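(* Let $(M,\phi_\alpha,\xi_\alpha,\eta_\alpha,g)$, $\alpha\in\{1,2,3\}$, be a $3$-quasi-Sasakian manifold of dimension $4n+3$ and rank $4l+3$, with $[\xi_\alpha,\xi_\beta]=c\,\xi_\gamma$ for every even permutation $(\alpha,\beta,\gamma)$ of $\{1,2,3\}$. With respect to the orthogonal decomposition $TM=\mathcal{E}^{4l+3}\oplus\mathcal{E}^{4m}$, the Ricci tensor is given by $\mathrm{Ric}(X,Y)=\frac{c^2}{2}(2l+1)g(X,Y)$ if $X,Y\in\Gamma(\mathcal{E}^{4l+3})$, and $\mathrm{Ric}(X,Y)=0$ elsewhere (i.e. if $X$ or $Y$ belongs to $\Gamma(\mathcal{E}^{4m})$). In particular, $M$ has positive scalar curvature $\frac{c^2}{2}(2l+1)(4l+3)$.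
   Context: Conventions: for a $1$-form $\eta$, $2d\eta(X,Y)=X(\eta(Y))-Y(\eta(X))-\eta([X,Y])$. An almost contact metric structure $(\phi,\xi,\eta,g)$ consists of a $(1,1)$-tensor $\phi$, a vector field $\xi$, a $1$-form $\eta$ and a Riemannian metric $g$ with $\phi^2=-I+\eta\otimes\xi$, $\eta(\xi)=1$, $g(\phi X,\phi Y)=g(X,Y)-\eta(X)\eta(Y)$. Its fundamental $2$-form is $\Phi(X,Y)=g(X,\phi Y)$. It is normal if $[\phi,\phi]+2d\eta\otimes\xi=0$ ($[\phi,\phi]$ the Nijenhuis torsion), and quasi-Sasakian if it is normal and $d\Phi=0$. A quasi-Sasakian structure has rank $2p+1$ if $\eta\wedge(d\eta)^p\neq0$ and $(d\eta)^{p+1}=0$ on $M$; only structures of constant rank are considered. A $3$-quasi-Sasakian manifold is a $(4n+3)$-dimensional manifold with three quasi-Sasakian structures $(\phi_\alpha,\xi_\alpha,\eta_\alpha,g)$, $\alpha=1,2,3$, with the same metric $g$, such that for every even permutation $(\alpha,\beta,\gamma)$ of $\{1,2,3\}$: $\phi_\gamma=\phi_\alpha\phi_\beta-\eta_\beta\otimes\xi_\alpha=-\phi_\beta\phi_\alpha+\eta_\alpha\otimes\xi_\beta$, $\xi_\gamma=\phi_\alpha\xi_\beta=-\phi_\beta\xi_\alpha$, $\eta_\gamma=\eta_\alpha\circ\phi_\beta=-\eta_\beta\circ\phi_\alpha$. It is known that there is $c\in\mathbb{R}$ with $[\xi_\alpha,\xi_\beta]=c\,\xi_\gamma$ for every even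 permutation, and that $\eta_1,\eta_2,\eta_3$ have the same rank, called the rank of $M$; it is $4l+1$ if $c=0$ and $4l+3$ if $c\ne0$, for some $0\le l\le n$. Put $m=n-l$, $\mathcal{V}=\langle\xi_1,\xi_2,\xi_3\rangle$, $\mathcal{H}=\bigcap_{\alpha=1}^3\ker\eta_\alpha=\mathcal{V}^\perp$. Let $\mathcal{E}^{4m}=\{X\in\mathcal{H}: i_Xd\eta_\alpha=0\text{ for some }\alpha\}$ (equivalently, for all $\alpha$), a distribution of rank $4m$, let $\mathcal{E}^{4l}$ be its orthogonal complement in $\mathcal{H}$, and $\mathcal{E}^{4l+3}=\mathcal{E}^{4l}\oplus\mathcal{V}$. *)

(* Defs.v *)
From HB Require Import structures.
From mathcomp Require Import all_boot all_order all_algebra all_fingroup.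
From mathcomp Require Import all_classical all_reals all_analysis.

Set Implicit Arguments.
Unset Strict Implicit.
Unset Printing Implicit Defensive.

Import Order.TTheory GRing.Theory Num.Theory numFieldNormedType.Exports.

Local Open Scope classical_set_scope.
Local Open Scope ring_scope.

(** * Smooth functions on open subsets of R^d *)

Section Smooth.
Variables (R : realType) (d : nat).

(* Meaningful for [U] open: ['D_v f x] only depends on [f] near [x]. *)
Fixpoint Ck (k : nat) (U : set 'rV[R]_d) (f : 'rV[R]_d -> R) : Prop :=
  (forall x, U x -> {for x, continuous f}) /\
  (if k is k'.+1 then
     forall v, (forall x, U x -> derivable f x v) /\ Ck k' U ('D_v f)
   else True).

Definition smooth (U : set 'rV[R]_d) (f : 'rV[R]_d -> R) := forall k, Ck k U f.

Definition smooth_mx (m n : nat) (U : set 'rV[R]_d)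
    (F : 'rV[R]_d -> 'M[R]_(m, n)) :=
  forall a b, smooth U (fun x => F x a b).

End Smooth.

(** * Smooth manifolds of dimension d *)

Record manifold (R : realType) (d : nat) := Manifold {
  points :> topologicalType;
  atlas : Type;
  chart_dom : atlas -> set points;
  chart : atlas -> points -> 'rV[R]_d;
  unchart : atlas -> 'rV[R]_d -> points;
  points_hausdorff : hausdorff_space points;
  points_second_countable : @second_countable points;
  chart_dom_open : forall i, open (chart_dom i);
  chart_dom_cover : forall p, exists i, chart_dom i p;
  chart_open : forall i, open (chart i @` chart_dom i);
  chartK : forall i p, chart_dom i p -> unchart i (chart i p) = p;
  chart_continuous : forall i p, chart_dom i p -> {for p, continuous (chart i)};
  unchart_continuous : forall i x, (chart i @` chart_dom i) x ->
    {for x, continuous (unchart i)};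
  transition_smooth : forall i j,
    smooth_mx (chart i @` (chart_dom i `&` chart_dom j)) (chart j \o unchart i)
}.

(** * Tensor fields

  A tensor field is the family of its components in the charts of the atlas,
  subject to the transformation law; the components in chart [i] at [p] only
  matter for [p] in [chart_dom i].  Tangent vectors are row vectors and
  covectors column vectors, so that a (1,1)-tensor with matrix [F] maps [v] to [v *m F];
  with this convention [v *m transition_jac i j p] are the components in chart
  [j] of the vector with components [v] in chart [i].  *)

Section TensorFields.
Variables (R : realType) (d : nat) (M : manifold R d).
Implicit Types (i j : atlas M) (p : M).

Definition vec_comps := atlas M -> M -> 'rV[R]_d.
Definition covec_comps := atlas M -> M -> 'cV[R]_d.
Definition mx_comps := atlas M -> M -> 'M[R]_d.

Definition transition_jac i j p : 'M[R]_d :=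
  'J (chart j \o unchart i) (chart i p).

Definition smooth_at_chart (m n : nat) i (U : set M) (F : M -> 'M[R]_(m, n)) :=
  smooth_mx (chart i @` U) (F \o unchart i).

Definition vector_field (X : vec_comps) :=
  (forall i, smooth_at_chart i (chart_dom i) (X i)) /\
  (forall i j p, chart_dom i p -> chart_dom j p ->
     X j p = X i p *m transition_jac i j p).

Definition one_form (eta : covec_comps) :=
  (forall i, smooth_at_chart i (chart_dom i) (eta i)) /\
  (forall i j p, chart_dom i p -> chart_dom j p ->
     eta i p = transition_jac i j p *m eta j p).

Definition tensor11 (phi : mx_comps) :=
  (forall i, smooth_at_chart i (chart_dom i) (phi i)) /\
  (forall i j p, chart_dom i p -> chart_dom j p ->
     phi i p *m transition_jac i j p = transition_jac i j p *m phi j p).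

(* Pointwise evaluation of 1-forms, (1,1)-tensors and metrics. *)
Definition ev (w : 'cV[R]_d) (v : 'rV[R]_d) : R := (v *m w) 0 0.
Definition ap (F : 'M[R]_d) (v : 'rV[R]_d) : 'rV[R]_d := v *m F.
Definition ip (G : 'M[R]_d) (v w : 'rV[R]_d) : R := (v *m G *m w^T) 0 0.

Definition riemannian_metric (g : mx_comps) :=
  [/\ forall i, smooth_at_chart i (chart_dom i) (g i),
      forall i j p, chart_dom i p -> chart_dom j p ->
        g i p = transition_jac i j p *m g j p *m (transition_jac i j p)^T,
      forall i p, chart_dom i p -> forall v w, ip (g i p) v w = ip (g i p) w v
    & forall i p, chart_dom i p -> forall v, v != 0 -> 0 < ip (g i p) v v].

End TensorFields.

(** * Local calculus in a chart

  In this section [i] is a chart; a vector field, 1-form, (1,1)-tensor or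
  metric on an open subset of [chart_dom i] is given by its components in
  [i].  *)

Section LocalCalculus.
Variables (R : realType) (d : nat) (M : manifold R d) (i : atlas M).
Implicit Types (X Y Z : M -> 'rV[R]_d) (eta : M -> 'cV[R]_d).
Implicit Types (phi g : M -> 'M[R]_d) (f : M -> R) (p : M).

(* X(f) *)
Definition deriv X f p : R := 'D_(X p) (f \o unchart i) (chart i p).

(* The coordinate vector field d/dx_a, and the constant extension of a
   tangent vector. *)
Definition const_field (v : 'rV[R]_d) : M -> 'rV[R]_d := fun=> v.
Definition coord_field (a : 'I_d) : M -> 'rV[R]_d := const_field (delta_mx 0 a).

Definition bracket X Y p : 'rV[R]_d :=
  'D_(X p) (Y \o unchart i) (chart i p) - 'D_(Y p) (X \o unchart i) (chart i p).

(* 2 d eta(X, Y) = X(eta(Y)) - Y(eta(X)) - eta([X, Y]) *)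
Definition dext eta X Y p : R :=
  2^-1 * (deriv X (fun q => ev (eta q) (Y q)) p
          - deriv Y (fun q => ev (eta q) (X q)) p
          - ev (eta p) (bracket X Y p)).

Definition nijenhuis phi X Y p : 'rV[R]_d :=
  let phiX q := ap (phi q) (X q) in
  let phiY q := ap (phi q) (Y q) in
  ap (phi p) (ap (phi p) (bracket X Y p)) + bracket phiX phiY p
  - ap (phi p) (bracket phiX Y p) - ap (phi p) (bracket X phiY p).

Definition fund_form phi g X Y p : R := ip (g p) (X p) (ap (phi p) (Y p)).

Definition dfund_form phi g X Y Z p : R :=
  let Phi := fund_form phi g in
  3^-1 * (deriv X (Phi Y Z) p + deriv Y (Phi Z X) p + deriv Z (Phi X Y) p
          - Phi (bracket X Y) Z p - Phi (bracket Y Z) X p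
          - Phi (bracket Z X) Y p).

(* Right-hand side of Koszul's formula for [2 g(nabla_X Y, Z)]. *)
Definition koszul g X Y Z p : R :=
  let gg X Y q := ip (g q) (X q) (Y q) in
  deriv X (gg Y Z) p + deriv Y (gg X Z) p - deriv Z (gg X Y) p
  + gg (bracket X Y) Z p - gg (bracket X Z) Y p - gg (bracket Y Z) X p.

(* The vector whose inner product with each d/dx_a is half of
   [koszul g X Y (coord_field a)]. *)
Definition levi_civita g X Y p : 'rV[R]_d :=
  (\row_a (2^-1 * koszul g X Y (coord_field a) p)) *m invmx (g p).

Definition curvature g X Y Z p : 'rV[R]_d :=
  let nabla := levi_civita g in
  nabla X (nabla Y Z) p - nabla Y (nabla X Z) p - nabla (bracket X Y) Z p.

(* Ric(X, Y) is the trace of Z |-> R(Z, X)Y. *)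
Definition ricci g X Y p : R := \sum_a (curvature g (coord_field a) X Y p) 0 a.

Definition scalar_curvature g p : R :=
  \sum_a \sum_b invmx (g p) a b * ricci g (coord_field a) (coord_field b) p.

(* d eta at [p] as a bilinear form on the tangent space; the constant
   extension is harmless since d eta is tensorial. *)
Definition dext_at eta p (v w : 'rV[R]_d) : R :=
  dext eta (const_field v) (const_field w) p.

End LocalCalculus.

(** * Exterior powers *)

Section Wedge.
Variables (R : realType) (V : Type).

Definition form (k : nat) := ('I_k -> V) -> R.

Definition wedge (k l : nat) (om : form k) (th : form l) : form (k + l) :=
  fun v => (k + l)`!%:R^-1 *
    \sum_(s : 'S_(k + l)) (-1) ^+ s *
      om (fun a => v (s (lshift l a))) * th (fun b => v (s (rshift k b))).

Fixpoint wedge_pow (om : form 2) (r : nat) : form (r * 2) :=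
  if r is r'.+1 then @wedge 2 (r' * 2) om (@wedge_pow om r') else fun=> 1.

End Wedge.

Arguments wedge {R V k l} om th v.
Arguments wedge_pow {R V} om r v.

(** * Almost contact metric and 3-quasi-Sasakian structures *)

Section Contact.
Variables (R : realType) (d : nat) (M : manifold R d).
Implicit Types (i : atlas M) (p : M) (phi g : mx_comps M).
Implicit Types (xi : vec_comps M) (eta : covec_comps M).

Definition almost_contact_metric phi xi eta g :=
  [/\ [/\ tensor11 phi, vector_field xi, one_form eta & riemannian_metric g],
      forall i p, chart_dom i p -> forall v,
        ap (phi i p) (ap (phi i p) v) = - v + ev (eta i p) v *: xi i p,
      forall i p, chart_dom i p -> ev (eta i p) (xi i p) = 1
    & forall i p, chart_dom i p -> forall v w,
        ip (g i p) (ap (phi i p) v) (ap (phi i p) w) =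
        ip (g i p) v w - ev (eta i p) v * ev (eta i p) w].

Definition normal phi xi eta :=
  forall i (X Y : M -> 'rV[R]_d),
    smooth_at_chart i (chart_dom i) X -> smooth_at_chart i (chart_dom i) Y ->
  forall p, chart_dom i p ->
    nijenhuis i (phi i) X Y p + (2 * dext i (eta i) X Y p) *: xi i p = 0.

Definition closed_fund_form phi g :=
  forall i (X Y Z : M -> 'rV[R]_d),
    smooth_at_chart i (chart_dom i) X -> smooth_at_chart i (chart_dom i) Y ->
    smooth_at_chart i (chart_dom i) Z ->
  forall p, chart_dom i p -> dfund_form i (phi i) (g i) X Y Z p = 0.

Definition quasi_sasakian phi xi eta g :=
  [/\ almost_contact_metric phi xi eta g, normal phi xi eta
    & closed_fund_form phi g].

Definition has_rank eta (r : nat) := exists2 q : nat, r = (2 * q + 1)%N &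
  forall i p, chart_dom i p ->
    let eta1 : form R 'rV[R]_d 1 := fun v => ev (eta i p) (v ord0) in
    let deta : form R 'rV[R]_d 2 :=
      fun v => dext_at i (eta i) p (v ord0) (v ord_max) in
    (exists v, wedge eta1 (wedge_pow deta q) v <> 0) /\
    (forall v, wedge_pow deta q.+1 v = 0).

Section ThreeStructures.
Variables (phi : 'I_3 -> mx_comps M) (xi : 'I_3 -> vec_comps M).
Variables (eta : 'I_3 -> covec_comps M) (g : mx_comps M).

(* (s 0, s 1, s 2) is the permutation (alpha, beta, gamma). *)
Definition three_quasi_sasakian :=
  (forall al, quasi_sasakian (phi al) (xi al) (eta al) g) /\
  (forall s : 'S_3, ~~ odd_perm s ->
   let al := s 0 in let be := s 1 in let ga := s 2 in
   forall i p, chart_dom i p ->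
   [/\ forall v, ap (phi ga i p) v =
         ap (phi al i p) (ap (phi be i p) v) - ev (eta be i p) v *: xi al i p,
       forall v, ap (phi ga i p) v =
         - ap (phi be i p) (ap (phi al i p) v) + ev (eta al i p) v *: xi be i p,
       xi ga i p = ap (phi al i p) (xi be i p) /\
       xi ga i p = - ap (phi be i p) (xi al i p),
       forall v, ev (eta ga i p) v = ev (eta al i p) (ap (phi be i p) v)
     & forall v, ev (eta ga i p) v = - ev (eta be i p) (ap (phi al i p) v)]).

Definition rank_is (r : nat) := forall al, has_rank (eta al) r.

Definition reeb_brackets (c : R) :=
  forall s : 'S_3, ~~ odd_perm s ->
  forall i p, chart_dom i p ->
    bracket i (xi (s 0) i) (xi (s 1) i) p = c *: xi (s 2) i p.

(* The distributions at [p], as sets of components in chart [i]. *)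
Definition distH i p : set 'rV[R]_d :=
  [set v | forall al, ev (eta al i p) v = 0].

(* E^{4m} *)
Definition distEm i p : set 'rV[R]_d :=
  [set v | distH i p v /\
           exists al, forall w, dext_at i (eta al i) p v w = 0].

(* E^{4l} *)
Definition distEl i p : set 'rV[R]_d :=
  [set v | distH i p v /\
           forall w, distEm i p w -> ip (g i p) v w = 0].

(* E^{4l+3} *)
Definition distEl3 i p : set 'rV[R]_d :=
  [set v | exists2 h, distEl i p h &
           exists a : 'I_3 -> R, v = h + \sum_al a al *: xi al i p].

End ThreeStructures.

(* Components in [i] of smooth sections, over an open [U] contained in
   [chart_dom i], of a distribution [D]. *)
Definition section_on i (U : set M) (D : M -> set 'rV[R]_d)
    (X : M -> 'rV[R]_d) :=
  smooth_at_chart i U X /\ forall p, U p -> D p (X p).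

End Contact.

(* Main.v *)
(** Everything is local, so it is enough to compute in one chart.  For each
    structure, normality and closedness of the fundamental form make [xi_a] a
    Killing field and determine [nabla phi_a] (Blair's identity).  The
    quaternionic relations then force the three endomorphisms built from
    [nabla xi_a] to coincide with one symmetric field [A] such that
    [nabla_u xi_a = - phi_a (A u)], [A] commutes with each [phi_a] and
    [A xi_a = mu xi_a] with [mu = c / 2].  The Bianchi identity and the closedness of
    [d eta_a] yield first [A^2 = mu A] and then [nabla A = 0]; hence, if [mu <> 0],
    [A / mu] is the orthogonal projection onto [E^{4l+3}].  Subtracting from the
    curvature [K] the model [K0(u, v) w = g(w, Av) Au - g(w, Au) Av] leaves a curvature-like
    tensor that commutes with the [phi_a] and kills the [xi_a], so it is Ricci-flat as in the
    hyperkaehler case.  Therefore [Ric(u, v) = (tr A - mu) g(A u, v)], and the rank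
    of [d eta_a], read off with Pfaffians, gives [mu <> 0] and [tr A = mu (4l + 3)]. *)

Require Import Defs.
From mathcomp Require Import all_boot all_order all_algebra all_fingroup.
From mathcomp Require Import all_classical all_reals all_analysis.
From mathcomp Require Import ring lra zify.
Set Implicit Arguments.
Unset Strict Implicit.
Unset Printing Implicit Defensive.
Import Order.TTheory GRing.Theory Num.Theory numFieldNormedType.Exports.
Local Open Scope classical_set_scope.
Local Open Scope ring_scope.

(** * Differential calculus *)

(** [Ck] only speaks of directional derivatives: their linearity in the direction and the symmetry
    of second derivatives are not part of it and come from the mean value theorem. Geometric
    identities are tested on constant fields of a chart, whose brackets vanish, and endomorphisms
    act on row vectors from the right, so compositions appear in reversed order. The endomorphism
    phi_a (nabla xi_a) kills xi_a but multiplies the other two Reeb fields by mu; adding mu eta_a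
    (x) xi_a repairs this and makes the three candidates for [A] comparable. Each of the two terms
    nabla_{xi_a} xi_b and - nabla_{xi_b} xi_a of the bracket contributes one eigenvalue, whence mu =
    c / 2. The order A^2 = mu A, then nabla A = 0, is imposed: differentiating A phi_a = phi_a A
    leaves terms that cancel only when A^2 = mu A. That mu <> 0 is read from the rank: mu = 0 would
    give A^2 = 0, so A = 0 by symmetry, so d eta_a = 0, whereas (d eta_a)^(2l+1) does not vanish.
    The constant is mu (tr A - mu) = mu^2 (4l + 2) = (c^2 / 2) (2l + 1). *)

Section DirectionalDerivatives.
Variables (R : realType) (V : normedModType R).
Implicit Types (f : V -> R) (x u v : V) (A U : set V).

Lemma is_derive_line f x v (t : R) : derivable f (t *: v + x) v ->
  is_derive t 1 (fun s : R => f (s *: v + x)) ('D_v f (t *: v + x)).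
Proof.
have E : (fun h : R => h^-1 *: (((fun s : R => f (s *: v + x)) \o shift t) (h *: 1)
    - (fun s : R => f (s *: v + x)) t)) =
  (fun h : R => h^-1 *: ((f \o shift (t *: v + x)) (h *: v) - f (t *: v + x))).
  by apply/funext => h /=; rewrite /= [h%:A]mulr1 scalerDl addrA.
move=> df; apply: DeriveDef; first by rewrite /derivable E.
by rewrite /derive E.
Qed.

Lemma MVT_line f x v (t : R) : 0 < t ->
  (forall s, 0 <= s <= t -> derivable f (s *: v + x) v) ->
  exists2 s, 0 <= s <= t & f (t *: v + x) - f x = t * 'D_v f (s *: v + x).
Proof.
move=> t0 df.
have /= [||c ct] := @MVT R (fun s => f (s *: v + x))
  (fun s => 'D_v f (s *: v + x)) 0 t t0.
- move=> s; rewrite in_itv /= => /andP[s0 st].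
  by apply: is_derive_line; apply: df; rewrite !ltW.
- apply: derivable_within_continuous => s; rewrite in_itv /= => st.
  by have [] := is_derive_line (df _ st).
rewrite scale0r add0r subr0 mulrC => ->; exists c => //.
by move: ct; rewrite in_itv /= => /andP[? ?]; rewrite !ltW.
Qed.

(** Uniform in both coefficients: the mean value theorem gives no control on where its point lies,
    so the whole parallelogram spanned by [h *: u] and [h *: v] must be inside [A]. *)
Lemma near_box A x u v : nbhs x A ->
  \forall h \near (0:R)^'+, forall a b, 0 <= a <= h -> 0 <= b <= h ->
    A (a *: u + b *: v + x).
Proof.
move=> /nbhs_ballP[e /= e0 eA].
have N0 : 0 < `|u| + `|v| + 1 by rewrite ltr_pwDr// addr_ge0.
near=> h => a b /andP[a0 ah] /andP[b0 bh]; apply: eA.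
rewrite -ball_normE /ball_/= opprD addrCA subrr addr0 normrN.
have h0 : 0 < h by [].
apply: (@le_lt_trans _ _ (h * (`|u| + `|v|))).
  rewrite (le_trans (ler_normD _ _))// !normrZ !ger0_norm// mulrDr.
  by rewrite lerD// ler_wpM2r.
apply: (@lt_trans _ _ (h * (`|u| + `|v| + 1))); first by rewrite ltr_pM2l// ltrDl.
rewrite -ltr_pdivlMr//; near: h; apply: nbhs_right_lt.
by rewrite divr_gt0.
Unshelve. all: by end_near. Qed.

Lemma near_derive f x v (e : R) : derivable f x v -> 0 < e ->
  \forall h \near (0:R)^'+, `|f (h *: v + x) - f x - h * 'D_v f x| <= e * h.
Proof.
move=> df e0; have /cvgrPdist_le/(_ e e0) : h^-1 *: ((f \o shift x) (h *: v) - f x)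
  @[h --> 0^'] --> 'D_v f x by exact: df.
move=> /nbhs_ballP[r /= r0 rd].
near=> h.
have h0 : 0 < h by [].
have := rd h; rewrite /ball /= sub0r normrN gtr0_norm// => /(_ _ _).
have hr : h < r by near: h; exact: nbhs_right_lt.
move=> /(_ hr (lt0r_neq0 h0)) H.
rewrite -ler_pdivrMr// -[X in `|_| / X]gtr0_norm// -normf_div distrC in H *.
by rewrite mulrBl mulrC [h * _]mulrC mulfK ?gt_eqF.
Unshelve. all: by end_near. Qed.

Lemma eq_of_ler_eps (a b C : R) : (forall e, 0 < e -> `|a - b| <= C * e) -> a = b.
Proof.
move=> H; apply/eqP; rewrite -subr_eq0 -normr_le0.
apply/ler_addgt0Pl => e e0; rewrite addr0.
have C0 : 0 < `|C| + 1 by rewrite ltr_wpDl.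
have := H (e / (`|C| + 1)) (divr_gt0 e0 C0); move/le_trans; apply.
rewrite mulrA ler_pdivrMr// mulrC ler_wpM2l ?(ltW e0)//.
by rewrite (le_trans (ler_norm _))// lerDl.
Qed.

(** The increment along [u + v] is the sum of the increments along two sides of a parallelogram. The
    mean value theorem turns each of them into a value of ['D_u f] or ['D_v f] near [x], and
    continuity at [x] concludes. *)
Lemma deriveDv f x u v U : open U -> U x ->
  (forall w y, U y -> derivable f y w) ->
  {for x, continuous ('D_u f)} -> {for x, continuous ('D_v f)} ->
  'D_(u + v) f x = 'D_u f x + 'D_v f x.
Proof.
(* Three errors of size [e] add up: the difference quotient along [u + v] and the two sides. *)
move=> oU Ux df cu cv; apply: (@eq_of_ler_eps _ _ 3) => e e0.
have nU : nbhs x U by exact: open_nbhs_nbhs.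
have N1 := near_box u v nU.
have N2 := near_derive (df (u + v) _ Ux) e0.
have N3 := @near_box (fun y => `|'D_u f x - 'D_u f y| <= e) x u v
  ((cvgrPdist_le _ _).1 cu e e0).
have N4 := @near_box (fun y => `|'D_v f x - 'D_v f y| <= e) x u v
  ((cvgrPdist_le _ _).1 cv e e0).
have [h [h0 [Ub [Duv [Du Dv]]]]] := filter_ex (filterI (nbhs_right_gt (0:R))
  (filterI N1 (filterI N2 (filterI (N3 _) (N4 _))))).
have hh : 0 <= h <= h by rewrite lexx ltW.
have z0 : 0 <= (0:R) <= h by rewrite lexx ltW.
have [s sh E1] := @MVT_line f x u h h0 (fun s hs =>
  df u _ (eq_ind _ U (Ub s 0 hs z0) _ (congr1 (+%R^~ x) (etrans (congr1 (+%R _) (scale0r _)) (addr0 _))))).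
have [|t th E2] := @MVT_line f (h *: u + x) v h h0.
  by move=> t th; apply: df; rewrite addrA [t *: v + _]addrC; exact: Ub.
move: Duv; rewrite scalerDr.
have -> : f (h *: u + h *: v + x) - f x = h * 'D_v f (h *: u + t *: v + x) + h * 'D_u f (s *: u + 0 *: v + x).
  rewrite scale0r addr0 -E1 [h *: u + t *: v]addrC -[in RHS]addrA -E2.
  by rewrite addrA subrK [h *: u + _]addrC addrA.
have := Du _ _ sh z0; have := Dv _ _ hh th.
move: ('D_v f (_ + _ + _)) ('D_u f (_ + _ + _)) => a b.
move: ('D_u f x) ('D_v f x) ('D_(u + v) f x) => p q r.
rewrite !ler_norml -!mulrDr -mulrBr => /andP[A1 A2] /andP[B1 B2].
rewrite [e * h]mulrC -mulrN !ler_pM2l// => /andP[C1 C2].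
by clear -A1 A2 B1 B2 C1 C2; apply/andP; split; lra. Qed.

(** The mean value theorem is used twice, along [u] for [y |-> f (h *: v + y) - f y] and then along
    [v] for ['D_u f]. The second difference on the left is symmetric in [u] and [v], which
    [derive_comm] exploits. *)
Lemma derive_difference f x u v U (h : R) : 0 < h ->
  (forall a b, 0 <= a <= h -> 0 <= b <= h -> U (a *: u + b *: v + x)) ->
  (forall w y, U y -> derivable f y w) ->
  (forall w y, U y -> derivable ('D_u f) y w) ->
  exists a b, [/\ 0 <= a <= h, 0 <= b <= h &
    f (h *: u + h *: v + x) - f (h *: u + x) - f (h *: v + x) + f x =
    h ^+ 2 * 'D_v ('D_u f) (a *: u + b *: v + x)].
Proof.
move=> h0 Ub df ddf.
have hh : 0 <= h <= h by rewrite lexx ltW.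
have z0 : 0 <= (0:R) <= h by rewrite lexx ltW.
have Uh s : 0 <= s <= h -> U (s *: u + (h *: v + x)).
  by move=> hs; rewrite addrA; exact: Ub.
have U0 s : 0 <= s <= h -> U (s *: u + x).
  by move=> hs; have := Ub _ _ hs z0; rewrite scale0r addr0.
pose psi y := f (h *: v + y) - f y.
have dpsi s : 0 <= s <= h -> is_derive (s *: u + x) u psi
    ('D_u f (s *: u + (h *: v + x)) - 'D_u f (s *: u + x)).
  move=> hs; apply: is_deriveB; last first.
    by apply: derivableP; apply: df; exact: U0.
  have E : (fun k : R => k^-1 *: (((fun y => f (h *: v + y)) \o shift (s *: u + x)) (k *: u)
      - f (h *: v + (s *: u + x)))) =
    (fun k : R => k^-1 *: ((f \o shift (s *: u + (h *: v + x))) (k *: u)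
      - f (s *: u + (h *: v + x)))).
    apply/funext => k /=; congr (_ *: (f _ - f _)); last by rewrite addrCA.
    by rewrite addrCA; congr (_ + _); rewrite addrCA.
  have := df u _ (Uh _ hs) => dfs.
  by apply: DeriveDef; rewrite /derivable /derive E.
have [|a ah E1] := @MVT_line psi x u h h0.
  by move=> s hs; have [] := dpsi s hs.
have [|b bh E2] := @MVT_line ('D_u f) (a *: u + x) v h h0.
  by move=> s hs; apply: ddf; rewrite addrA [s *: v + _]addrC; exact: Ub.
exists a, b; split; [exact: ah|exact: bh|].
have [_ Ea] := dpsi a ah.
rewrite expr2 -mulrA [a *: u + b *: v]addrC -[b *: v + _ + _]addrA -E2.
rewrite addrCA -Ea -E1 /psi [h *: v + (_ + _)]addrCA addrA.
by move: (f _) (f (h *: u + x)) (f (h *: v + x)) (f x) => p q r s; ring.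
Qed.

(** Schwarz's theorem: the same second difference, divided by [h ^+ 2], is a value of either mixed
    derivative somewhere in a small parallelogram, and both are continuous at [x]. *)
Lemma derive_comm f x u v U : open U -> U x ->
  (forall w y, U y -> derivable f y w) ->
  (forall w w' y, U y -> derivable ('D_w f) y w') ->
  (forall w w', {for x, continuous ('D_w ('D_w' f))}) ->
  'D_u ('D_v f) x = 'D_v ('D_u f) x.
Proof.
move=> oU Ux df ddf c2; apply: (@eq_of_ler_eps _ _ 2) => e e0.
have nU : nbhs x U by exact: open_nbhs_nbhs.
have N1 := near_box u v nU.
have N2 := near_box v u nU.
have N3 := @near_box (fun y => `|'D_v ('D_u f) x - 'D_v ('D_u f) y| <= e) x u v
  ((cvgrPdist_le _ _).1 (c2 v u) e e0).
have N4 := @near_box (fun y => `|'D_u ('D_v f) x - 'D_u ('D_v f) y| <= e) x v u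
  ((cvgrPdist_le _ _).1 (c2 u v) e e0).
have [h [h0 [Ub [Ub' [Du Dv]]]]] := filter_ex (filterI (nbhs_right_gt (0:R))
  (filterI N1 (filterI N2 (filterI (N3 _) (N4 _))))).
have [a [b [ah bh E]]] := derive_difference h0 Ub df (ddf u).
have [a' [b' [ah' bh' E']]] := derive_difference h0 Ub' df (ddf v).
have := Du _ _ ah bh; have := Dv _ _ ah' bh'.
have -> : 'D_u ('D_v f) (a' *: v + b' *: u + x) = 'D_v ('D_u f) (a *: u + b *: v + x).
  apply: (@mulfI _ (h ^+ 2)); first by rewrite expf_neq0 ?gt_eqF.
  apply: etrans (esym E') (etrans _ E); rewrite [h *: v + h *: u]addrC.
  by move: (f _) (f _) (f _) (f _) => p q r s; ring.
move: ('D_v _ (_ + _)) ('D_u ('D_v f) x) ('D_v ('D_u f) x) => z p q.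
rewrite !ler_norml => /andP[A1 A2] /andP[B1 B2].
by clear -A1 A2 B1 B2; apply/andP; split; lra. Qed.

End DirectionalDerivatives.

(** * Closure properties of smooth functions; their derivatives are linear in the direction and
    commute *)

Section SmoothFunctions.
Variables (R : realType) (d : nat).
Implicit Types (f g : 'rV[R]_d -> R) (U : set 'rV[R]_d) (x v w : 'rV[R]_d) (k : nat).

Lemma near_open U x (P : 'rV[R]_d -> Prop) : open U -> U x ->
  (forall y, U y -> P y) -> \forall y \near x, P y.
Proof. by move=> oU Ux UP; apply: filterS (open_nbhs_nbhs (conj oU Ux)). Qed.

Lemma Ck_eq k U f g : open U -> (forall x, U x -> f x = g x) -> Ck k U f -> Ck k U g.
Proof.
move=> oU; elim: k f g => [|k IH] f g fg [cf df]; split => //.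
- move=> x Ux; rewrite /prop_for /continuous_at -fg//.
  exact: cvg_trans (near_eq_cvg (near_open oU Ux fg)) (cf x Ux).
- move=> x Ux; rewrite /prop_for /continuous_at -fg//.
  exact: cvg_trans (near_eq_cvg (near_open oU Ux fg)) (cf x Ux).
- move=> v; have [d1 d2] := df v; split=> [x Ux|].
    by exact: near_eq_derivable (near_open oU Ux fg) (d1 x Ux).
  apply: IH d2 => x Ux; exact: near_eq_derive (near_open oU Ux fg).
Qed.

Lemma CkW k U f : Ck k.+1 U f -> Ck k U f.
Proof.
elim: k f => [|k IH] f [cf df]; split=> // v.
by have [d1 d2] := df v; split=> //; exact: IH.
Qed.

Lemma Ck_cst k U (a : R) : Ck k U (cst a).
Proof.
have C0 b x : U x -> {for x, continuous (cst b : _ -> R)} by move=> _; apply: (@cst_continuous _ _ b).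
elim: k a => [|k IH] a; (split; first by move=> x; exact: C0) => //.
move=> v; split=> [x _|]; first exact: derivable_cst.
have -> : 'D_v (cst a : 'rV[R]_d -> R) = cst 0 by apply/funext => x; exact: derive_cst.
exact: IH.
Qed.

Lemma CkD k U f g : open U -> Ck k U f -> Ck k U g -> Ck k U (fun x => f x + g x).
Proof.
move=> oU; elim: k f g => [|k IH] f g [cf df] [cg dg]; (split;
  first by move=> x Ux; exact: (continuousD (cf x Ux) (cg x Ux))) => //.
move=> v; have [d1 d2] := df v; have [e1 e2] := dg v; split=> [x Ux|].
  by apply: derivableD; [exact: d1|exact: e1].
apply: Ck_eq (IH _ _ d2 e2) => // x Ux; rewrite -deriveD; [by []|exact: d1|exact: e1].
Qed.

Lemma CkM k U f g : open U -> Ck k U f -> Ck k U g -> Ck k U (fun x => f x * g x).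
Proof.
move=> oU; elim: k f g => [|k IH] f g Cf Cg; have [cf df] := Cf; have [cg dg] := Cg; (split;
  first by move=> x Ux; exact: (continuousM (cf x Ux) (cg x Ux))) => //.
move=> v; have [d1 d2] := df v; have [e1 e2] := dg v; split=> [x Ux|].
  by apply: derivableM; [exact: d1|exact: e1].
apply: Ck_eq (CkD oU (IH _ _ (CkW Cf) e2) (IH _ _ (CkW Cg) d2)) => // x Ux.
by rewrite -[LHS]/(_ *: _ + _ *: _) -deriveM; [by []|exact: d1|exact: e1].
Qed.

Lemma CkN k U f : open U -> Ck k U f -> Ck k U (fun x => - f x).
Proof.
move=> oU Cf; apply: Ck_eq (CkM oU (Ck_cst k U (-1)) Cf) => // x _.
by rewrite /= mulN1r.
Qed.

Lemma CkV k U f : open U -> (forall x, U x -> f x != 0) -> Ck k U f ->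
  Ck k U (fun x => (f x)^-1).
Proof.
move=> oU f0; elim: k f f0 => [|k IH] f f0 Cf; have [cf df] := Cf; (split;
  first by move=> x Ux; exact: (cvgV (f0 x Ux) (cf x Ux))) => //.
move=> v; have [d1 d2] := df v; split=> [x Ux|].
  by apply: derivableV; [exact: f0|exact: d1].
have Ci := IH _ f0 (CkW Cf).
apply: Ck_eq (CkN oU (CkM oU (CkM oU Ci Ci) d2)) => // x Ux.
have := deriveV (f0 x Ux) (d1 x Ux); rewrite -[RHS]/(_ * _) => ->.
by rewrite expr2 invfM mulNr.
Qed.

Lemma smooth_eq U f g : open U -> (forall x, U x -> f x = g x) -> smooth U f -> smooth U g.
Proof. by move=> oU fg sf k; exact: Ck_eq (sf k). Qed.

Lemma smooth_cst U (a : R) : smooth U (fun=> a).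
Proof. by move=> k; exact: Ck_cst. Qed.

Lemma smoothD U f g : open U -> smooth U f -> smooth U g -> smooth U (fun x => f x + g x).
Proof. by move=> oU sf sg k; exact: CkD. Qed.

Lemma smoothM U f g : open U -> smooth U f -> smooth U g -> smooth U (fun x => f x * g x).
Proof. by move=> oU sf sg k; exact: CkM. Qed.

Lemma smoothN U f : open U -> smooth U f -> smooth U (fun x => - f x).
Proof. by move=> oU sf k; exact: CkN. Qed.

Lemma smoothV U f : open U -> (forall x, U x -> f x != 0) -> smooth U f ->
  smooth U (fun x => (f x)^-1).
Proof. by move=> oU f0 sf k; exact: CkV. Qed.

Lemma smooth_sum U (I : Type) (r : seq I) (P : pred I) (F : I -> 'rV[R]_d -> R) :
  open U -> (forall i, smooth U (F i)) -> smooth U (fun x => \sum_(i <- r | P i) F i x).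
Proof.
move=> oU sF; elim: r => [|i r IH].
  by apply: smooth_eq (smooth_cst U 0) => // x _; rewrite big_nil.
apply: (@smooth_eq _ (fun x => (if P i then F i x else 0) + \sum_(i <- r | P i) F i x)) => //.
  move=> x _; rewrite big_cons; case: ifP => _ //; exact: add0r.
by apply: smoothD => //; case: (P i); [exact: sF|exact: smooth_cst].
Qed.

Lemma smooth_prod U (I : Type) (r : seq I) (F : I -> 'rV[R]_d -> R) :
  open U -> (forall i, smooth U (F i)) -> smooth U (fun x => \prod_(i <- r) F i x).
Proof.
move=> oU sF; elim: r => [|i r IH].
  by apply: smooth_eq (smooth_cst U 1) => // x _; rewrite big_nil.
apply: (@smooth_eq _ (fun x => F i x * \prod_(i <- r) F i x)) => //.
  by move=> x _; rewrite big_cons.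
by apply: smoothM.
Qed.

Lemma smooth_derivable U f x v : smooth U f -> U x -> derivable f x v.
Proof. by move=> sf Ux; have [_ /(_ v)[+ _]] := sf 1%N; apply. Qed.

Lemma smooth_continuous U f x : smooth U f -> U x -> {for x, continuous f}.
Proof. by move=> sf; have [+ _] := sf 0%N; apply. Qed.

Lemma smooth_derive U f v : smooth U f -> smooth U ('D_v f).
Proof. by move=> sf k; have [_ /(_ v)[_]] := sf k.+1. Qed.

Lemma smooth_subset U U' f : U' `<=` U -> smooth U f -> smooth U' f.
Proof.
move=> UU sf k; elim: k f sf => [|k IH] f sf; split=> //.
- by move=> x /UU; exact: smooth_continuous.
- by move=> x /UU; exact: smooth_continuous.
- move=> v; split=> [x /UU|]; first exact: smooth_derivable.
  by apply: IH; exact: smooth_derive.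
Qed.

Lemma smooth_deriveD U f x u v : open U -> smooth U f -> U x ->
  'D_(u + v) f x = 'D_u f x + 'D_v f x.
Proof.
move=> oU sf Ux; apply: (deriveDv oU Ux).
- by move=> w y Uy; exact: smooth_derivable Uy.
- exact: smooth_continuous (smooth_derive _ sf) Ux.
- exact: smooth_continuous (smooth_derive _ sf) Ux.
Qed.

Lemma smooth_derive_comm U f x u v : open U -> smooth U f -> U x ->
  'D_u ('D_v f) x = 'D_v ('D_u f) x.
Proof.
move=> oU sf Ux; apply: (@derive_comm R _ f x u v U oU Ux).
- by move=> w y Uy; exact: smooth_derivable Uy.
- by move=> w w' y Uy; exact: (@smooth_derivable U ('D_w f) y w' (smooth_derive w sf) Uy).
- by move=> w w'; exact: smooth_continuous (smooth_derive _ (smooth_derive _ sf)) Ux.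
Qed.

Lemma smooth_deriveZ U f x v (a : R) : smooth U f -> U x ->
  'D_(a *: v) f x = a * 'D_v f x.
Proof.
move=> sf Ux.
have d0 w : is_derive (0 : R) 1 (fun s : R => f (s *: w + x)) ('D_w f x).
  have /(_ f x w 0) := @is_derive_line R 'rV[R]_d; rewrite scale0r add0r; apply.
  exact: smooth_derivable Ux.
have g0 : is_derive (0 : R) 1 (fun s : R => a * s) a.
  have := is_deriveZ a (is_derive_id (0 : R) (1 : R)).
  by rewrite [_ *: 1]mulr1.
have f0 : is_derive (a * 0 : R) 1 (fun s : R => f (s *: v + x)) ('D_v f x).
  by rewrite mulr0.
have := is_derive1_comp f0 g0.
have -> : (fun s : R => f (s *: v + x)) \o (fun s : R => a * s) =
  (fun s : R => f (s *: (a *: v) + x)).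
  by apply/funext => s /=; rewrite scalerA mulrC.
move=> [_ E]; have [_ E'] := d0 (a *: v).
by rewrite -E' E mulrC.
Qed.

End SmoothFunctions.

Fact pd_key : unit. Proof. by []. Qed.

(* Entrywise derivative, locked because unification otherwise unfolds ['D_v] to a limit. *)
Definition pd (R : realType) (d m n : nat) (v : 'rV[R]_d)
    (F : 'rV[R]_d -> 'M[R]_(m, n)) (x : 'rV[R]_d) : 'M[R]_(m, n) :=
  locked_with pd_key (\matrix_(i, j) 'D_v (fun y => F y i j) x).

(** * Calculus of matrix-valued functions, entry by entry *)

Section MatrixCalculus.
Variables (R : realType) (d : nat) (U : set 'rV[R]_d).
Hypothesis oU : open U.
Implicit Types (m n p : nat) (x v w : 'rV[R]_d).

Lemma pd_entry m n v (F : 'rV[R]_d -> 'M[R]_(m, n)) x i j :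
  pd v F x i j = 'D_v (fun y => F y i j) x.
Proof. by rewrite /pd unlock mxE. Qed.

Lemma pdE m n v (F : 'rV[R]_d -> 'M[R]_(m, n)) x :
  smooth_mx U F -> U x -> 'D_v F x = pd v F x.
Proof.
move=> sF Ux; rewrite derive_mx ?[pd]unlock; last first.
  by apply/derivable_mxP => i j; exact: smooth_derivable (sF i j) Ux.
by apply/matrixP => i j; rewrite pd_entry mxE.
Qed.

Lemma pd_eq m n v (F G : 'rV[R]_d -> 'M[R]_(m, n)) x :
  (forall y, U y -> F y = G y) -> U x -> pd v F x = pd v G x.
Proof.
move=> FG Ux; apply/matrixP => i j; rewrite !pd_entry.
apply: near_eq_derive; apply: (near_open oU Ux) => y Uy.
by rewrite FG.
Qed.

Lemma smooth_mx_eq m n (F G : 'rV[R]_d -> 'M[R]_(m, n)) :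
  (forall y, U y -> F y = G y) -> smooth_mx U F -> smooth_mx U G.
Proof. by move=> FG sF i j; apply: smooth_eq (sF i j) => // y Uy; rewrite FG. Qed.

Lemma smooth_mx_cst m n (A : 'M[R]_(m, n)) : smooth_mx U (fun=> A).
Proof. by move=> i j; exact: smooth_cst. Qed.

Lemma smooth_mxD m n (F G : 'rV[R]_d -> 'M[R]_(m, n)) :
  smooth_mx U F -> smooth_mx U G -> smooth_mx U (fun x => F x + G x).
Proof.
move=> sF sG i j; apply: smooth_eq (smoothD oU (sF i j) (sG i j)) => // x _.
by rewrite mxE.
Qed.

Lemma smooth_mxN m n (F : 'rV[R]_d -> 'M[R]_(m, n)) :
  smooth_mx U F -> smooth_mx U (fun x => - F x).
Proof.
move=> sF i j; apply: smooth_eq (smoothN oU (sF i j)) => // x _.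
by rewrite mxE.
Qed.

Lemma smooth_mxB m n (F G : 'rV[R]_d -> 'M[R]_(m, n)) :
  smooth_mx U F -> smooth_mx U G -> smooth_mx U (fun x => F x - G x).
Proof. by move=> sF sG; apply: smooth_mxD => //; exact: smooth_mxN. Qed.

Lemma smooth_mxZ m n (a : R) (F : 'rV[R]_d -> 'M[R]_(m, n)) :
  smooth_mx U F -> smooth_mx U (fun x => a *: F x).
Proof.
move=> sF i j; apply: smooth_eq (smoothM oU (smooth_cst U a) (sF i j)) => // x _.
by rewrite mxE.
Qed.

Lemma smooth_mxM m n p (F : 'rV[R]_d -> 'M[R]_(m, n)) (G : 'rV[R]_d -> 'M[R]_(n, p)) :
  smooth_mx U F -> smooth_mx U G -> smooth_mx U (fun x => F x *m G x).
Proof.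
move=> sF sG i j.
have := smooth_sum (index_enum 'I_n) xpredT oU (fun k => smoothM oU (sF i k) (sG k j)).
by apply: smooth_eq => // x _; rewrite mxE.
Qed.

Lemma smooth_mx_tr m n (F : 'rV[R]_d -> 'M[R]_(m, n)) :
  smooth_mx U F -> smooth_mx U (fun x => (F x)^T).
Proof. by move=> sF i j; apply: smooth_eq (sF j i) => // x _; rewrite mxE. Qed.

Lemma smooth_mx_rows m n (F : 'I_m -> 'rV[R]_d -> 'rV[R]_n) :
  (forall i, smooth_mx U (F i)) -> smooth_mx U (fun x => \matrix_(i, j) F i x 0 j).
Proof. by move=> sF i j; apply: smooth_eq (sF i 0 j) => // x _; rewrite mxE. Qed.

Lemma smooth_mx_pd m n v (F : 'rV[R]_d -> 'M[R]_(m, n)) :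
  smooth_mx U F -> smooth_mx U (pd v F).
Proof.
move=> sF i j; apply: smooth_eq (smooth_derive v (sF i j)) => // x _.
by rewrite pd_entry.
Qed.

Lemma smooth_det n (F : 'rV[R]_d -> 'M[R]_n) :
  smooth_mx U F -> smooth U (fun x => \det (F x)).
Proof.
move=> sF; rewrite /determinant; apply: smooth_sum => // s.
apply: (smoothM oU (smooth_cst U ((-1) ^+ s))).
by apply: smooth_prod.
Qed.

Lemma smooth_mx_inv n (F : 'rV[R]_d -> 'M[R]_n) :
  (forall x, U x -> F x \in unitmx) -> smooth_mx U F -> smooth_mx U (fun x => invmx (F x)).
Proof.
move=> uF sF i j.
have sdi : smooth U (fun x => (\det (F x))^-1).
  by apply: smoothV (smooth_det sF) => // x /uF; rewrite unitmxE unitfE.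
have sadj : smooth U (fun x => (\adj (F x)) i j).
  have : smooth U (fun x => (-1) ^+ (j + i) * \det (row' j (col' i (F x)))).
    apply: smoothM => //; first exact: smooth_cst.
    apply: smooth_det => a b; apply: smooth_eq (sF (lift j a) (lift i b)) => // x _.
    by rewrite !mxE.
  by apply: smooth_eq => // x _; rewrite mxE.
apply: smooth_eq (smoothM oU sdi sadj) => // x /uF Fu.
by rewrite /invmx Fu [RHS]mxE.
Qed.

Section AtPoint.
Variable x : 'rV[R]_d.
Hypothesis Ux : U x.

Lemma pd_cst m n v (A : 'M[R]_(m, n)) : pd v (fun=> A) x = 0.
Proof. by apply/matrixP => i j; rewrite pd_entry mxE derive_cst. Qed.

Lemma pdD m n v (F G : 'rV[R]_d -> 'M[R]_(m, n)) :
  smooth_mx U F -> smooth_mx U G ->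
  pd v (fun x => F x + G x) x = pd v F x + pd v G x.
Proof.
move=> sF sG; apply/matrixP => i j; rewrite mxE !pd_entry -deriveD.
- by congr ('D_v _ x); apply/funext => y; rewrite mxE.
- exact: smooth_derivable (sF i j) Ux.
- exact: smooth_derivable (sG i j) Ux.
Qed.

Lemma pdN m n v (F : 'rV[R]_d -> 'M[R]_(m, n)) :
  smooth_mx U F -> pd v (fun x => - F x) x = - pd v F x.
Proof.
move=> sF; apply/matrixP => i j; rewrite mxE !pd_entry -deriveN.
- by congr ('D_v _ x); apply/funext => y; rewrite mxE.
- exact: smooth_derivable (sF i j) Ux.
Qed.

Lemma pdB m n v (F G : 'rV[R]_d -> 'M[R]_(m, n)) :
  smooth_mx U F -> smooth_mx U G ->
  pd v (fun x => F x - G x) x = pd v F x - pd v G x.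
Proof. by move=> sF sG; rewrite pdD ?pdN//; exact: smooth_mxN. Qed.

Lemma pdZ m n v (a : R) (F : 'rV[R]_d -> 'M[R]_(m, n)) :
  smooth_mx U F -> pd v (fun x => a *: F x) x = a *: pd v F x.
Proof.
move=> sF; apply/matrixP => i j; rewrite mxE !pd_entry -[RHS]/(a *: _) -deriveZ.
- by congr ('D_v _ x); apply/funext => y; rewrite mxE.
- exact: smooth_derivable (sF i j) Ux.
Qed.

Lemma pdM m n p v (F : 'rV[R]_d -> 'M[R]_(m, n)) (G : 'rV[R]_d -> 'M[R]_(n, p)) :
  smooth_mx U F -> smooth_mx U G ->
  pd v (fun x => F x *m G x) x = pd v F x *m G x + F x *m pd v G x.
Proof.
move=> sF sG; apply/matrixP => i j; rewrite !mxE !pd_entry.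
have dF k : derivable (fun y => F y i k) x v by exact: smooth_derivable (sF i k) Ux.
have dG k : derivable (fun y => G y k j) x v by exact: smooth_derivable (sG k j) Ux.
have -> : (fun y => (F y *m G y) i j) =
    \sum_(k < n) ((fun y => F y i k) * (fun y => G y k j)).
  by apply/funext => y; rewrite mxE fct_sumE.
rewrite derive_sum => [|k]; last exact: derivableM.
rewrite -big_split; apply: eq_bigr => k _ /=; rewrite deriveM// !pd_entry addrC.
by congr (_ + _); rewrite mulrC.
Qed.

Lemma pd_tr m n v (F : 'rV[R]_d -> 'M[R]_(m, n)) :
  pd v (fun x => (F x)^T) x = (pd v F x)^T.
Proof.
apply/matrixP => i j; rewrite mxE !pd_entry.
by congr ('D_v _ x); apply/funext => y; rewrite mxE.
Qed.

Lemma pdMl m n p v (F : 'rV[R]_d -> 'M[R]_(m, n)) (A : 'M[R]_(n, p)) :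
  smooth_mx U F -> pd v (fun x => F x *m A) x = pd v F x *m A.
Proof.
by move=> sF; rewrite (pdM _ sF (smooth_mx_cst A)) pd_cst mulmx0 addr0.
Qed.

Lemma pdMr m n p v (A : 'M[R]_(m, n)) (F : 'rV[R]_d -> 'M[R]_(n, p)) :
  smooth_mx U F -> pd v (fun x => A *m F x) x = A *m pd v F x.
Proof.
by move=> sF; rewrite (pdM _ (smooth_mx_cst A) sF) pd_cst mul0mx add0r.
Qed.

Lemma pdvD m n u v (F : 'rV[R]_d -> 'M[R]_(m, n)) :
  smooth_mx U F -> pd (u + v) F x = pd u F x + pd v F x.
Proof.
move=> sF; apply/matrixP => i j; rewrite mxE !pd_entry.
exact: smooth_deriveD oU (sF i j) Ux.
Qed.

Lemma pdvZ m n a v (F : 'rV[R]_d -> 'M[R]_(m, n)) :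
  smooth_mx U F -> pd (a *: v) F x = a *: pd v F x.
Proof.
move=> sF; apply/matrixP => i j; rewrite mxE !pd_entry.
exact: smooth_deriveZ (sF i j) Ux.
Qed.

Lemma pd_comm m n u v (F : 'rV[R]_d -> 'M[R]_(m, n)) :
  smooth_mx U F -> pd u (pd v F) x = pd v (pd u F) x.
Proof.
move=> sF; apply/matrixP => i j.
have E w : (fun y => pd w F y i j) = 'D_w (fun y => F y i j).
  by apply/funext => y; exact: pd_entry.
apply: etrans (pd_entry _ _ _ _ _) (etrans _ (esym (pd_entry _ _ _ _ _))).
rewrite (E v) (E u); exact: smooth_derive_comm oU (sF i j) Ux.
Qed.

End AtPoint.
End MatrixCalculus.

(** * The Levi-Civita connection in coordinates *)

Section EntrywiseArithmetic.
Variables (R : realType) (m n : nat).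
Implicit Types A B : 'M[R]_(m, n).

Lemma entryD A B i j : (A + B) i j = A i j + B i j. Proof. by rewrite mxE. Qed.
Lemma entryN A i j : (- A) i j = - A i j. Proof. by rewrite mxE. Qed.
Lemma entryZ a A i j : (a *: A) i j = a * A i j. Proof. by rewrite mxE. Qed.
Lemma entry0 i j : (0 : 'M[R]_(m, n)) i j = 0. Proof. by rewrite mxE. Qed.
Lemma entryT (A : 'M[R]_(n, m)) i j : A^T i j = A j i. Proof. by rewrite mxE. Qed.
End EntrywiseArithmetic.

(* The library lemmas, restated so that all products go through one and the
   same instance path and monomials can be compared syntactically. *)
Section RealMatrixProducts.
Variables (R : realType) (m n p q : nat).
Implicit Types (A : 'M[R]_(m, n)) (B : 'M[R]_(n, p)) (C : 'M[R]_(p, q)).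

Lemma mxMDl A A' B : (A + A') *m B = A *m B + A' *m B. Proof. exact: mulmxDl. Qed.
Lemma mxMDr A B B' : A *m (B + B') = A *m B + A *m B'. Proof. exact: mulmxDr. Qed.
Lemma mxMNl A B : (- A) *m B = - (A *m B). Proof. exact: mulNmx. Qed.
Lemma mxMNr A B : A *m (- B) = - (A *m B). Proof. exact: mulmxN. Qed.
Lemma mxMZl a A B : (a *: A) *m B = a *: (A *m B). Proof. by rewrite scalemxAl. Qed.
Lemma mxMZr a A B : A *m (a *: B) = a *: (A *m B). Proof. by rewrite scalemxAr. Qed.
Lemma mxMA A B C : A *m (B *m C) = A *m B *m C. Proof. exact: mulmxA. Qed.
Lemma mxM0 A : A *m (0 : 'M[R]_(n, p)) = 0. Proof. exact: mulmx0. Qed.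
Lemma mx0M B : (0 : 'M[R]_(m, n)) *m B = 0. Proof. exact: mul0mx. Qed.
Lemma mxM1 A : A *m (1%:M : 'M[R]_n) = A. Proof. exact: mulmx1. Qed.
Lemma mx1M A : (1%:M : 'M[R]_m) *m A = A. Proof. exact: mul1mx. Qed.
Lemma mxTD A A' : (A + A')^T = A^T + A'^T. Proof. exact: linearD. Qed.
Lemma mxTN A : (- A)^T = - A^T. Proof. exact: linearN. Qed.
Lemma mxTZ a A : (a *: A)^T = a *: A^T. Proof. exact: linearZ. Qed.
Lemma mxTM A B : (A *m B)^T = B^T *m A^T. Proof. exact: trmx_mul. Qed.
Lemma mxTT A : A^T^T = A. Proof. exact: trmxK. Qed.
End RealMatrixProducts.

(* Noncommutative matrix identities: expand, then treat the monomials as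
   variables; entrywise this is a commutative ring identity. *)
Ltac mxexpand := rewrite ?(mxTD, mxTN, mxTZ, mxTM, mxTT)
  ?(mxMDl, mxMDr, mxMNl, mxMNr, mxMZl, mxMZr, mxMA, mxM0, mx0M, mxM1, mx1M).
Ltac mxgen := repeat match goal with
  | |- context [@mulmx ?R ?m ?n ?p ?A ?B] => generalize (@mulmx R m n p A B); intro
  end;
  repeat match goal with
  | |- context [@pd ?R ?d ?m ?n ?v ?F ?x] => generalize (@pd R d m n v F x); intro
  end.
Ltac mxring := mxgen; apply/matrixP => ? ?; rewrite !(entryD, entryN, entryZ, entry0); ring.

(* Proves [H1 -> ... -> Hk -> A = B] for matrix equations when the conclusion
   is linear over the hypotheses, the monomials being variables. *)
Ltac mxlin := mxgen; intros; apply/matrixP; let i := fresh "i" in let j := fresh "j" in intros i j;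
  repeat match goal with
  | H : @eq _ ?A ?B |- _ =>
    let H' := fresh in pose proof (f_equal (fun M => fun_of_matrix M i j) H) as H';
    cbv beta in H'; clear H; rewrite ?(entryD, entryN, entryZ, entry0) in H'
  end; rewrite ?(entryD, entryN, entryZ, entry0); lra.

Section Connection.
Variables (R : realType) (d : nat) (U : set 'rV[R]_d) (g : 'rV[R]_d -> 'M[R]_d).
Hypothesis oU : open U.
Hypothesis sg : smooth_mx U g.
Hypothesis g_sym : forall x, U x -> (g x)^T = g x.
Hypothesis g_unit : forall x, U x -> g x \in unitmx.
Implicit Types (u v w x : 'rV[R]_d) (X : 'rV[R]_d -> 'rV[R]_d)
  (F : 'rV[R]_d -> 'M[R]_d) (c : 'rV[R]_d -> 'cV[R]_d).

(** Turns the direction of differentiation into a matrix argument: [w *m pdrows v x] is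
    [v *m pd w g x] ([pdrowsE]). With it the Koszul formula becomes one matrix expression. *)
Definition pdrows v x : 'M[R]_d := \matrix_(b, a) (v *m pd (delta_mx 0 b) g x) 0 a.

(* [u *m chr v x] is the Christoffel term of the covariant derivative of [u] along [v]. *)
Definition chr v x : 'M[R]_d := locked_with pd_key
  (2^-1 *: ((pd v g x + pdrows v x - (pdrows v x)^T) *m invmx (g x))).

Lemma chrE v x :
  chr v x = 2^-1 *: ((pd v g x + pdrows v x - (pdrows v x)^T) *m invmx (g x)).
Proof. by rewrite /chr unlock. Qed.

(** [w *m curv u v x] is R(u, v) w. There is no bracket term because [u] and [v] are constant in the
    chart, and the two products are swapped because matrices act from the right. *)
Definition curv u v x : 'M[R]_d :=
  pd u (chr v) x - pd v (chr u) x + chr v x *m chr u x - chr u x *m chr v x.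

(** The covariant derivatives of vector fields, (1,1)-tensors and 1-forms along a constant
    direction; the Christoffel matrix multiplies on the side dictated by the row-vector
    convention. *)
Definition nabV u X x := pd u X x + X x *m chr u x.
Definition nabT u F x := pd u F x + F x *m chr u x - chr u x *m F x.
Definition nabC u c x := pd u c x - chr u x *m c x.

Lemma smooth_chr v : smooth_mx U (chr v).
Proof.
apply: (smooth_mx_eq oU (fun y _ => esym (chrE v y))); apply: (smooth_mxZ oU); apply: (smooth_mxM oU); last exact: (smooth_mx_inv oU).
have sr : smooth_mx U (pdrows v).
  apply: (smooth_mx_rows oU) => b; apply: (smooth_mxM oU); first exact: smooth_mx_cst.
  exact: smooth_mx_pd.
apply: (smooth_mxB oU); last exact: (smooth_mx_tr oU).
by apply: (smooth_mxD oU) => //; exact: smooth_mx_pd.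
Qed.

Lemma smooth_nabV u X : smooth_mx U X -> smooth_mx U (nabV u X).
Proof.
move=> sX; apply: (smooth_mxD oU); first exact: smooth_mx_pd.
by apply: (smooth_mxM oU) => //; exact: smooth_chr.
Qed.

Section AtPoint.
Variable x : 'rV[R]_d.
Hypothesis Ux : U x.

Lemma pdrowsE v w : w *m pdrows v x = v *m pd w g x.
Proof.
rewrite [in RHS](row_sum_delta w).
have -> : pd (\sum_j w 0 j *: delta_mx 0 j) g x =
    \sum_j w 0 j *: pd (delta_mx 0 j) g x.
  elim: (index_enum _) => [|j s IH].
    by rewrite !big_nil -(scale0r (0 : 'rV[R]_d)) (pdvZ Ux _ _ sg) scale0r.
  by rewrite !big_cons (pdvD oU Ux _ _ sg) (pdvZ Ux _ _ sg) IH.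
apply/rowP => a; rewrite mxE mulmx_sumr summxE; apply: eq_bigr => b _.
by rewrite mxE -scalemxAr entryZ.
Qed.

(** The connection is metric: [chr v x *m g x] is half of [pd v g x] plus a skew matrix, so adding
    its transpose leaves [pd v g x]. *)
Lemma chr_metric v : pd v g x = chr v x *m g x + g x *m (chr v x)^T.
Proof.
have gS : (pd v g x)^T = pd v g x by rewrite -pd_tr; apply: (pd_eq oU) => // y /g_sym.
have E : chr v x *m g x = 2^-1 *: (pd v g x + pdrows v x - (pdrows v x)^T).
  by rewrite chrE -scalemxAl (mulmxKV (g_unit Ux)).
have -> : g x *m (chr v x)^T = (chr v x *m g x)^T by rewrite trmx_mul g_sym.
rewrite E; apply/matrixP => i j; rewrite !(entryD, entryN, entryZ, entryT).
rewrite -[pd v g x j i]entryT gS.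
by field.
Qed.

(** The connection has no torsion; symmetry of [g] makes the transposed term symmetric ([trE]),
    while the two other terms are exchanged by [pdrowsE]. *)
Lemma chr_sym v w : w *m chr v x = v *m chr w x.
Proof.
have trE u z : z *m (pdrows u x)^T = u *m (pdrows z x)^T.
  apply/rowP => a; rewrite [LHS]mxE [RHS]mxE.
  have E y w' : \sum_j w' 0 j * (pdrows y x)^T j a = (w' *m (y *m pd (delta_mx 0 a) g x)^T) 0 0.
    rewrite [RHS]mxE; apply: eq_bigr => b _; congr (_ * _).
    by rewrite !entryT [LHS]mxE.
  rewrite !E -[LHS]entryT; congr (fun_of_matrix _ _ _).
  have gS e : (pd e g x)^T = pd e g x by rewrite -pd_tr; apply: (pd_eq oU) => // y /g_sym.
  by rewrite trmx_mul trmxK trmx_mul gS mulmxA.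
rewrite !chrE -!scalemxAr !mulmxA; congr (_ *: (_ *m _)).
by rewrite !mulmxBr !mulmxDr !pdrowsE trE [w *m _ + _]addrC.
Qed.

(** Linearity in the direction is inherited through [chr_sym] from the linearity of the matrix
    product in the other vector. *)
Lemma chrD u v : chr (u + v) x = chr u x + chr v x.
Proof.
apply/row_matrixP => i; rewrite !rowE mulmxDr !(chr_sym _ (delta_mx 0 i)).
by rewrite mulmxDl.
Qed.

Lemma chrZ a u : chr (a *: u) x = a *: chr u x.
Proof.
apply/row_matrixP => i; rewrite !rowE (chr_sym _ (delta_mx 0 i)) -scalemxAl.
by rewrite (chr_sym _ u) scalemxAr.
Qed.

End AtPoint.

Section CovariantDerivative.
Variable x : 'rV[R]_d.
Hypothesis Ux : U x.

Lemma nabV_mulmx u X F : smooth_mx U X -> smooth_mx U F ->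
  nabV u (fun y => X y *m F y) x = nabV u X x *m F x + X x *m nabT u F x.
Proof.
move=> sX sF; rewrite /nabV /nabT (pdM Ux _ sX sF); mxexpand; mxring.
Qed.

Lemma nabT_mulmx u F F' : smooth_mx U F -> smooth_mx U F' ->
  nabT u (fun y => F y *m F' y) x = nabT u F x *m F' x + F x *m nabT u F' x.
Proof.
move=> sX sF; rewrite /nabT (pdM Ux _ sX sF); mxexpand; mxring.
Qed.

Lemma nabT_dyad u c X : smooth_mx U c -> smooth_mx U X ->
  nabT u (fun y => c y *m X y) x = nabC u c x *m X x + c x *m nabV u X x.
Proof.
move=> sX sF; rewrite /nabT /nabV /nabC (pdM Ux _ sX sF); mxexpand; mxring.
Qed.

Lemma pd_pairing u X c : smooth_mx U X -> smooth_mx U c ->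
  pd u (fun y => X y *m c y) x = nabV u X x *m c x + X x *m nabC u c x.
Proof.
move=> sX sF; rewrite /nabV /nabC (pdM Ux _ sX sF); mxexpand; mxring.
Qed.

Lemma nabC_flat u X : smooth_mx U X ->
  nabC u (fun y => g y *m (X y)^T) x = g x *m (nabV u X x)^T.
Proof.
move=> sX; rewrite /nabV /nabC (pdM Ux _ sg (smooth_mx_tr oU sX)) pd_tr (chr_metric Ux).
mxexpand; mxring.
Qed.

Lemma nabT_gD u F F' : smooth_mx U F -> smooth_mx U F' ->
  nabT u (fun y => F y + F' y) x = nabT u F x + nabT u F' x.
Proof. move=> sX sF; rewrite /nabT (pdD Ux _ sX sF); mxexpand; mxring. Qed.

Lemma nabT_N u F : smooth_mx U F -> nabT u (fun y => - F y) x = - nabT u F x.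
Proof. move=> sF; rewrite /nabT (pdN Ux _ sF); mxexpand; mxring. Qed.

Lemma nabT_1 u : nabT u (fun=> 1%:M) x = 0.
Proof. by rewrite /nabT pd_cst; mxexpand; mxring. Qed.

Lemma nabT_Z a u F : smooth_mx U F -> nabT u (fun y => a *: F y) x = a *: nabT u F x.
Proof. move=> sF; rewrite /nabT (pdZ Ux _ _ sF); mxexpand; mxring. Qed.

(** Taking adjoints commutes with covariant derivation because [g] is parallel. *)
Lemma nabT_adjoint u F F' : smooth_mx U F -> smooth_mx U F' ->
  (forall y, U y -> F y *m g y = g y *m (F' y)^T) ->
  nabT u F x *m g x = g x *m (nabT u F' x)^T.
Proof.
move=> sF sF' FF'.
have E : pd u (fun y => F y *m g y) x = pd u (fun y => g y *m (F' y)^T) x.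
  by apply: (pd_eq oU).
rewrite (pdM Ux _ sF sg) (pdM Ux _ sg (smooth_mx_tr oU sF')) pd_tr in E.
have {}E : pd u F x *m g x = pd u g x *m (F' x)^T + g x *m (pd u F' x)^T
    - F x *m pd u g x by rewrite -E addrK.
rewrite /nabT mulmxBl mulmxDl E (chr_metric Ux) -!mulmxA FF'//; mxexpand.
rewrite -FF'//; mxring.
Qed.

Lemma nabV_eq u X X' : (forall y, U y -> X y = X' y) -> nabV u X x = nabV u X' x.
Proof. by move=> XX; rewrite /nabV (pd_eq oU u XX Ux) XX. Qed.

Lemma nabT_eq u F F' : (forall y, U y -> F y = F' y) -> nabT u F x = nabT u F' x.
Proof. by move=> FF; rewrite /nabT (pd_eq oU u FF Ux) FF. Qed.

Lemma nabC_eq u c c' : (forall y, U y -> c y = c' y) -> nabC u c x = nabC u c' x.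
Proof. by move=> cc; rewrite /nabC (pd_eq oU u cc Ux) cc. Qed.

Lemma nabV_lin a u v X : smooth_mx U X ->
  nabV (a *: u + v) X x = a *: nabV u X x + nabV v X x.
Proof.
move=> sX; rewrite /nabV (pdvD oU Ux _ _ sX) (pdvZ Ux _ _ sX) (chrD Ux) (chrZ Ux).
by mxexpand; rewrite scalerDr addrACA.
Qed.

Lemma nabT_lin a u v F : smooth_mx U F ->
  nabT (a *: u + v) F x = a *: nabT u F x + nabT v F x.
Proof.
move=> sF; rewrite /nabT (pdvD oU Ux _ _ sF) (pdvZ Ux _ _ sF) (chrD Ux) (chrZ Ux).
by mxexpand; mxring.
Qed.

(** The Ricci identity, that is, the commutation rule for second covariant derivatives, not a
    statement on the Ricci tensor. Second partial derivatives cancel by [pd_comm], first ones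
    algebraically. *)
Lemma ricci_vec u v X : smooth_mx U X ->
  nabV u (nabV v X) x - nabV v (nabV u X) x = X x *m curv u v x.
Proof.
move=> sX; have sp w := smooth_mx_pd oU w sX; have sc := smooth_chr.
have s1 w : smooth_mx U (fun y => X y *m chr w y) by exact: (smooth_mxM oU).
have E w w' : nabV w (nabV w' X) x = pd w (pd w' X) x + pd w X x *m chr w' x
    + X x *m pd w (chr w') x + (pd w' X x + X x *m chr w' x) *m chr w x.
  rewrite [LHS]/nabV; congr (_ + _).
  by rewrite /nabV (pdD Ux _ (sp w') (s1 w')) (pdM Ux _ sX (sc w')) addrA.
rewrite (E u v) (E v u) /curv; mxexpand; move: (pd_comm oU Ux u v sX); mxlin.
Qed.

Lemma ricci_end u v F : smooth_mx U F ->
  nabT u (nabT v F) x - nabT v (nabT u F) x = F x *m curv u v x - curv u v x *m F x.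
Proof.
move=> sF; have sp w := smooth_mx_pd oU w sF; have sc := smooth_chr.
have s1 w : smooth_mx U (fun y => F y *m chr w y) by exact: (smooth_mxM oU).
have s2 w : smooth_mx U (fun y => chr w y *m F y) by exact: (smooth_mxM oU).
have s3 w : smooth_mx U (fun y => pd w F y + F y *m chr w y) by exact: (smooth_mxD oU).
pose DF w := pd w F x + F x *m chr w x - chr w x *m F x.
have E w w' : nabT w (nabT w' F) x = pd w (pd w' F) x + pd w F x *m chr w' x
    + F x *m pd w (chr w') x - pd w (chr w') x *m F x - chr w' x *m pd w F x
    + DF w' *m chr w x - chr w x *m DF w'.
  rewrite [LHS]/nabT; congr (_ + _ - _).
  rewrite /nabT (pdB oU Ux _ (s3 w') (s2 w')) (pdD Ux _ (sp w') (s1 w')).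
  by rewrite (pdM Ux _ sF (sc w')) (pdM Ux _ (sc w') sF); mxring.
rewrite (E u v) (E v u) /curv /DF; mxexpand; move: (pd_comm oU Ux u v sF); mxlin.
Qed.

(** The derivative of the torsion-free relation [chr_sym] handles the terms with [pd], [chr_sym]
    itself those with two Christoffel matrices. *)
Lemma curv_bianchi u v w :
  w *m curv u v x + u *m curv v w x + v *m curv w u x = 0.
Proof.
have E e z z' : z *m pd e (chr z') x = z' *m pd e (chr z) x.
  rewrite -(pdMr Ux e z (smooth_chr z')) -(pdMr Ux e z' (smooth_chr z)).
  by apply: (pd_eq oU _ _ Ux) => y Uy; exact: chr_sym.
have C z1 z2 z3 : z1 *m chr z2 x *m chr z3 x = z2 *m chr z1 x *m chr z3 x.
  by rewrite (chr_sym Ux z2).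
rewrite /curv; mxexpand; move: (E u w v) (E v u w) (E w v u) (C w v u) (C w u v) (C u v w).
mxlin.
Qed.

(** The Ricci identity for [g]: expand both orders of the second derivative of [g] by [chr_metric];
    their difference is zero and equals [curv *m g + g *m curv^T]. *)
Lemma curv_skew u v : curv u v x *m g x = - (g x *m (curv u v x)^T).
Proof.
have sc := smooth_chr.
have E w w' : pd w (pd w' g) x =
    pd w (chr w') x *m g x + chr w' x *m (chr w x *m g x + g x *m (chr w x)^T)
  + ((chr w x *m g x + g x *m (chr w x)^T) *m (chr w' x)^T + g x *m (pd w (chr w') x)^T).
  have -> : pd w (pd w' g) x = pd w (fun y => chr w' y *m g y + g y *m (chr w' y)^T) x.
    apply: (pd_eq oU _ _ Ux) => y Uy; exact: chr_metric.
  have st := smooth_mx_tr oU (sc w').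
  rewrite (pdD Ux _ (smooth_mxM oU (sc w') sg) (smooth_mxM oU sg st)).
  by rewrite (pdM Ux _ (sc w') sg) (pdM Ux _ sg st) pd_tr !(chr_metric Ux).
have := pd_comm oU Ux u v sg; rewrite !E /curv => {}E.
move: E; mxexpand; mxlin.
Qed.

Lemma curvDl u u' v : curv (u + u') v x = curv u v x + curv u' v x.
Proof.
have sc := smooth_chr.
have E : pd v (chr (u + u')) x = pd v (chr u) x + pd v (chr u') x.
  rewrite -(pdD Ux _ (sc u) (sc u')); apply: (pd_eq oU _ _ Ux) => y Uy; exact: chrD.
by rewrite /curv (pdvD oU Ux _ _ (sc v)) E (chrD Ux); mxexpand; mxring.
Qed.

Lemma curvZl a u v : curv (a *: u) v x = a *: curv u v x.
Proof.
have sc := smooth_chr.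
have E : pd v (chr (a *: u)) x = a *: pd v (chr u) x.
  rewrite -(pdZ Ux _ _ (sc u)); apply: (pd_eq oU _ _ Ux) => y Uy; exact: chrZ.
by rewrite /curv (pdvZ Ux _ _ (sc v)) E (chrZ Ux); mxexpand; mxring.
Qed.

Lemma curvC u v : curv u v x = - curv v u x.
Proof. by rewrite /curv; mxring. Qed.

End CovariantDerivative.
End Connection.

(** * Algebra of almost contact 3-structures *)

Section BlairIdentity.
Variables (R : realFieldType) (V : lmodType R).
Variables (phi : V -> V) (xi : V) (eta : V -> R) (th : V -> V -> R) (f : V -> V -> V -> R).
Implicit Types u v w : V.
Hypothesis f_lin1 : forall a u u' v w, f (a *: u + u') v w = a * f u v w + f u' v w.
Hypothesis f_lin3 : forall a u v w w', f u v (a *: w + w') = a * f u v w + f u v w'.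
Hypothesis th_linl : forall a u u' v, th (a *: u + u') v = a * th u v + th u' v.
Hypothesis th_linr : forall a u v v', th u (a *: v + v') = a * th u v + th u v'.
Hypothesis phi_lin : forall a u v, phi (a *: u + v) = a *: phi u + phi v.
Hypothesis eta_lin : forall a u v, eta (a *: u + v) = a * eta u + eta v.
Hypothesis phi_phi : forall v, phi (phi v) = - v + eta v *: xi.
Hypothesis phi_xi : phi xi = 0.
Hypothesis eta_phi : forall v, eta (phi v) = 0.
Hypothesis eta_xi : eta xi = 1.
Hypothesis f_skew : forall u v w, f u v w = - f u w v.
Hypothesis f_cyc : forall u v w, f u v w + f v w u + f w u v = 0.
Hypothesis f_normal : forall u v w,
  f (phi u) v w - f (phi v) u w - f v u (phi w) + f u v (phi w)
  + (th u v - th v u) * eta w = 0.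
Hypothesis f_phi : forall u v w,
  f u (phi v) w - f u v (phi w) = th u v * eta w + eta v * th u w.
Hypothesis th_xi : forall u, th u xi = 0.
Hypothesis f_xi : forall u w, f u xi w = th u (phi w).

Let f0_1 v w : f 0 v w = 0.
Proof. by have := f_lin1 (-1) 0 0 v w; rewrite scaler0 addr0; lra. Qed.
Let f0_3 u v : f u v 0 = 0.
Proof. by have := f_lin3 (-1) u v 0 0; rewrite scaler0 addr0; lra. Qed.
Let th0 u : th u 0 = 0.
Proof. by have := th_linr (-1) u 0 0; rewrite scaler0 addr0; lra. Qed.
Let th0l u : th 0 u = 0.
Proof. by have := th_linl (-1) 0 0 u; rewrite scaler0 addr0; lra. Qed.

Let phi2 v : phi (phi v) = (-1) *: v + (eta v *: xi + 0).
Proof. by rewrite phi_phi scaleN1r addr0. Qed.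

Let th_phi2 u v : th u (phi (phi v)) = - th u v.
Proof. by rewrite phi2 !th_linr th_xi th0; lra. Qed.

Let xi_th v : th xi v = 0.
Proof.
have := f_normal xi v xi; rewrite phi_xi f0_1 !f0_3 !f_xi phi_xi th0 eta_xi th_xi.
lra.
Qed.

Let phi2_th u v : th (phi (phi u)) v = - th u v.
Proof. by rewrite phi2 !th_linl xi_th th0l; lra. Qed.

(** Normality with first argument [xi] and the cyclic identity with first argument [xi] both express
    [f xi], that is nabla_xi phi; eliminating it gives skewness on the image of [phi]. Since [th]
    vanishes as soon as one argument is [xi], [phi] twice acts as -1 inside [th], and skewness
    extends to all vectors. *)
Lemma killing v w : th v w = - th w v.
Proof.
have key z y : th (phi z) (phi y) = - th (phi y) (phi z).
  have E1 := f_normal xi z y; rewrite phi_xi f0_1 !f_xi th_phi2 xi_th th_xi in E1.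
  have E2 := f_cyc xi z (phi y).
  rewrite (f_skew z (phi y)) !f_xi th_phi2 in E2.
  by lra.
have := key (phi v) (phi w); rewrite !phi2_th !th_phi2; lra.
Qed.

(** This is the [xi]-component of normality, combined with [killing]. *)
Lemma dext_invariant u v : th (phi u) (phi v) = th u v.
Proof.
have := f_normal u v xi; rewrite phi_xi !f0_3 eta_xi.
rewrite (f_skew _ v) (f_skew _ u) !f_xi (killing v u) (killing (phi v)); lra.
Qed.

Lemma blair_identity u v w : f u v w = - th u (phi v) * eta w + th u (phi w) * eta v.
Proof.
have th_phi a b : th a (phi b) = th b (phi a).
  by rewrite -dext_invariant th_phi2 (killing (phi a)) opprK.
(* The defect of the identity to be shown. It inherits skewness, the cyclic identity and the
   compatibility with [phi], now without right-hand sides. *)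
pose p a b e := f a b e + th a (phi b) * eta e - th a (phi e) * eta b.
have p_skew a b e : p a b e = - p a e b by rewrite /p f_skew; lra.
have p_cyc a b e : p a b e + p b e a + p e a b = 0.
  have := f_cyc a b e; rewrite /p (th_phi b a) (th_phi e a) (th_phi e b); lra.
have p_phi a b e : p a (phi b) e = p a b (phi e).
  by have := f_phi a b e; rewrite /p !th_phi2 !eta_phi; lra.
pose q a b e := p (phi a) b e + p a b (phi e).
have q_sym a b e : q a b e = q b a e.
  have := f_normal a b e.
  rewrite /q /p !dext_invariant !th_phi2 !eta_phi (killing b a); lra.
have q_skew a b e : q a b e = - q a e b.
  by rewrite /q p_skew -p_phi (p_skew a (phi b)); lra.
(* Symmetric in the first two arguments and skew in the last two, hence zero, by the shuffle that
   proves uniqueness of the Levi-Civita connection. *)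
have q0 a b e : q a b e = 0.
  have H1 := q_sym a b e; have H2 := q_skew b a e; have H3 := q_sym b e a.
  have H4 := q_skew e b a; have H5 := q_sym e a b; have H6 := q_skew a e b.
  by lra.
have p_phi1 a b e : p (phi a) b e = - p a b (phi e).
  by have := q0 a b e; rewrite /q; lra.
(* Inserting [phi] in two different places of the cyclic sum gives two relations that differ by
   signs; their sum leaves twice the wanted term. *)
have p0 a b e : p a b (phi e) = 0.
  have E1 := p_cyc (phi b) e a; have E2 := p_cyc b (phi e) a.
  rewrite p_phi1 in E1; rewrite p_phi p_phi1 in E2.
  have E3 := p_phi a b e; have E4 := p_phi e a b.
  by lra.
have pxi a b : p a b xi = 0.
  by rewrite /p f_skew f_xi phi_xi th0 eta_xi; lra.
have : p u v w = 0.
  have p_lin x y a e e' : p x y (a *: e + e') = a * p x y e + p x y e'.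
    by rewrite /p f_lin3 phi_lin th_linr eta_lin; lra.
  have p00 : p u v 0 = 0.
    by have := p_lin u v (-1) 0 0; rewrite scaler0 addr0; lra.
  by have := p0 u v (phi w); rewrite phi2 !p_lin pxi p00; lra.
by rewrite /p; lra.
Qed.

End BlairIdentity.

(** * Cyclic indexing: even permutations of the indices are the triples [a], [ordS a],
    [ordS (ordS a)] *)

Section OrdS3.
Implicit Types a b : 'I_3.

Lemma ordS3 a : ordS (ordS (ordS a)) = a.
Proof. by apply/val_inj; case: a => [[|[|[|]]]]. Qed.

Lemma ord3_cases a b : [\/ b = a, b = ordS a | b = ordS (ordS a)].
Proof.
case: a b => [[|[|[|//]]] ia] [[|[|[|//]]] ib];
  by [constructor 1; apply/val_inj | constructor 2; apply/val_inj | constructor 3; apply/val_inj].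
Qed.

End OrdS3.

Section InnerProduct.
Variables (R : realFieldType) (V : lmodType R) (g : V -> V -> R).
Hypothesis g_lin : forall a u v w, g (a *: u + v) w = a * g u w + g v w.
Hypothesis g_sym : forall u v, g u v = g v u.
Hypothesis g_pos : forall v, v != 0 -> 0 < g v v.
Implicit Types u v w : V.

Lemma g0l w : g 0 w = 0.
Proof. by have := g_lin (-1) 0 0 w; rewrite scaler0 addr0; lra. Qed.
Lemma g0r w : g w 0 = 0. Proof. by rewrite g_sym g0l. Qed.
Lemma gDl u v w : g (u + v) w = g u w + g v w.
Proof. by rewrite -[u]scale1r g_lin mul1r scale1r. Qed.
Lemma gZl a u w : g (a *: u) w = a * g u w.
Proof. by rewrite -[a *: u]addr0 g_lin g0l addr0. Qed.
Lemma gNl u w : g (- u) w = - g u w.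
Proof. by rewrite -scaleN1r gZl mulN1r. Qed.
Lemma gDr u v w : g w (u + v) = g w u + g w v.
Proof. by rewrite !(g_sym w) gDl. Qed.
Lemma gZr a u w : g w (a *: u) = a * g w u.
Proof. by rewrite !(g_sym w) gZl. Qed.
Lemma gNr u w : g w (- u) = - g w u.
Proof. by rewrite !(g_sym w) gNl. Qed.

Definition g_simp := (gDl, gDr, gZl, gZr, gNl, gNr, g0l, g0r).

Lemma g_inj u v : (forall w, g u w = g v w) -> u = v.
Proof.
move=> H; apply/eqP; rewrite -subr_eq0; apply/negPn/negP => /g_pos.
by rewrite gDl gNl H subrr ltxx.
Qed.

Lemma g_eq0 v : g v v = 0 -> v = 0.
Proof.
by move=> H; apply/eqP/negPn/negP => /g_pos; rewrite H ltxx.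
Qed.

End InnerProduct.

(** * Pointwise linear algebra of three almost contact structures sharing one metric *)

Section ThreeStructure.
Variables (R : realFieldType) (V : lmodType R) (g : V -> V -> R).
Hypothesis g_lin : forall a u v w, g (a *: u + v) w = a * g u w + g v w.
Hypothesis g_sym : forall u v, g u v = g v u.
Hypothesis g_pos : forall v, v != 0 -> 0 < g v v.
Variables (phi : 'I_3 -> V -> V) (xi : 'I_3 -> V).
Hypothesis phi_lin : forall a b u v, phi a (b *: u + v) = b *: phi a u + phi a v.
Hypothesis phi_phi : forall a v, phi a (phi a v) = - v + g v (xi a) *: xi a.
Hypothesis phi_skew : forall a u v, g (phi a u) v = - g u (phi a v).
Hypothesis phi_xi : forall a, phi a (xi a) = 0.
Hypothesis xi_xi : forall a, g (xi a) (xi a) = 1.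
Local Notation s := ordS.
Hypothesis xi_s : forall a, phi a (xi (s a)) = xi (s (s a)).
Hypothesis xi_ss : forall a, phi (s a) (xi a) = - xi (s (s a)).
Implicit Types (u v w : V) (a b : 'I_3).

Let gs := g_simp g_lin g_sym.

Lemma phi0 a : phi a 0 = 0.
Proof. by have := phi_lin a (-1) 0 0; rewrite scaler0 addr0 scaleN1r addNr. Qed.
Lemma phiD a u v : phi a (u + v) = phi a u + phi a v.
Proof. by rewrite -[u]scale1r phi_lin !scale1r. Qed.
Lemma phiZ a c u : phi a (c *: u) = c *: phi a u.
Proof. by rewrite -[c *: u]addr0 phi_lin phi0 addr0. Qed.
Lemma phiN a u : phi a (- u) = - phi a u.
Proof. by rewrite -scaleN1r phiZ scaleN1r. Qed.

Lemma xi_orth a : g (xi a) (xi (s a)) = 0.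
Proof.
have : g (xi a) (xi (s a)) = - g (xi a) (xi (s a)); last by lra.
by have := xi_s (s (s a)); rewrite ordS3 => <-; rewrite -phi_skew g_sym.
Qed.

Lemma xi_orth2 a : g (xi a) (xi (s (s a))) = 0.
Proof. by rewrite g_sym -[in xi a](ordS3 a) xi_orth. Qed.

Lemma xi_prev a : phi a (xi (s (s a))) = - xi (s a).
Proof. by have := xi_ss (s (s a)); rewrite !ordS3. Qed.

Lemma hor_inj u v : (forall a, g u (xi a) = g v (xi a)) ->
  (forall w, (forall a, g w (xi a) = 0) -> g u w = g v w) -> u = v.
Proof.
move=> Hv Hh; apply: (g_inj g_lin g_pos) => w; pose a : 'I_3 := ord0.
pose w' := w - g w (xi a) *: xi a - g w (xi (s a)) *: xi (s a)
  - g w (xi (s (s a))) *: xi (s (s a)).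
have O1 := xi_orth a; have O2 := xi_orth2 a; have O3 := xi_orth (s a).
have w'h b : g w' (xi b) = 0.
  case: (ord3_cases a b) => ->; rewrite /w' !gs xi_xi.
  - by rewrite (g_sym (xi (s a))) (g_sym (xi (s (s a)))) O1 O2; lra.
  - by rewrite (g_sym (xi (s (s a)))) O1 O3; lra.
  - by rewrite O2 O3; lra.
have := Hh _ w'h; rewrite /w' !gs (Hv a) (Hv (s a)) (Hv (s (s a))); lra.
Qed.

Section Derivatives.
Variables (mu : R) (h : 'I_3 -> V -> V) (T : 'I_3 -> V -> V -> V).
Hypothesis h_skew : forall a u v, g (h a u) v = - g (h a v) u.
Hypothesis h_phi : forall a u v, g (h a (phi a u)) (phi a v) = g (h a u) v.
Hypothesis h_eta : forall a u, g (h a u) (xi a) = 0.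
Hypothesis T_form : forall a u v,
  T a u v = g (phi a (h a u)) v *: xi a - g v (xi a) *: phi a (h a u).
Hypothesis T_quat : forall a u v, T (s (s a)) u v =
  phi a (T (s a) u v) + T a u (phi (s a) v) - g (h (s a) u) v *: xi a
  - g v (xi (s a)) *: h a u.
Hypothesis h_bracket : forall a, h (s a) (xi a) - h a (xi (s a)) = (2 * mu) *: xi (s (s a)).

(** With [h a u] for nabla_u xi_a, the first summand inverts nabla_u xi_a = - phi_a (A u) up to a
    multiple of [xi a]. The second one fixes that multiple so that [xi a] has the eigenvalue [mu]
    found for the other two Reeb vectors in [lamE]. *)
Definition qsA a u : V := locked (phi a (h a u) + (mu * g u (xi a)) *: xi a).

Lemma qsAE a u : qsA a u = phi a (h a u) + (mu * g u (xi a)) *: xi a.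
Proof. by rewrite /qsA -lock. Qed.

Lemma h_xi a : h a (xi a) = 0.
Proof. by apply: (g_inj g_lin g_pos) => w; rewrite h_skew h_eta !gs oppr0. Qed.

Lemma phi_qsA a u : phi a (qsA a u) = - h a u.
Proof. by rewrite qsAE phiD phiZ phi_xi scaler0 addr0 phi_phi h_eta scale0r addr0. Qed.

Lemma qsA_sym a u v : g (qsA a u) v = g u (qsA a v).
Proof.
have E x y : g (h a x) (phi a y) = g (h a y) (phi a x).
  by rewrite -h_phi phi_phi !gs h_eta h_skew; lra.
rewrite !qsAE !gs phi_skew E -phi_skew g_sym (g_sym (xi a)); lra.
Qed.

Lemma qsA_phi a u : qsA a (phi a u) = phi a (qsA a u).
Proof.
rewrite phi_qsA qsAE phi_skew phi_xi !gs oppr0 mulr0 scale0r addr0.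
by apply: (g_inj g_lin g_pos) => w; rewrite phi_skew h_phi gs.
Qed.

Lemma qsA_xi a : qsA a (xi a) = mu *: xi a.
Proof. by rewrite qsAE h_xi phi0 add0r xi_xi mulr1. Qed.

(** The two contributions of the [mu] summand of [qsA] cancel, so Blair's identity takes the shape
    of the Sasakian formula for nabla phi, with [qsA] in place of a multiple of the identity. *)
Lemma T_qsA a u v : T a u v = g (qsA a u) v *: xi a - g v (xi a) *: qsA a u.
Proof.
rewrite T_form !qsAE; apply: (g_inj g_lin g_pos) => w; rewrite !gs (g_sym (xi a) v); ring.
Qed.

(** Compare the components along [xi (s (s a))] in the differentiated relation [T_quat]: on the left
    stands the operator of [s (s a)], and on the right [phi a] carries [xi (s a)] to that vector
    with the operator of [s a] as coefficient. *)
Lemma qsA_hor a u v : (forall b, g v (xi b) = 0) ->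
  g (qsA (s (s a)) u) v = g (qsA (s a) u) v.
Proof.
move=> vh; have := congr1 (g ^~ (xi (s (s a)))) (T_quat a u v).
rewrite !T_qsA !vh !scale0r !subr0 phiZ xi_s !gs !xi_xi xi_orth2.
have -> : g (phi (s a) v) (xi a) = 0 by rewrite phi_skew xi_ss gs vh; lra.
by lra.
Qed.

Lemma qsA_hor_eq a b u v : (forall b, g v (xi b) = 0) -> g (qsA a u) v = g (qsA b u) v.
Proof.
move=> vh; case: (ord3_cases a b) => ->; first by [].
  by have := qsA_hor (s (s a)) u vh; rewrite !ordS3.
by have := qsA_hor a u vh; have := qsA_hor (s (s a)) u vh; rewrite !ordS3 => -> ->.
Qed.

Let lam a := g (qsA a (xi (s a))) (xi (s a)).

Let qsA_xi_s a : qsA a (xi (s a)) = lam a *: xi (s a).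
Proof.
apply: hor_inj => [b|w wh]; last first.
  by rewrite (qsA_hor_eq a (s a) _ wh) qsA_xi !gs g_sym wh; lra.
case: (ord3_cases a b) => ->.
- by rewrite qsA_sym qsA_xi !gs (g_sym _ (xi a)) xi_orth; lra.
- by rewrite !gs xi_xi mulr1.
- rewrite !gs xi_orth mulr0 -xi_s.
  (* A symmetric operator commuting with the skew [phi a] makes this component equal to its own
     negative. *)
  have : g (qsA a (xi (s a))) (phi a (xi (s a))) = - g (qsA a (xi (s a))) (phi a (xi (s a))).
    by rewrite -phi_skew -qsA_phi [RHS]qsA_sym [RHS]g_sym.
  by lra.
Qed.

Let qsA_xi_ss a : qsA a (xi (s (s a))) = lam a *: xi (s (s a)).
Proof. by rewrite -xi_s qsA_phi qsA_xi_s phiZ. Qed.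

(** Each bracket gives only the sum of two cyclically consecutive eigenvalues, namely [2 * mu]; the
    cycle has odd length three, so all of them are [mu]. *)
Let lamE a : lam a = mu.
Proof.
have sum b : lam (s b) + lam b = 2 * mu.
  have hE c u : h c u = - phi c (qsA c u) by rewrite phi_qsA opprK.
  have := h_bracket b; rewrite !hE qsA_xi_s.
  have := qsA_xi_ss (s b); rewrite ordS3 => ->.
  rewrite !phiZ xi_ss xi_s => /(congr1 (g ^~ (xi (s (s b))))).
  by rewrite !gs xi_xi; lra.
have := sum a; have := sum (s a); have := sum (s (s a)); rewrite ordS3; lra.
Qed.

Lemma qsA_xi_all a b : qsA a (xi b) = mu *: xi b.
Proof.
case: (ord3_cases a b) => ->; first exact: qsA_xi.
  by rewrite qsA_xi_s lamE.
by rewrite qsA_xi_ss lamE.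
Qed.

Lemma qsA_indep a b u : qsA a u = qsA b u.
Proof.
apply: hor_inj => [e|w wh]; last exact: qsA_hor_eq.
by rewrite !qsA_sym !qsA_xi_all.
Qed.

End Derivatives.

Hypothesis quat1 : forall a v,
  phi (s (s a)) v = phi a (phi (s a) v) - g v (xi (s a)) *: xi a.
Hypothesis quat2 : forall a v,
  phi (s (s a)) v = - phi (s a) (phi a v) + g v (xi a) *: xi (s a).

Lemma phi_hor a v : (forall b, g v (xi b) = 0) -> forall b, g (phi a v) (xi b) = 0.
Proof.
move=> vh b; rewrite phi_skew; case: (ord3_cases a b) => ->.
- by rewrite phi_xi gs oppr0.
- by rewrite xi_s vh oppr0.
- by rewrite xi_prev gs vh !oppr0.
Qed.

(* Each phi_c is a product phi_a phi_b in either order up to sign, so moving both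
   factors across sigma reverses their order and changes the sign. *)
Lemma quaternionic_form_eq0 (sigma : V -> V -> R) :
  (forall c u u' v, sigma (c *: u + u') v = c * sigma u v + sigma u' v) ->
  (forall c u v v', sigma u (c *: v + v') = c * sigma u v + sigma u v') ->
  (forall a v, sigma (xi a) v = 0) -> (forall a u, sigma u (xi a) = 0) ->
  (forall a u v, sigma u (phi a v) = sigma (phi a u) v) ->
  forall u v, sigma u v = 0.
Proof.
move=> lin1 lin2 xi1 xi2 adj.
have s0 u : sigma u 0 = 0 by have := lin2 (-1) u 0 0; rewrite scaler0 addr0; lra.
have s0l v : sigma 0 v = 0 by have := lin1 (-1) 0 0 v; rewrite scaler0 addr0; lra.
pose a : 'I_3 := ord0.
have phi0' u v : sigma u (phi (s (s a)) v) = 0.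
  have E1 : sigma u (phi (s (s a)) v) = sigma u (phi a (phi (s a) v)).
    by rewrite quat1 addrC -scaleNr lin2 xi2 mulr0 add0r.
  have E2 : sigma (phi (s (s a)) u) v = - sigma (phi (s a) (phi a u)) v.
    by rewrite quat2 addrC lin1 xi1 mulr0 add0r -scaleN1r -[_ *: _]addr0 lin1 s0l; lra.
  have E3 : sigma u (phi a (phi (s a) v)) = sigma (phi (s a) (phi a u)) v by rewrite !adj.
  by have E4 := adj (s (s a)) u v; lra.
move=> u v; have := phi0' u (phi (s (s a)) v); rewrite phi_phi addrC lin2 xi2 mulr0 add0r.
by rewrite -scaleN1r -[_ *: _]addr0 lin2 s0; lra.
Qed.

(** * The tensor [A] and its derivative, with [B u v] for (nabla_u A) v and [T a u v] for (nabla_u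
    phi_a) v *)

Section StructureTensor.
Variables (mu : R) (A : V -> V) (B : V -> V -> V).
Hypothesis A_lin : forall c u v, A (c *: u + v) = c *: A u + A v.
Hypothesis A_sym : forall u v, g (A u) v = g u (A v).
Hypothesis A_phi : forall a u, A (phi a u) = phi a (A u).
Hypothesis A_xi : forall a, A (xi a) = mu *: xi a.
Hypothesis B_lin1 : forall c u u' v, B (c *: u + u') v = c *: B u v + B u' v.
Hypothesis B_lin2 : forall c u v v', B u (c *: v + v') = c *: B u v + B u v'.
Hypothesis B_sym : forall u v w, g (B u v) w = g v (B u w).
Let T a u v := g (A u) v *: xi a - g v (xi a) *: A u.
Hypothesis B_xi : forall a u, B u (xi a) - A (phi a (A u)) = - (mu *: phi a (A u)).
Hypothesis B_cyc : forall a u v w,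
  g (T a u (A v) + phi a (B u v)) w + g (T a v (A w) + phi a (B v w)) u
  + g (T a w (A u) + phi a (B w u)) v = 0.

Lemma A0 : A 0 = 0.
Proof. by have := A_lin (-1) 0 0; rewrite scaler0 addr0 scaleN1r addNr. Qed.
Lemma AD u v : A (u + v) = A u + A v.
Proof. by rewrite -[u]scale1r A_lin !scale1r. Qed.
Lemma AZ c u : A (c *: u) = c *: A u.
Proof. by rewrite -[c *: u]addr0 A_lin A0 addr0. Qed.
Lemma AN u : A (- u) = - A u.
Proof. by rewrite -scaleN1r AZ scaleN1r. Qed.

(** The defect of A^2 = mu A. Differentiating A xi_a = mu xi_a shows that it is seen by the
    derivative of [A]: [B u (xi a)] equals [phi a (Adef u)]. *)
Definition Adef u : V := locked (A (A u) - mu *: A u).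
Lemma AdefE u : Adef u = A (A u) - mu *: A u. Proof. by rewrite /Adef -lock. Qed.

Let B_xiC a u : B u (xi a) = phi a (Adef u).
Proof.
rewrite AdefE phiD phiN phiZ -A_phi.
by rewrite -B_xi addrC subrK.
Qed.

Let C_sym u v : g (Adef u) v = g u (Adef v).
Proof. by rewrite !AdefE !gs !A_sym. Qed.
Let C_phi a u : Adef (phi a u) = phi a (Adef u).
Proof. by rewrite !AdefE !A_phi phiD phiN phiZ. Qed.
Let C_xi a : Adef (xi a) = 0.
Proof. by rewrite AdefE A_xi AZ A_xi subrr. Qed.
Let C_hor u a : g (Adef u) (xi a) = 0.
Proof. by rewrite C_sym C_xi gs. Qed.

Let cyc a u v w : g (phi a (B u v)) w + g (phi a (B v w)) u + g (phi a (B w u)) v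
  + g w (xi a) * g (Adef u) v + g u (xi a) * g (Adef v) w + g v (xi a) * g (Adef w) u = 0.
Proof.
have := B_cyc a u v w; rewrite /T !AdefE !gs.
rewrite (A_sym v (xi a)) (A_sym u (xi a)) (A_sym w (xi a)) !A_xi !gs.
rewrite (A_sym (A u) v) (A_sym (A v) w) (A_sym (A w) u).
have S x y : g (A x) y = g (A y) x by rewrite A_sym g_sym.
by rewrite (S u w) (S v u) (S w v) !(g_sym (xi a)); lra.
Qed.

(** In the cyclic identity at [w = xi a] the two terms with [Adef] cancel by symmetry, and only the
    term with [B (xi a) u] survives. *)
Let B_hor a u v : (forall b, g u (xi b) = 0) -> (forall b, g v (xi b) = 0) ->
  g (B (xi a) u) (phi a v) = 0.
Proof.
move=> uh vh; have := cyc a u v (xi a); rewrite B_xiC phi_phi C_hor xi_xi uh vh.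
rewrite !gs !phi_skew phi_xi !gs (C_sym v) (g_sym v); lra.
Qed.

Let B_hor2 a b u v : (forall b, g u (xi b) = 0) -> (forall b, g v (xi b) = 0) ->
  g (B (xi a) u) (phi b v) = 0.
Proof.
move=> uh vh; have pbv := phi_hor b vh.
have := B_hor a uh (phi_hor a pbv); rewrite phi_phi pbv scale0r addr0 gs; lra.
Qed.

(** The cyclic identity of one structure is tested on the Reeb vector of the next. The term with [B]
    along that Reeb vector vanishes by [B_hor2]; the other two are equal, because [Adef] is
    symmetric and commutes with the skew [phi (s (s a))], so they vanish too. On horizontal vectors
    [phi (s (s a))] is injective. *)
Lemma Adef_eq0 u : Adef u = 0.
Proof.
have hor z : (forall b, g z (xi b) = 0) -> Adef z = 0.
  move=> zh; pose a : 'I_3 := ord0.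
  have key v : (forall b, g v (xi b) = 0) -> g v (phi (s (s a)) (Adef z)) = 0.
    move=> vh; have := cyc a z v (xi (s a)).
    rewrite (g_sym (xi (s a)) (xi a)) xi_orth zh vh !mul0r !addr0.
    rewrite (phi_skew a (B z v)) xi_s B_sym B_xiC B_xiC.
    have -> : phi a (phi (s a) (Adef v)) = phi (s (s a)) (Adef v).
      by rewrite quat1 C_hor scale0r subr0.
    rewrite (phi_skew a (B _ _)) (B_hor2 _ _ zh vh).
    rewrite (phi_skew _ (Adef v)) (C_sym v) C_phi; lra.
  have pz : phi (s (s a)) (Adef z) = 0.
    by apply: (g_eq0 g_pos); apply: key; apply: phi_hor; exact: C_hor.
  have := phi_phi (s (s a)) (Adef z); rewrite pz phi0 C_hor scale0r addr0.
  by move/eqP; rewrite eq_sym oppr_eq0 => /eqP.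
apply: hor_inj => [b|w wh]; first by rewrite C_hor gs.
by rewrite C_sym hor // !gs.
Qed.

Lemma A_A u : A (A u) = mu *: A u.
Proof. by apply/eqP; rewrite -subr_eq0 -AdefE Adef_eq0. Qed.

Section Parallel.
Hypothesis mu_neq0 : mu != 0.
Hypothesis B_A : forall u v, B u (A v) + A (B u v) = mu *: B u v.
Hypothesis B_phiT : forall a u v,
  T a u (A v) + phi a (B u v) = B u (phi a v) + A (T a u v).

Let Bxi a u : B u (xi a) = 0.
Proof. by rewrite B_xiC Adef_eq0 phi0. Qed.

(** With A^2 = mu A the two terms [T] in [B_phiT] cancel, and the derivative of [A] commutes with
    [phi a]. *)
Let Bphi a u v : B u (phi a v) = phi a (B u v).
Proof.
have := B_phiT a u v; rewrite /T AD AN !AZ A_xi A_A.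
rewrite -(A_sym (A u) v) A_A !gs (A_sym v (xi a)) A_xi !gs => E.
apply: (g_inj g_lin g_pos) => w; have := congr1 (g ^~ w) E; rewrite !gs; lra.
Qed.

Let xiB a v : B (xi a) v = 0.
Proof.
apply: hor_inj => [b|w wh]; first by rewrite B_sym Bxi !gs.
suff hor z : (forall b, g z (xi b) = 0) -> B (xi a) z = 0.
  by rewrite B_sym hor // !gs.
move=> zh; apply: hor_inj => [b|y yh]; first by rewrite B_sym Bxi !gs.
have := B_hor2 a a zh (phi_hor a yh); rewrite phi_phi yh scale0r addr0 !gs; lra.
Qed.

Let t u v w := g (B u v) w.
Let t_lin1 c u u' v w : t (c *: u + u') v w = c * t u v w + t u' v w.
Proof. by rewrite /t B_lin1 !gs. Qed.
Let t_lin2 c u v v' w : t u (c *: v + v') w = c * t u v w + t u v' w.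
Proof. by rewrite /t B_lin2 !gs. Qed.
Let t_lin3 c u v w w' : t u v (c *: w + w') = c * t u v w + t u v w'.
Proof. by rewrite /t !gs. Qed.
Let t_sym u v w : t u v w = t u w v.
Proof. by rewrite /t B_sym g_sym. Qed.
Let t_phi a u v w : t u (phi a v) w = - t u v (phi a w).
Proof. by rewrite /t Bphi phi_skew. Qed.
Let t_cyc a u v w : t u v (phi a w) + t v w (phi a u) + t w u (phi a v) = 0.
Proof. by have := cyc a u v w; rewrite !Adef_eq0 !phi_skew !gs /t; lra. Qed.
Let t_A u v w : t u (A v) w + t u v (A w) = mu * t u v w.
Proof. by have := congr1 (g ^~ w) (B_A u v); rewrite !gs (A_sym (B u v)). Qed.

(* Up to a factor, [A] and [K] are the complementary projections onto the
   eigenspaces of [A]. *)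
Let K v : V := (- mu) *: v + A v.
Let K_lin c u v : K (c *: u + v) = c *: K u + K v.
Proof. by rewrite /K A_lin !scalerDr !scalerA mulrC addrACA. Qed.
Let A_K v : A (K v) = 0.
Proof. by rewrite /K A_lin A_A scaleNr addNr. Qed.
Let K_phi a v : K (phi a v) = phi a (K v).
Proof. by rewrite /K phi_lin A_phi. Qed.
Let K_xi a : K (xi a) = 0.
Proof. by rewrite /K A_xi scaleNr addNr. Qed.
(** The derivative of A^2 = mu A counts the block twice on the left and once on the right. Together
    with [t_KK]: the derivative of a projection exchanges its image and its kernel. *)
Let t_AA u v w : t u (A v) (A w) = 0.
Proof.
have := t_A u (A v) (A w); rewrite !A_A -[_ *: A v]addr0 t_lin2 -[_ *: A w]addr0 t_lin3.
have -> : t u 0 (A w) = 0 by have := t_lin2 (-1) u 0 0 (A w); rewrite scaler0 addr0; lra.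
have -> : t u (A v) 0 = 0 by rewrite /t !gs.
move=> H; apply: (mulfI mu_neq0); lra.
Qed.

Let t_KK u v w : t u (K v) (K w) = 0.
Proof.
have := t_A u (K v) (K w); rewrite !A_K.
have -> : t u 0 (K w) = 0 by have := t_lin2 (-1) u 0 0 (K w); rewrite scaler0 addr0; lra.
have -> : t u (K v) 0 = 0 by rewrite /t !gs.
move=> H; apply: (mulfI mu_neq0); lra.
Qed.

Let t0 u v : t u v 0 = 0. Proof. by rewrite /t !gs. Qed.
Let tN u v w : t u v (- w) = - t u v w. Proof. by rewrite /t !gs. Qed.

Let t0l v w : t 0 v w = 0.
Proof. by have := t_lin1 (-1) 0 0 v w; rewrite scaler0 addr0; lra. Qed.
Let tZ1 c u v w : t (c *: u) v w = c * t u v w.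
Proof. by rewrite -[c *: u]addr0 t_lin1 t0l addr0. Qed.
Let tZ3 c u v w : t u v (c *: w) = c * t u v w.
Proof. by rewrite -[c *: w]addr0 t_lin3 t0 addr0. Qed.
Let txi u v a : t u v (xi a) = 0.
Proof. by rewrite t_sym /t Bxi !gs. Qed.
Let t_phi2 a u v w : t u v (phi a (phi a w)) = - t u v w.
Proof. by rewrite phi_phi addrC t_lin3 txi tN; lra. Qed.
Let t_phi_phi a u v w : t u (phi a v) (phi a w) = t u v w.
Proof. by rewrite t_phi t_phi2 opprK. Qed.

Let t_AAK_sym u v w : t (A u) (A v) (K w) = t (A v) (A u) (K w).
Proof.
pose a : 'I_3 := ord0; have := t_cyc a (A u) (A v) (phi a (K w)).
rewrite t_phi2 t_phi_phi -[phi a (A v)]A_phi (t_sym (phi _ _)).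
rewrite (t_sym (phi _ _)) t_AA (t_sym (A v) (K w)); lra.
Qed.

(** The third term of the cyclic identity lies in the vanishing block [t_AA], so the form is
    symmetric in [u] and [v]; [phi a] can then be moved from one of them to the other, as
    [quaternionic_form_eq0] demands. [t_KAK] is the analogue with [t_KK]. *)
Let t_AAK u v w : t (A u) (A v) (K w) = 0.
Proof.
apply: (@quaternionic_form_eq0 (fun x y => t (A x) (A y) (K w))) => /=.
- by move=> c x x' y; rewrite A_lin t_lin1.
- by move=> c x y y'; rewrite A_lin t_lin2.
- by move=> a y; rewrite A_xi tZ1 /t xiB !gs mulr0.
- by move=> a y; rewrite A_xi t_sym tZ3 txi mulr0.
- move=> a x y; rewrite A_phi t_phi -K_phi t_AAK_sym K_phi -t_phi -A_phi.
  by rewrite t_AAK_sym.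
Qed.

Let t_KAK_sym u v w : t (K u) (A v) (K w) = t (K w) (A v) (K u).
Proof.
pose a : 'I_3 := ord0; have := t_cyc a (K u) (A (phi a v)) (K w).
by rewrite -(K_phi a u) t_KK A_phi t_phi_phi t_phi2 (t_sym (K w) (K u)); lra.
Qed.

Let t_KAK u v w : t (K u) (A v) (K w) = 0.
Proof.
apply: (@quaternionic_form_eq0 (fun x y => t (K x) (A v) (K y))) => /=.
- by move=> c x x' y; rewrite K_lin t_lin1.
- by move=> c x y y'; rewrite K_lin t_lin3.
- by move=> a y; rewrite K_xi t0l.
- by move=> a y; rewrite K_xi t0.
- move=> a x y; have := t_cyc a (K x) (A v) (K y).
  rewrite -(K_phi a y) (t_sym (K y) (K x)) t_phi -(K_phi a x) t_KK.
  by rewrite (t_KAK_sym y); lra.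
Qed.

Let split (F : V -> R) : (forall c x y, F (c *: x + y) = c * F x + F y) ->
  (forall x, F (A x) = 0) -> (forall x, F (K x) = 0) -> forall x, F x = 0.
Proof.
move=> F_lin FA FK x; have := FK x; rewrite /K F_lin FA addr0 => H.
by apply: (mulfI mu_neq0); lra.
Qed.

Lemma B_eq0 u v : B u v = 0.
Proof.
apply: (g_inj g_lin g_pos) => w; rewrite gs -/(t u v w).
have AAw x y z : t (A x) (A y) z = 0.
  by apply: (@split (t (A x) (A y))); move=> *; [exact: t_lin3|exact: t_AA|exact: t_AAK].
have KAw x y z : t (K x) (A y) z = 0.
  by apply: (@split (t (K x) (A y))); move=> *; [exact: t_lin3|exact: t_AA|exact: t_KAK].
have xAw x y z : t x (A y) z = 0.
  by apply: (@split (fun x => t x (A y) z)) => // c x' y'; exact: t_lin1.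
have xKw x y z : t x (K y) z = 0.
  by apply: (@split (t x (K y))) => // q; rewrite t_sym xAw.
apply: (@split (fun y => t u y w)) => // c x' y'; exact: t_lin2.
Qed.

End Parallel.
End StructureTensor.
End ThreeStructure.

(** * Ricci-flatness of curvature-like tensors that commute with the [phi a] and kill the [xi a] *)

Section RicciFlat.
Variables (R : realType) (d : nat) (G : 'M[R]_d).
Local Notation s := ordS.
Local Notation g := (ip G).
Variables (phi : 'I_3 -> 'M[R]_d) (xi : 'I_3 -> 'rV[R]_d).
Variable K : 'rV[R]_d -> 'rV[R]_d -> 'M[R]_d.
Implicit Types (u v w z : 'rV[R]_d) (a b : 'I_3).
Hypothesis G_unit : G \in unitmx.
Hypothesis phi_phi : forall a v, v *m phi a *m phi a = - v + g v (xi a) *: xi a.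
Hypothesis quat1 : forall a v,
  v *m phi (s (s a)) = v *m phi (s a) *m phi a - g v (xi (s a)) *: xi a.
Hypothesis quat2 : forall a v,
  v *m phi (s (s a)) = - (v *m phi a *m phi (s a)) + g v (xi a) *: xi (s a).
Hypothesis K_lin : forall c u u' v, K (c *: u + u') v = c *: K u v + K u' v.
Hypothesis K_alt : forall u v, K u v = - K v u.
Hypothesis K_bianchi : forall u v w, w *m K u v + u *m K v w + v *m K w u = 0.
Hypothesis K_skew : forall u v, K u v *m G = - (G *m (K u v)^T).
Hypothesis K_phi : forall a u v, phi a *m K u v = K u v *m phi a.
Hypothesis K_xi : forall a u v, xi a *m K u v = 0.

Let eta a : 'cV[R]_d := G *m (xi a)^T.

Let dyadE a b v : g v (xi a) *: xi b = v *m (eta a *m xi b).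
Proof. by rewrite mulmxA /eta mulmxA /ip [in RHS](mx11_scalar (v *m G *m _)) mul_scalar_mx. Qed.

Let K_eta a u v : K u v *m eta a = 0.
Proof. by rewrite /eta mulmxA K_skew mulNmx -mulmxA -trmx_mul K_xi trmx0 mulmx0 oppr0. Qed.

Let trN (A : 'M[R]_d) : \tr (- A) = - \tr A. Proof. exact: raddfN. Qed.

Lemma trace_skew u v : \tr (K u v) = 0.
Proof.
have : \tr (K u v) = - \tr (K u v); last by move=> H; lra.
rewrite -[LHS]mxtrace_tr -[(K u v)^T](mulKmx G_unit).
rewrite -[X in \tr (_ *m X)]opprK -K_skew mulmxN trN mxtrace_mulC.
by rewrite mulmxK.
Qed.

Let phi2 a : phi a *m phi a = - 1%:M + eta a *m xi a.
Proof.
by apply/row_matrixP => i; rewrite !rowE mulmxA phi_phi mulmxDr mulmxN mulmx1 dyadE.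
Qed.

Let phi_anti a : phi (s a) *m phi a =
  - (phi a *m phi (s a)) + eta a *m xi (s a) + eta (s a) *m xi a.
Proof.
apply/row_matrixP => i; rewrite !rowE !mulmxDr mulmxN -!dyadE !mulmxA.
by rewrite -quat2 quat1 subrK.
Qed.

(** Insert - phi_b^2, which acts as the identity behind [K u v]. Moving one [phi b] past [phi a]
    changes the sign, while moving it around the trace and through [K u v] does not. *)
Lemma trace_phi a u v : \tr (K u v *m phi a) = 0.
Proof.
pose b := s a.
have E1 : K u v = - (K u v *m phi b *m phi b).
  by rewrite -mulmxA phi2 mulmxDr mulmxN mulmx1 mulmxA K_eta mul0mx addr0 opprK.
have Keta e f : K u v *m phi b *m (eta e *m xi f) = 0.
  by rewrite [LHS]mulmxA -K_phi -(mulmxA (phi b)) K_eta mulmx0 mul0mx.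
have E2 : K u v *m phi b *m phi b *m phi a = - (K u v *m phi b *m phi a *m phi b).
  rewrite -[_ *m phi b *m phi b *m phi a]mulmxA phi_anti !mulmxDr mulmxN.
  by rewrite !Keta !addr0 mulmxA.
have E3 : \tr (K u v *m phi b *m phi a *m phi b) = \tr (K u v *m phi b *m phi b *m phi a).
  by rewrite mxtrace_mulC !mulmxA K_phi.
have : \tr (K u v *m phi b *m phi b *m phi a) = 0.
  by have := congr1 mxtrace E2; rewrite trN E3; lra.
by rewrite [in \tr (K u v *m phi a)]E1 mulNmx trN => ->; rewrite oppr0.
Qed.

(** The endomorphism z |-> K(z, u) w, whose trace [rho w u] is the Ricci form of [K]. *)
Let L w u : 'M[R]_d := \matrix_i (w *m K (delta_mx 0 i) u).

Let LE w u z : z *m L w u = w *m K z u.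
Proof.
rewrite [in RHS](row_sum_delta z).
have -> : K (\sum_j z 0 j *: delta_mx 0 j) u = \sum_j z 0 j *: K (delta_mx 0 j) u.
  elim: (index_enum _) => [|j r IH].
    have := K_lin (-1) 0 0 u; rewrite scaler0 addr0 scaleN1r addNr !big_nil => ->.
    by [].
  by rewrite !big_cons K_lin IH.
rewrite mulmx_sumr mulmx_sum_row; apply: eq_bigr => j _.
by rewrite rowK -scalemxAr.
Qed.

Let rho w u := \tr (L w u).

Let L_swap w u : L w u = L u w - K u w.
Proof.
apply/row_matrixP => i; rewrite !rowE mulmxBr !LE.
have := K_bianchi (delta_mx 0 i) u w; rewrite (K_alt w) mulmxN => /eqP.
by rewrite subr_eq0 => /eqP <-; rewrite addrK.
Qed.

Let rho_sym w u : rho w u = rho u w.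
Proof. by rewrite /rho L_swap mxtraceD trN trace_skew oppr0 addr0. Qed.

Let rho_lin c w w' u : rho (c *: w + w') u = c * rho w u + rho w' u.
Proof.
rewrite /rho -mxtraceZ -mxtraceD; congr (\tr _); apply/row_matrixP => i.
by rewrite !rowE mulmxDr -scalemxAr !LE mulmxDl scalemxAl.
Qed.

(** Since [K] commutes with [phi a], [rho (w *m phi a) u] is the trace of [L w u] times [phi a]; by
    [L_swap] exchanging [w] and [u] costs the trace of [K u w *m phi a], which is zero. *)
Let rho_phi a w u : rho (w *m phi a) u = rho w (u *m phi a).
Proof.
have E z y : rho (z *m phi a) y = \tr (L z y *m phi a).
  rewrite /rho; congr (\tr _); apply/row_matrixP => i.
  by rewrite !rowE mulmxA !LE -!mulmxA K_phi.
rewrite (rho_sym w) !E.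
by rewrite L_swap mulmxBl mxtraceD trN trace_phi oppr0 addr0.
Qed.

Lemma ricci_flat w u : \sum_i (w *m K (delta_mx 0 i) u) 0 i = 0.
Proof.
transitivity (rho w u).
  by apply: eq_bigr => i _; rewrite [RHS]mxE.
apply: (@quaternionic_form_eq0 R 'rV[R]_d g (fun a v => v *m phi a) xi
  phi_phi quat1 quat2 rho).
- by move=> c x x' y; exact: rho_lin.
- by move=> c x y y'; rewrite !(rho_sym x); exact: rho_lin.
- move=> a y; rewrite /rho; have -> : L (xi a) y = 0; last exact: mxtrace0.
  by apply/row_matrixP => i; rewrite !rowE LE K_xi mulmx0.
- move=> a x; rewrite rho_sym /rho; have -> : L (xi a) x = 0; last exact: mxtrace0.
  by apply/row_matrixP => i; rewrite !rowE LE K_xi mulmx0.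
- by move=> a x y; rewrite rho_phi.
Qed.

End RicciFlat.

(** * Pfaffians and the rank of a skew form *)

Section Pfaffian.
Variables (R : realType) (V : lmodType R) (O : V -> V -> R).
Hypothesis O_lin : forall a u v w, O (a *: u + v) w = a * O u w + O v w.
Hypothesis O_skew : forall u v, O u v = - O v u.

Fixpoint pairprod (r : nat) : ('I_(r * 2) -> V) -> R :=
  if r is r'.+1 then fun x : 'I_(2 + r' * 2) -> V =>
    O (x (lshift (r' * 2) (ord0 : 'I_2))) (x (lshift (r' * 2) (ord_max : 'I_2)))
    * @pairprod r' (fun b => x (rshift 2 b))
  else fun=> 1.

(** Unnormalised: all permutations are summed, so this is 2^r r! times the Pfaffian of the matrix
    with entries [O (x p) (x q)]. *)
Definition Pf (r : nat) (x : 'I_(r * 2) -> V) : R :=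
  \sum_(s : 'S_(r * 2)) (-1) ^+ s * pairprod (fun p => x (s p)).

Definition lift2 (n : nat) (t : 'S_n) : 'S_(2 + n) :=
  lift_perm ord0 ord0 (lift_perm ord0 ord0 t).

Lemma rshift2E n (b : 'I_n) : rshift 2 b = lift ord0 (lift ord0 b) :> 'I_(2 + n).
Proof. exact/val_inj. Qed.

Lemma lshift0E n : lshift n (ord0 : 'I_2) = ord0 :> 'I_(2 + n).
Proof. exact/val_inj. Qed.

Lemma lshift1E n : lshift n (ord_max : 'I_2) = lift ord0 ord0 :> 'I_(2 + n).
Proof. exact/val_inj. Qed.

Lemma lift2_rshift n (t : 'S_n) b : lift2 t (rshift 2 b) = rshift 2 (t b).
Proof. by rewrite !rshift2E /lift2 !lift_perm_lift. Qed.

Lemma lift2_lshift n (t : 'S_n) (c : 'I_2) : lift2 t (lshift n c) = lshift n c.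
Proof.
have [->|->] : c = ord0 \/ c = ord_max.
  by case: c => [[|[|//]] ic]; [left|right]; apply/val_inj.
by rewrite !lshift0E /lift2 lift_perm_id.
by rewrite !lshift1E /lift2 lift_perm_lift lift_perm_id.
Qed.

Lemma odd_lift2 n (t : 'S_n) : lift2 t = t :> bool.
Proof. by rewrite /lift2 !odd_lift_perm /=. Qed.

Lemma eq_pairprod r (x y : 'I_(r * 2) -> V) : x =1 y -> pairprod x = pairprod y.
Proof. by move=> xy; congr (pairprod _); apply/funext. Qed.

Lemma wedge_pow_Pf r (x : 'I_(r * 2) -> V) :
  wedge_pow (fun v : 'I_2 -> V => O (v ord0) (v ord_max)) r x = (r * 2)`!%:R^-1 * Pf x.
Proof.
elim: r x => [|r IH] x.
  rewrite /= /Pf (big_pred1 1%g) => [|s]; first by rewrite odd_perm1 mul1r fact0 invr1 mul1r.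
  by apply/esym/eqP/permP => -[].
rewrite /= /wedge; congr (_ * _).
under eq_bigr do rewrite IH /Pf mulrCA -mulrA.
rewrite -mulr_sumr.
transitivity ((r * 2)`!%:R^-1 * \sum_(t : 'S_(r * 2)) Pf x); last first.
  rewrite sumr_const card_Sn -[Pf x *+ _]mulr_natl mulrA mulVf ?mul1r//.
congr (_ * _).
under eq_bigr do rewrite mulr_sumr mulr_sumr.
rewrite exchange_big /=; apply: eq_bigr => t _.
rewrite /Pf (reindex_inj (mulgI (lift2 (t^-1)%g))) /=; apply: eq_bigr => s _.
rewrite !permM !lift2_lshift odd_permM odd_lift2 odd_permV signr_addb.
rewrite (@eq_pairprod _ _ (fun b => x (s (rshift 2 b)))); last first.
  by move=> b; rewrite permM lift2_rshift permK.
move: (O _ _) (pairprod _) ((-1) ^+ odd_perm s : R) => o q e.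
by case: (odd_perm t); rewrite /= ?expr0 ?expr1; ring.
Qed.

Lemma pairprod_orth r (x : 'I_(r * 2) -> V) p :
  (forall q, q != p -> O (x p) (x q) = 0) -> pairprod x = 0.
Proof.
elim: r x p => [|r IH] x p xp; first by case: p xp.
case: (split_ordP (p : 'I_(2 + r * 2))) => c Ec; subst p; last first.
  rewrite /= (IH _ c) ?mulr0// => q qc; apply: xp.
  by apply: contraNneq qc => /rshift_inj ->.
rewrite /=; suff -> : O (x (lshift (r * 2) (ord0 : 'I_2))) (x (lshift (r * 2) (ord_max : 'I_2))) = 0.
  by rewrite mul0r.
have [E|E] : c = ord0 \/ c = ord_max.
  by case: (c) => [[|[|//]] ic]; [left|right]; apply/val_inj.
  by rewrite -E xp// E.
by rewrite O_skew -E xp ?oppr0// E.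
Qed.

Definition upd n (x : 'I_n -> V) (p : 'I_n) (v : V) : 'I_n -> V :=
  fun q => if q == p then v else x q.

Lemma pairprod_upd r (x : 'I_(r * 2) -> V) p c v v' :
  pairprod (upd x p (c *: v + v')) = c * pairprod (upd x p v) + pairprod (upd x p v').
Proof.
have O_linr a u y w : O w (a *: u + y) = a * O w u + O w y.
  by rewrite !(O_skew w) O_lin; lra.
elim: r x p => [|r IH] x p; first by case: p.
case: (split_ordP (p : 'I_(2 + r * 2))) => e Ee; subst p; last first.
  have E y : (fun b => upd x (rshift 2 e) y (rshift 2 b)) =
             upd (fun b => x (rshift 2 b)) e y.
    by apply/funext => b; rewrite /upd; congr (if _ then _ else _).
  have L y (q : 'I_2) : upd x (rshift 2 e) y (lshift (r * 2) q) = x (lshift (r * 2) q).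
    by rewrite /upd; have -> : (lshift (r * 2) q == rshift 2 e) = false by exact: eq_lrshift.
  by rewrite /= !E IH !L; ring.
have E y : (fun b => upd x (lshift (r * 2) e) y (rshift 2 b)) = (fun b => x (rshift 2 b)).
  apply/funext => b; rewrite /upd.
  by have -> : (rshift 2 b == lshift (r * 2) e) = false by exact: eq_rlshift.
have L y (q : 'I_2) : upd x (lshift (r * 2) e) y (lshift (r * 2) q) =
    if q == e then y else x (lshift (r * 2) q).
  by rewrite /upd; congr (if _ then _ else _).
rewrite /= !E !L.
have [->|->] : e = ord0 \/ e = ord_max.
  by case: (e) => [[|[|//]] ic]; [left|right]; apply/val_inj.
by rewrite !eqxx /= O_lin; move: (O _ _) (O _ _) (pairprod _) => o o' q; ring.
by rewrite !eqxx /= O_linr; move: (O _ _) (O _ _) (pairprod _) => o o' q; ring.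
Qed.

Lemma Pf_upd r (x : 'I_(r * 2) -> V) p c v v' :
  Pf (upd x p (c *: v + v')) = c * Pf (upd x p v) + Pf (upd x p v').
Proof.
rewrite /Pf mulr_sumr -big_split; apply: eq_bigr => s _ /=.
have E y : (fun q => upd x p y (s q)) = upd (x \o s) ((s^-1)%g p) y.
  apply/funext => q; rewrite /upd /= -{1}(permKV s p).
  by rewrite (inj_eq perm_inj).
by rewrite !E pairprod_upd mulrDr mulrCA.
Qed.

Lemma Pf_repeat r (x : 'I_(r * 2) -> V) p q : p != q -> x p = x q -> Pf x = 0.
Proof.
move=> pq xpq; suff : Pf x = - Pf x by lra.
rewrite {1}/Pf (reindex_inj (mulIg (tperm p q))) /= /Pf -sumrN; apply: eq_bigr => s _.
rewrite odd_permM odd_tperm pq addbT signrN mulNr; congr (- (_ * _)).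
apply: eq_pairprod => b; rewrite permM.
by case: tpermP => [->|->|//]; rewrite xpq.
Qed.

Lemma Pf_orth r (x : 'I_(r * 2) -> V) p :
  (forall q, q != p -> O (x p) (x q) = 0) -> Pf x = 0.
Proof.
move=> xp; rewrite /Pf big1// => s _; rewrite (@pairprod_orth _ _ ((s^-1)%g p)) ?mulr0// => q qp.
rewrite permKV; apply: xp; apply: contraNneq qp => <-; by rewrite permK.
Qed.

Let q0 r : 'I_(r.+1 * 2) := lshift (r * 2) (ord0 : 'I_2).
Let q1 r : 'I_(r.+1 * 2) := lshift (r * 2) (ord_max : 'I_2).
Let sh r (b : 'I_(r * 2)) : 'I_(r.+1 * 2) := rshift 2 b.

Let pairprodS r (y : 'I_(r.+1 * 2) -> V) :
  pairprod y = O (y (q0 r)) (y (q1 r)) * pairprod (fun b => y (sh b)).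
Proof. by []. Qed.

Let q01 r : q0 r != q1 r. Proof. by []. Qed.
Let q0sh r (b : 'I_(r * 2)) : q0 r != sh b. Proof. by []. Qed.
Let q1sh r (b : 'I_(r * 2)) : q1 r != sh b. Proof. by []. Qed.
Let q_cases r (p : 'I_(r.+1 * 2)) : [\/ p = q0 r, p = q1 r | exists b, p = sh b].
Proof.
case: (split_ordP (p : 'I_(2 + r * 2))) => e ->; last by constructor 3; exists e.
have [->|->] : e = ord0 \/ e = ord_max; last 2 first.
- by constructor 1.
- by constructor 2.
by case: (e) => [[|[|//]] ic]; [left|right]; apply/val_inj.
Qed.

(** Built from two moves: a swap inside a pair is odd and changes the sign by skewness, and an
    exchange of two whole pairs is even and leaves the product alone. *)
Lemma pairprod_sign_perm r (p : 'I_(r.+1 * 2)) : exists pi : 'S_(r.+1 * 2),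
  pi (q0 r) = p /\
  forall y : 'I_(r.+1 * 2) -> V, pairprod (fun b => y (pi b)) = (-1) ^+ pi * pairprod y.
Proof.
elim: r p => [|r IH] p; case: (q_cases p) => [->|->|[b ->]].
- exists 1%g; split=> [|y]; first by rewrite perm1.
  by rewrite odd_perm1 expr0 mul1r; apply: eq_pairprod => b; rewrite perm1.
- exists (tperm (q0 0) (q1 0)); split=> [|y]; first by rewrite tpermL.
  by rewrite odd_tperm q01 expr1 mulN1r !pairprodS tpermL tpermR O_skew mulNr.
- by case: b.
- exists 1%g; split=> [|y]; first by rewrite perm1.
  by rewrite odd_perm1 expr0 mul1r; apply: eq_pairprod => b; rewrite perm1.
- exists (tperm (q0 r.+1) (q1 r.+1)); split=> [|y]; first by rewrite tpermL.
  rewrite odd_tperm q01 expr1 mulN1r (pairprodS y) pairprodS tpermL tpermR O_skew mulNr.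
  congr (- (_ * _)); apply: eq_pairprod => b.
  by rewrite tpermD // ?q0sh ?q1sh.
have [pi [pib Hpi]] := IH b.
(* The exchange of the first two pairs; [lift2 pi] works on all pairs but the first. *)
pose bl := (tperm (q0 r.+1) (sh (q0 r)) * tperm (q1 r.+1) (sh (q1 r)))%g.
have bl_odd : odd_perm bl = false.
  by rewrite odd_permM !odd_tperm.
have bl0 : bl (q0 r.+1) = sh (q0 r).
  by rewrite permM tpermL tpermD.
exists (bl * lift2 pi)%g; split.
  by rewrite permM bl0 [LHS]lift2_rshift pib.
move=> y; rewrite odd_permM bl_odd odd_lift2 addFb.
have swap (z : 'I_(r.+2 * 2) -> V) : pairprod (fun b0 => z (bl b0)) = pairprod z.
  have b1 : bl (q1 r.+1) = sh (q1 r).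
    by rewrite permM (tpermD (x := q0 r.+1)) // tpermL.
  have b2 : bl (sh (q0 r)) = q0 r.+1.
    by rewrite permM tpermR tpermD.
  have b3 : bl (sh (q1 r)) = q1 r.+1.
    by rewrite permM (tpermD (x := q0 r.+1)) // tpermR.
  have b4 (e : 'I_(r * 2)) : bl (sh (sh e)) = sh (sh e).
    by rewrite permM (tpermD (x := q0 r.+1)) // tpermD.
  rewrite !pairprodS bl0 b1 b2 b3 mulrCA; congr (_ * (_ * _)).
  by apply: eq_pairprod => e; rewrite b4.
transitivity (@pairprod r.+2 (fun b0 => (y \o lift2 pi) (bl b0))).
  by apply: eq_pairprod => z; rewrite permM.
rewrite swap (pairprodS y) mulrCA -(Hpi (fun b => y (sh b))).
apply: (etrans (pairprodS _)); congr (O (y _) (y _) * _).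
- exact: lift2_lshift.
- exact: lift2_lshift.
- by apply: eq_pairprod => e; congr (y _); exact: lift2_rshift.
Qed.

Lemma sum_lift_perm n (F : 'S_n.+1 -> R) :
  \sum_(s : 'S_n.+1 | s ord0 == ord0) F s = \sum_(t : 'S_n) F (lift_perm ord0 ord0 t).
Proof.
rewrite (reindex (lift_perm ord0 ord0)); last first.
  pose ulsf (s : 'S_n.+1) k := odflt k (unlift (s ord0) (s (lift ord0 k))).
  have ulsfK (s : 'S_n.+1) k : lift (s ord0) (ulsf s k) = s (lift ord0 k).
    rewrite /ulsf; have := neq_lift ord0 k.
    by rewrite -(can_eq (permK s)) => /unlift_some[] ? ? ->.
  have inj_ulsf s : injective (ulsf s).
    move=> k k' E; apply: (@lift_inj _ ord0); apply: (@perm_inj _ s).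
    by rewrite -!ulsfK E.
  exists (fun s => perm (inj_ulsf s)) => [t _|s].
    apply/permP => k; rewrite permE; apply: (@lift_inj _ ord0).
    by have := ulsfK (lift_perm ord0 ord0 t) k; rewrite lift_perm_id lift_perm_lift.
  rewrite inE => /eqP s0; apply/permP => k.
  case: (unliftP ord0 k) => [k'|] ->; last by rewrite lift_perm_id s0.
  by rewrite lift_perm_lift permE -ulsfK s0.
by apply: eq_bigl => t; rewrite lift_perm_id eqxx.
Qed.

Lemma sum_lift2 r (F : 'S_(r.+1 * 2) -> R) :
  \sum_(s : 'S_(r.+1 * 2) | (s (q0 r) == q0 r) && (s (q1 r) == q1 r)) F s =
  \sum_(t : 'S_(r * 2)) F (lift2 t).
Proof.
rewrite -(sum_lift_perm (fun t => F (lift_perm ord0 ord0 t))).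
rewrite big_mkcondr /=.
have := @sum_lift_perm (r * 2).+1 (fun s : 'S_(2 + r * 2) => if s (q1 r) == q1 r then F s else 0).
have -> : (ord0 : 'I_(r * 2).+2) = q0 r by exact/val_inj.
move=> ->; rewrite [RHS]big_mkcond /=; apply: eq_bigr => t _.
have -> : q1 r = lift (ord0 : 'I_(2 + r * 2)) (ord0 : 'I_(1 + r * 2)) by exact/val_inj.
by rewrite lift_perm_lift (inj_eq (@lift_inj _ _)).
Qed.

(* Split the sum by the position of [y (q0 r)]: all positions contribute equally,
   and in the first one [y (q0 r)] pairs only with [y (q1 r)]. *)
Lemma Pf_split r (y : 'I_(r.+1 * 2) -> V) :
  (forall b, O (y (q0 r)) (y (sh b)) = 0) ->
  Pf y = (r.+1 * 2)%:R * (O (y (q0 r)) (y (q1 r)) * Pf (fun b => y (sh b))).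
Proof.
move=> y0.
pose a (s : 'S_(r.+1 * 2)) : R := (-1) ^+ s * pairprod (fun b => y (s b)).
have pos p : \sum_(s : 'S_(r.+1 * 2) | s p == q0 r) a s =
             \sum_(s : 'S_(r.+1 * 2) | s (q0 r) == q0 r) a s.
  have [pi [pip Hpi]] := pairprod_sign_perm p.
  rewrite [RHS](reindex_inj (mulgI pi)) /=; apply: eq_big => s; first by rewrite permM pip.
  move=> _; rewrite /a odd_permM signr_addb.
  have -> : pairprod (fun b => y ((pi * s)%g b)) = pairprod (fun b => (y \o s) (pi b)).
    by apply: eq_pairprod => b; rewrite permM.
  by rewrite Hpi mulrACA -signr_addb addbb mul1r.
have -> : Pf y = \sum_(p : 'I_(r.+1 * 2)) \sum_(s : 'S_(r.+1 * 2) | s p == q0 r) a s.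
  rewrite (exchange_big_dep xpredT) //= /Pf; apply: eq_bigr => s _.
  rewrite (big_pred1 ((s^-1)%g (q0 r))) // => p.
  by apply/eqP/eqP => [<-|->]; rewrite ?permK ?permKV.
under eq_bigr do rewrite pos.
rewrite sumr_const card_ord -[LHS]mulr_natl; congr (_ * _).
have y_q0 (s : 'S_(r.+1 * 2)) : s (q0 r) = q0 r -> s (q1 r) != q1 r -> a s = 0.
  move=> s0 s1; rewrite /a pairprodS s0.
  case: (q_cases (s (q1 r))) => [E|E|[b ->]].
  - by have := q01 r; rewrite -(inj_eq (@perm_inj _ s)) s0 E eqxx.
  - by rewrite E eqxx in s1.
  - by rewrite y0 mul0r mulr0.
rewrite (bigID (fun s : 'S_(r.+1 * 2) => s (q1 r) == q1 r)) /= [X in _ + X]big1 ?addr0; last first.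
  by move=> s /andP[/eqP s0 s1]; exact: y_q0.
rewrite sum_lift2 /Pf mulr_sumr; apply: eq_bigr => t _.
rewrite /a odd_lift2 [RHS]mulrCA; congr (_ * _).
apply: (etrans (pairprodS _)); congr (O (y _) (y _) * _).
- exact: lift2_lshift.
- exact: lift2_lshift.
- by apply: eq_pairprod => e; congr (y _); exact: lift2_rshift.
Qed.

End Pfaffian.

(** * The rank of a skew form read from its wedge powers *)

Section SkewRank.
Variables (R : realType) (d k : nat) (Th : 'M[R]_d).
Let O (u v : 'rV[R]_d) : R := (u *m Th *m v^T) 0 0.
Hypothesis Th_skew : forall u v, O u v = - O v u.
Let W (r : nat) : Defs.form R 'rV[R]_d (r * 2) :=
  wedge_pow (fun v : 'I_2 -> 'rV[R]_d => O (v ord0) (v ord_max)) r.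

Let O_lin a u v w : O (a *: u + v) w = a * O u w + O v w.
Proof. by rewrite /O !mulmxDl -!scalemxAl mxE [X in X + _ = _]mxE. Qed.

Let WE r x : (@W r x = 0) <-> (@Pf _ _ O r x = 0).
Proof.
rewrite /W wedge_pow_Pf; split=> [H|->]; last by rewrite mulr0.
by apply: (mulfI (x := (r * 2)`!%:R^-1)); rewrite ?mulr0.
Qed.

(** Vectors [x] with nonzero Pfaffian have an invertible Gram matrix, so the rank is at least 2k.
    Conversely a vector orthogonal to all [x] lies in the kernel of [Th], since otherwise the next
    wedge power would not vanish; hence the rank is at most 2k. *)
Lemma rank_of_wedge_pow : (forall x, @W k.+1 x = 0) -> (exists x, @W k x <> 0) ->
  \rank Th = (2 * k)%N.
Proof.
move=> W0 [x Wx]; have Px : Pf O x <> 0 by move=> /WE.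
pose X : 'M[R]_(k * 2, d) := \matrix_p x p.
have OX u p : O u (x p) = (u *m Th *m X^T) 0 p.
  rewrite /O mxE [RHS]mxE; apply: eq_bigr => b _; congr (_ * _).
  by rewrite !mxE.
(* If a combination [z] with [c 0 p != 0] is orthogonal to every [x q], replacing [x p] by [z]
   multiplies the Pfaffian by [c 0 p] and also kills it. *)
have free : row_free (X *m (Th *m X^T)).
  apply/negPn/negP; rewrite -kermx_eq0 => /rowV0Pn[c].
  rewrite sub_kermx => /eqP cX /rV0Pn[p cp].
  apply: Px; pose z := c *m X.
  have zE : z = \sum_q c 0 q *: x q.
    by rewrite /z mulmx_sum_row; apply: eq_bigr => q _; rewrite rowK.
  have zx q : O z (x q) = 0.
    by rewrite OX /z -2!mulmxA cX mxE.
  have Pz : Pf O (upd x p z) = 0.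
    apply: (@Pf_orth _ _ _ Th_skew _ _ p) => q qp.
    by rewrite /upd eqxx (negbTE qp).
  have Pf0 : Pf O (upd x p 0) = 0.
    by have := Pf_upd O_lin Th_skew x p (-1) 0 0; rewrite scaler0 addr0; lra.
  have Psum (r : seq 'I_(k * 2)) : Pf O (upd x p (\sum_(q <- r) c 0 q *: x q)) =
      \sum_(q <- r) c 0 q * Pf O (upd x p (x q)).
    elim: r => [|q r IH]; first by rewrite !big_nil.
    by rewrite !big_cons (Pf_upd O_lin Th_skew) IH.
  have := Psum (index_enum _); rewrite -zE Pz (bigD1 p) //= big1 ?addr0 => [|q qp].
    move/eqP; rewrite eq_sym mulf_eq0 (negbTE cp) => /eqP <-.
    by congr (Pf _ _); apply/funext => q; rewrite /upd; case: eqP => [->|].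
  have -> : Pf O (upd x p (x q)) = 0; last by rewrite mulr0.
  apply: (@Pf_repeat _ _ O _ _ p q); first by rewrite eq_sym.
  by rewrite /upd eqxx (negbTE qp).
apply/eqP; rewrite eqn_leq mulnC; apply/andP; split; last first.
  move: free; rewrite /row_free => /eqP <-.
  by apply: leq_trans (mxrankM_maxr _ _) _; exact: mxrankM_maxl.
have sub : (kermx (Th *m X^T) <= kermx Th)%MS.
  apply/row_subP => i; set u := row i _; rewrite sub_kermx.
  have u0 : u *m (Th *m X^T) = 0 by apply/sub_kermxP; exact: row_sub.
  apply/eqP/rowP => j; rewrite [RHS]mxE.
  (* Prepend [u] and a basis vector to [x]: as [u] is orthogonal to [x], [Pf_split] factors the
     Pfaffian and isolates [O u (delta_mx 0 j)]. *)
  pose y (p : 'I_(2 + k * 2)) : 'rV[R]_d := match fintype.split p with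
    | inl c => if c == ord0 then u else delta_mx 0 j | inr b => x b end.
  have yl c : y (lshift (k * 2) c) = if c == ord0 then u else delta_mx 0 j.
    by rewrite /y (unsplitK (inl c)).
  have yr b : y (rshift 2 b) = x b by rewrite /y (unsplitK (inr b)).
  have y0 b : O (y (lshift (k * 2) ord0)) (y (rshift 2 b)) = 0.
    by rewrite yl yr eqxx OX -mulmxA u0 mxE.
  have /WE := W0 y; rewrite (Pf_split Th_skew y0) !yl eqxx /=.
  have -> : Pf O (fun b => y (rshift 2 b)) = Pf O x.
    by congr (Pf _ _); apply/funext => b; rewrite yr.
  move/eqP; rewrite !mulf_eq0 => /or3P[|/eqP|/eqP/Px//].
    by rewrite pnatr_eq0.
  by rewrite /O trmx_delta -colE mxE.
have := mxrankS sub; rewrite !mxrank_ker => le_ker.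
have : (\rank (Th *m X^T) <= k * 2)%N.
  by apply: leq_trans (mxrankM_maxr _ _) _; rewrite mxrank_tr rank_leq_row.
have := rank_leq_row Th; have := rank_leq_row (Th *m X^T); lia.
Qed.

End SkewRank.

(** * Quasi-Sasakian structures in coordinates *)

Section AlmostContact.
Variables (R : realFieldType) (V : lmodType R) (g : V -> V -> R).
Hypothesis g_lin : forall a u v w, g (a *: u + v) w = a * g u w + g v w.
Hypothesis g_sym : forall u v, g u v = g v u.
Variables (phi : V -> V) (xi : V) (eta : V -> R).
Hypothesis phi_lin : forall a u v, phi (a *: u + v) = a *: phi u + phi v.
Hypothesis phi_phi : forall v, phi (phi v) = - v + eta v *: xi.
Hypothesis eta_lin : forall a u v, eta (a *: u + v) = a * eta u + eta v.
Hypothesis eta_xi : eta xi = 1.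
Hypothesis phi_g : forall u v, g (phi u) (phi v) = g u v - eta u * eta v.

Let phi0 : phi 0 = 0.
Proof. by have := phi_lin (-1) 0 0; rewrite scaler0 addr0 scaleN1r addNr. Qed.
Let phiZ a u : phi (a *: u) = a *: phi u.
Proof. by rewrite -[a *: u]addr0 phi_lin phi0 addr0. Qed.
Let eta0 : eta 0 = 0.
Proof. by have := eta_lin (-1) 0 0; rewrite scaler0 addr0; lra. Qed.
Let etaZ a u : eta (a *: u) = a * eta u.
Proof. by rewrite -[a *: u]addr0 eta_lin eta0 addr0. Qed.

Let eta_phi_xi v : eta (phi v) *: xi = eta v *: phi xi.
Proof.
have E : phi (phi (phi v)) = - phi v + eta v *: phi xi.
  by rewrite [in LHS](phi_phi v) -[- v]scaleN1r phi_lin phiZ scaleN1r.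
by move: E; rewrite (phi_phi (phi v)) => /addrI.
Qed.

(** Computing phi^3 in two ways shows that [phi xi] is a multiple of [xi]; as phi^2 kills [xi], the
    square of the factor is zero. *)
Lemma acm_phi_xi : phi xi = 0.
Proof.
have E : phi xi = eta (phi xi) *: xi by rewrite eta_phi_xi eta_xi scale1r.
have : phi (phi xi) = 0 by rewrite phi_phi eta_xi scale1r addNr.
move: (eta (phi xi)) E => a E; rewrite E phiZ E scalerA => /(congr1 eta); rewrite etaZ eta_xi eta0 mulr1.
by move/eqP; rewrite mulf_eq0 orbb => /eqP ->; rewrite scale0r.
Qed.

Lemma acm_eta_phi v : eta (phi v) = 0.
Proof.
by have /(congr1 eta) := eta_phi_xi v; rewrite acm_phi_xi scaler0 etaZ eta_xi eta0 mulr1.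
Qed.

Lemma acm_eta_g v : eta v = g v xi.
Proof. by have := phi_g v xi; rewrite acm_phi_xi (g0r g_lin g_sym) eta_xi; lra. Qed.

Lemma acm_phi_skew u v : g (phi u) v = - g u (phi v).
Proof.
have := phi_g (phi u) v; rewrite acm_eta_phi mul0r subr0 => <-.
by rewrite phi_phi (gDl g_lin) (gNl g_lin) (gZl g_lin) g_sym (g_sym xi) -acm_eta_g acm_eta_phi mulr0 addr0 g_sym.
Qed.

End AlmostContact.

Section FormIp.
Variables (R : realType) (d : nat) (G : 'M[R]_d).
Implicit Types u v w : 'rV[R]_d.

Lemma ip_lin a u v w : ip G (a *: u + v) w = a * ip G u w + ip G v w.
Proof. by rewrite /ip !mulmxDl -!scalemxAl entryD entryZ. Qed.

Lemma ev_lin (c : 'cV[R]_d) a u v : ev c (a *: u + v) = a * ev c u + ev c v.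
Proof. by rewrite /ev mulmxDl -scalemxAl entryD entryZ. Qed.

Lemma dyad_row (c : 'cV[R]_d) (z : 'rV[R]_d) v : v *m (c *m z) = ev c v *: z.
Proof. by rewrite mulmxA [v *m c]mx11_scalar mul_scalar_mx. Qed.

Lemma ev_flat u v : ev (G *m u^T) v = ip G v u.
Proof. by rewrite /ev /ip mulmxA. Qed.

Lemma evDc (c c' : 'cV[R]_d) v : ev (c + c') v = ev c v + ev c' v.
Proof. by rewrite /ev mulmxDr entryD. Qed.

Lemma evMc (F : 'M[R]_d) (c : 'cV[R]_d) v : ev (F *m c) v = ev c (v *m F).
Proof. by rewrite /ev mulmxA. Qed.

Lemma ev_inj (c c' : 'cV[R]_d) : (forall v, ev c v = ev c' v) -> c = c'.
Proof.
move=> H; apply/colP => i; have := H (delta_mx 0 i).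
by rewrite /ev -!rowE !mxE.
Qed.

Lemma rows_inj m (F F' : 'M[R]_(d, m)) : (forall v : 'rV[R]_d, v *m F = v *m F') -> F = F'.
Proof. by move=> H; apply/row_matrixP => i; rewrite !rowE. Qed.

Lemma ip_inj_mx (F F' : 'M[R]_d) :
  (forall v w, ip F v w = ip F' v w) -> F = F'.
Proof.
move=> H; apply/matrixP => i j; have := H (delta_mx 0 i) (delta_mx 0 j).
by rewrite /ip !trmx_delta -!colE -!rowE !mxE.
Qed.

Lemma ip_mull F v w : ip G (v *m F) w = ip (F *m G) v w.
Proof. by rewrite /ip !mulmxA. Qed.

Lemma ip_mulr F v w : ip G v (w *m F) = ip (G *m F^T) v w.
Proof. by rewrite /ip trmx_mul !mulmxA. Qed.

Lemma ipN_mx v w : ip (- G) v w = - ip G v w.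
Proof. by rewrite /ip mulmxN mulNmx entryN. Qed.

Lemma ip_tr v w : ip G^T v w = ip G w v.
Proof. by rewrite /ip -[RHS]entryT !trmx_mul trmxK mulmxA. Qed.

End FormIp.

Section MetricIp.
Variables (R : realType) (d : nat) (G : 'M[R]_d).
Hypothesis G_sym : forall v w, ip G v w = ip G w v.
Hypothesis G_pos : forall v, v != 0 -> 0 < ip G v v.

Lemma metric_tr : G^T = G.
Proof. by apply: ip_inj_mx => v w; rewrite ip_tr. Qed.

Lemma metric_unit : G \in unitmx.
Proof.
rewrite -row_free_unit -kermx_eq0; apply/negPn/negP => /rowV0Pn[v].
by rewrite sub_kermx => /eqP vG /G_pos; rewrite /ip vG mul0mx mxE ltxx.
Qed.

End MetricIp.

Section QuasiSasakian.
Variables (R : realType) (d : nat) (U : set 'rV[R]_d) (g : 'rV[R]_d -> 'M[R]_d).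
Variables (phi : 'rV[R]_d -> 'M[R]_d) (xi : 'rV[R]_d -> 'rV[R]_d) (eta : 'rV[R]_d -> 'cV[R]_d).
Hypothesis oU : open U.
Hypothesis sg : smooth_mx U g.
Hypothesis sphi : smooth_mx U phi.
Hypothesis sxi : smooth_mx U xi.
Hypothesis g_sym : forall x, U x -> forall v w, ip (g x) v w = ip (g x) w v.
Hypothesis g_pos : forall x, U x -> forall v, v != 0 -> 0 < ip (g x) v v.
Hypothesis phi_phi : forall x, U x -> forall v,
  v *m phi x *m phi x = - v + ev (eta x) v *: xi x.
Hypothesis eta_xi : forall x, U x -> ev (eta x) (xi x) = 1.
Hypothesis phi_g : forall x, U x -> forall v w,
  ip (g x) (v *m phi x) (w *m phi x) = ip (g x) v w - ev (eta x) v * ev (eta x) w.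
Hypothesis nij : forall x, U x -> forall u v,
  v *m pd (u *m phi x) phi x - u *m pd (v *m phi x) phi x
  + u *m pd v phi x *m phi x - v *m pd u phi x *m phi x
  + (ev (pd u eta x) v - ev (pd v eta x) u) *: xi x = 0.
Hypothesis closed : forall x, U x -> forall u v w,
  let dPhi u := pd u (fun y => g y *m (phi y)^T) x in
  ip (dPhi u) v w + ip (dPhi v) w u + ip (dPhi w) u v = 0.
Implicit Types (x u v w : 'rV[R]_d).

Lemma qs_g_tr x : U x -> (g x)^T = g x.
Proof. by move=> Ux; exact: metric_tr (g_sym Ux). Qed.

Lemma qs_g_unit x : U x -> g x \in unitmx.
Proof. by move=> Ux; exact: metric_unit (g_pos Ux). Qed.

Let phi_lin x a u v : (a *: u + v) *m phi x = a *: (u *m phi x) + v *m phi x.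
Proof. by rewrite mulmxDl scalemxAl. Qed.

Lemma qs_phi_xi x : U x -> xi x *m phi x = 0.
Proof.
move=> Ux; apply: (@acm_phi_xi R 'rV[R]_d (fun v => v *m phi x) (xi x) (ev (eta x))).
- exact: phi_lin.
- exact: phi_phi.
- exact: ev_lin.
- exact: eta_xi.
Qed.

Lemma qs_eta_phi x v : U x -> ev (eta x) (v *m phi x) = 0.
Proof.
move=> Ux; apply: (@acm_eta_phi R 'rV[R]_d (fun v => v *m phi x) (xi x) (ev (eta x))).
- exact: phi_lin.
- exact: phi_phi.
- exact: ev_lin.
- exact: eta_xi.
Qed.

Lemma qs_eta x : U x -> eta x = g x *m (xi x)^T.
Proof.
move=> Ux; apply: ev_inj => v; rewrite ev_flat.
apply: (@acm_eta_g R 'rV[R]_d (ip (g x)) (@ip_lin _ _ _) (g_sym Ux)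
  (fun v => v *m phi x) (xi x) (ev (eta x))).
- exact: phi_lin.
- exact: phi_phi.
- exact: ev_lin.
- exact: eta_xi.
- exact: phi_g.
Qed.

Lemma qs_phi_skew x u v : U x -> ip (g x) (u *m phi x) v = - ip (g x) u (v *m phi x).
Proof.
move=> Ux; apply: (@acm_phi_skew R 'rV[R]_d (ip (g x)) (@ip_lin _ _ _) (g_sym Ux)
  (fun v => v *m phi x) (xi x) (ev (eta x))).
- exact: phi_lin.
- exact: phi_phi.
- exact: ev_lin.
- exact: eta_xi.
- exact: phi_g.
Qed.

Let gt := qs_g_tr.
Let gu := qs_g_unit.

Lemma smooth_eta : smooth_mx U eta.
Proof.
apply: (smooth_mx_eq oU (fun y Uy => esym (qs_eta Uy))).
by apply: (smooth_mxM oU) => //; exact: smooth_mx_tr.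
Qed.

Section AtPoint.
Variable x : 'rV[R]_d.
Hypothesis Ux : U x.
Local Notation h u := (nabV g u xi x).
Local Notation T u := (nabT g u phi x).
Local Notation ip := (ip (g x)).
Let ip_simp := g_simp (@ip_lin R d (g x)) (g_sym Ux).

Lemma qs_nabC_eta u : nabC g u eta x = g x *m (h u)^T.
Proof.
by rewrite (nabC_eq g oU Ux u qs_eta) (nabC_flat oU sg gt gu Ux u sxi).
Qed.

Lemma qs_h_eta u : ip (h u) (xi x) = 0.
Proof.
have E : pd u (fun y => xi y *m eta y) x = pd u (fun=> 1%:M) x.
  apply: (pd_eq oU _ _ Ux) => y Uy; rewrite [LHS]mx11_scalar.
  by have := eta_xi Uy; rewrite /ev => ->.
move: E; rewrite (pd_pairing g Ux u sxi smooth_eta) pd_cst qs_nabC_eta.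
move/(congr1 (fun M : 'M[R]_1 => M 0 0)); rewrite entryD entry0 mulmxA.
rewrite -[(h u *m _) 0 0]/(ev (eta x) (h u)) (qs_eta Ux) ev_flat.
by rewrite -[(_ *m _ *m _) 0 0]/(ip (xi x) (h u)) (g_sym Ux (xi x)) => H; lra.
Qed.

Lemma qs_xi_T u : xi x *m T u = - (h u *m phi x).
Proof.
have E : nabV g u (fun y => xi y *m phi y) x = nabV g u (fun=> 0) x.
  apply: (nabV_eq g oU Ux) => y Uy; exact: qs_phi_xi.
move: E; rewrite (nabV_mulmx g Ux u sxi sphi) /nabV pd_cst mul0mx addr0.
by move/eqP; rewrite addrC addr_eq0 => /eqP.
Qed.

Lemma qs_T_skew u v w : ip (v *m T u) w = - ip v (w *m T u).
Proof.
have E : T u *m g x = g x *m (nabT g u (fun y => - phi y) x)^T.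
  apply: (nabT_adjoint oU sg gt gu Ux u sphi (smooth_mxN oU sphi)) => y Uy.
  apply: ip_inj_mx => z z'; rewrite -ip_mull -ip_mulr qs_phi_skew // mulmxN.
  by rewrite (gNr (@ip_lin R d (g y)) (g_sym Uy)).
rewrite ip_mull E (nabT_N g Ux u sphi) -ip_mulr mulmxN.
by rewrite (gNr (@ip_lin R d (g x)) (g_sym Ux)).
Qed.

Lemma qs_T_phi u v : v *m T u *m phi x + v *m phi x *m T u =
  ip v (h u) *: xi x + ev (eta x) v *: h u.
Proof.
have sd := smooth_mxM oU smooth_eta sxi.
have E : nabT g u (fun y => phi y *m phi y) x = nabT g u (fun y => - 1%:M + eta y *m xi y) x.
  apply: (nabT_eq g oU Ux) => y Uy; apply: rows_inj => z.
  by rewrite mulmxA phi_phi // mulmxDr mulmxN mulmx1 dyad_row.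
have s1 : smooth_mx U (fun=> 1%:M : 'M[R]_d) by exact: smooth_mx_cst.
rewrite (nabT_mulmx g Ux u sphi sphi) (nabT_gD g Ux u (smooth_mxN oU s1) sd) in E.
rewrite (nabT_N g Ux u s1) nabT_1 oppr0 add0r (nabT_dyad g Ux u smooth_eta sxi) in E.
rewrite -!mulmxA -mulmxDr E mulmxDr qs_nabC_eta !dyad_row.
by rewrite ev_flat.
Qed.

Lemma qs_deta u v :
  ev (pd u eta x) v - ev (pd v eta x) u = ip (h u) v - ip (h v) u.
Proof.
have E z : pd z eta x = g x *m (h z)^T + chr g z x *m eta x.
  by rewrite -qs_nabC_eta /nabC subrK.
rewrite !E !evDc !ev_flat !evMc (chr_sym oU sg gt Ux u v) (g_sym Ux v) (g_sym Ux u).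
by move: (Defs.ip _ _ _) (Defs.ip _ _ _) (ev _ _) => a b e; ring.
Qed.

(** The hypothesis [nij] with covariant in place of partial derivatives: the Christoffel terms
    cancel because the connection has no torsion. *)
Lemma qs_normal u v :
  v *m T (u *m phi x) - u *m T (v *m phi x) + u *m T v *m phi x - v *m T u *m phi x
  + (ip (h u) v - ip (h v) u) *: xi x = 0.
Proof.
rewrite -qs_deta -(nij Ux u v); congr (_ + _).
have C z z' := chr_sym oU sg gt Ux z z'.
rewrite /nabT; mxexpand.
rewrite (C (v *m phi x) u) (C (u *m phi x) v) (C v u) (C (u *m phi x) (v *m phi x)).
mxring.
Qed.

Lemma qs_cyc u v w :
  ip (v *m T u) w + ip (w *m T v) u + ip (u *m T w) v = 0.
Proof.
have E z : pd z (fun y => g y *m (phi y)^T) x = g x *m (T z)^T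
    + chr g z x *m (g x *m (phi x)^T) + (g x *m (phi x)^T) *m (chr g z x)^T.
  rewrite (pdM Ux _ sg (smooth_mx_tr oU sphi)) pd_tr (chr_metric oU gt gu Ux) /nabT.
  by mxexpand; mxring.
have D z a b : Defs.ip (pd z (fun y => g y *m (phi y)^T) x) a b =
    ip a (b *m T z) + ip (a *m chr g z x) (b *m phi x) + ip a (b *m chr g z x *m phi x).
  by rewrite E /Defs.ip; mxexpand; rewrite !entryD.
have := closed Ux u v w; cbv zeta; rewrite !D.
have C z z' := chr_sym oU sg gt Ux z z'.
have S z z' : ip z (z' *m phi x) = - ip z' (z *m phi x).
  by rewrite -qs_phi_skew // g_sym.
rewrite (C w v) (C u v) (C w u) !(S (_ *m chr g _ x)).
rewrite (qs_T_skew u v w) (qs_T_skew v w u) (qs_T_skew w u v).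
rewrite !(g_sym Ux _ (_ *m chr g _ x *m phi x)).
move: (ip v (w *m T u)) (ip w (u *m T v)) (ip u (v *m T w))
  (ip (u *m chr g v x *m phi x) w) (ip (w *m chr g u x *m phi x) v)
  (ip (w *m chr g v x *m phi x) u) => a b e p q r; lra.
Qed.

Let f u v w := ip (v *m T u) w.
Let th u v := ip (h u) v.

Let phix v := v *m phi x.

Let f_lin1 a u u' v w : f (a *: u + u') v w = a * f u v w + f u' v w.
Proof. by rewrite /f (nabT_lin oU sg gt Ux _ _ _ sphi) mulmxDr -scalemxAr ip_lin. Qed.
Let f_lin3 a u v w w' : f u v (a *: w + w') = a * f u v w + f u v w'.
Proof. by rewrite /f; move: (T u) => z; rewrite !ip_simp. Qed.
Let th_linl a u u' v : th (a *: u + u') v = a * th u v + th u' v.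
Proof. by rewrite /th (nabV_lin oU sg gt Ux _ _ _ sxi) ip_lin. Qed.
Let th_linr a u v v' : th u (a *: v + v') = a * th u v + th u v'.
Proof. by rewrite /th; move: (h u) => z; rewrite !ip_simp. Qed.
Let phix_lin a u v : phix (a *: u + v) = a *: phix u + phix v.
Proof. exact: phi_lin. Qed.
Let f_normal u v w : f (phix u) v w - f (phix v) u w - f v u (phix w) + f u v (phix w)
  + (th u v - th v u) * ev (eta x) w = 0.
Proof.
have := congr1 (ip ^~ w) (qs_normal u v).
rewrite /f /th /phix; move: (h u) (h v) (T _) (T _) (T u) (T v) => hu hv Tu' Tv' Tu Tv.
rewrite !ip_simp !qs_phi_skew // (qs_eta Ux) ev_flat (g_sym Ux (xi x)).
by move: (ip _ _) (ip _ _) (ip _ _) (ip _ _) (ip _ _) (ip _ _) (ip _ _) => *; lra.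
Qed.
Let f_phi u v w : f u (phix v) w - f u v (phix w) =
  th u v * ev (eta x) w + ev (eta x) v * th u w.
Proof.
have := congr1 (ip ^~ w) (qs_T_phi u v).
rewrite /f /th /phix; move: (h u) (T u) => hu Tu.
rewrite !ip_simp !qs_phi_skew // (qs_eta Ux) !ev_flat (g_sym Ux (xi x)) (g_sym Ux v hu).
by move: (ip _ _) (ip _ _) (ip _ _) (ip _ _) (ip _ _) (ip _ _) => *; lra.
Qed.
Let f_xi u w : f u (xi x) w = th u (phix w).
Proof. by rewrite /f qs_xi_T (gNl (@ip_lin R d (g x))) qs_phi_skew // opprK. Qed.
Let f_skew u v w : f u v w = - f u w v.
Proof. by rewrite /f qs_T_skew g_sym. Qed.

Lemma qs_killing u v : ip (h u) v = - ip (h v) u.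
Proof.
exact: (@killing _ _ phix (xi x) (ev (eta x)) th f f_lin1 f_lin3 th_linl th_linr
  (phi_phi Ux) (qs_phi_xi Ux) (eta_xi Ux) f_skew qs_cyc f_normal qs_h_eta f_xi).
Qed.

Lemma qs_h_phi u v : ip (h (u *m phi x)) (v *m phi x) = ip (h u) v.
Proof.
exact: (@dext_invariant _ _ phix (xi x) (ev (eta x)) th f f_lin1 f_lin3 th_linl th_linr
  (phi_phi Ux) (qs_phi_xi Ux) (eta_xi Ux) f_skew qs_cyc f_normal qs_h_eta f_xi).
Qed.

Lemma qs_T_form u v :
  v *m T u = ip (h u *m phi x) v *: xi x - ip v (xi x) *: (h u *m phi x).
Proof.
apply: (g_inj (@ip_lin R d (g x)) (g_pos Ux)) => w.
have := @blair_identity _ _ phix (xi x) (ev (eta x)) th f f_lin1 f_lin3 th_linl th_linr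
  phix_lin (@ev_lin R d (eta x)) (phi_phi Ux) (qs_phi_xi Ux) (fun v => qs_eta_phi v Ux) (eta_xi Ux) f_skew
  qs_cyc f_normal f_phi qs_h_eta f_xi u v w.
rewrite /f => ->; rewrite /th /phix (qs_eta Ux) !ev_flat.
move: (h u) => hu; rewrite !ip_simp !qs_phi_skew // (g_sym Ux (xi x)).
by move: (ip _ _) (ip _ _) (ip _ _) (ip _ _) => *; lra.
Qed.

End AtPoint.
End QuasiSasakian.

(** In a full-rank factorisation [Q = C *m B] idempotency means [B *m C = 1%:M], whose size is the
    rank. *)
Lemma mxtrace_idem (F : fieldType) n (Q : 'M[F]_n) : Q *m Q = Q -> \tr Q = (\rank Q)%:R.
Proof.
move=> QQ; have := row_base_free Q; have := col_base_full Q; have := mulmx_base Q.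
move: (row_base Q) (col_base Q) => B C QE fC fB.
have BC : B *m C = 1%:M.
  apply: (row_free_inj fB); rewrite /= mul1mx; apply: (row_full_inj fC).
  by rewrite !mulmxA QE -mulmxA QE QQ.
by rewrite -[in LHS]QE mxtrace_mulC BC mxtrace1.
Qed.

(* With [P = A / mu], the projector [P - eta (x) xi] and the form [A phi g] have the same rank. *)
Section StructureTensor.
Variables (R : realType) (d : nat) (G A F : 'M[R]_d) (X : 'rV[R]_d) (mu : R).
Local Notation eta := (G *m X^T).
Hypothesis G_unit : G \in unitmx.
Hypothesis AG : A *m G = G *m A^T.
Hypothesis AA : A *m A = mu *: A.
Hypothesis AX : X *m A = mu *: X.
Hypothesis FX : X *m F = 0.
Hypothesis FF : F *m F = - 1%:M + eta *m X.
Hypothesis X_eta : X *m eta = 1%:M.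
Hypothesis mu_neq0 : mu != 0.

Lemma mxtrace_structure_tensor k : \rank (A *m F *m G) = (2 * k)%N ->
  \tr A = mu * (2 * k + 1)%:R.
Proof.
move=> rk; pose P := mu^-1 *: A.
have PP : P *m P = P.
  by rewrite /P -scalemxAl -scalemxAr AA !scalerA mulfVK.
have XP : X *m P = X by rewrite /P -scalemxAr AX scalerA mulVf // scale1r.
have Pe : P *m eta = eta.
  have PG : P *m G = G *m P^T by rewrite /P -scalemxAl AG linearZ -scalemxAr.
  by rewrite mulmxA PG -mulmxA -trmx_mul XP.
move: (G *m X^T) Pe FF X_eta => e Pe FFe Xe; pose Q := P - e *m X.
have QQ : Q *m Q = Q.
  rewrite /Q mulmxBl !mulmxBr PP mulmxA Pe -!mulmxA XP (mulmxA X) Xe mul1mx.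
  by rewrite subrr subr0.
have QF : Q *m F = P *m F by rewrite /Q mulmxBl -[_ *m X *m F]mulmxA FX mulmx0 subr0.
have FQ : P *m F *m F = - Q.
  by rewrite -mulmxA FFe mulmxDr mulmxN mulmx1 mulmxA Pe /Q opprB addrC.
have rQ : \rank Q = (2 * k)%N.
  have -> : \rank Q = \rank (P *m F).
    apply/eqP; rewrite eqn_leq; apply/andP; split.
      by rewrite -mxrank_opp -FQ mxrankM_maxl.
    by rewrite -QF mxrankM_maxl.
  have Gf : row_free G by rewrite row_free_unit.
  rewrite -rk (mxrankMfree (A *m F) Gf) /P -scalemxAl.
  by apply: eqmx_rank; apply/eqmxP; apply: eqmx_scale; rewrite invr_eq0.
(* The rank-one projection [e *m X] onto the Reeb direction accounts for the 1 in [2 * k + 1]. *)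
have trA : A = mu *: (Q + e *m X) by rewrite /Q subrK /P scalerA mulfV // scale1r.
rewrite trA linearZ linearD /= (mxtrace_idem QQ) rQ mxtrace_mulC Xe mxtrace1.
by rewrite natrD.
Qed.

End StructureTensor.

Section StructureDistributions.
Variables (R : realType) (d : nat) (G A : 'M[R]_d) (F : 'I_3 -> 'M[R]_d)
  (X : 'I_3 -> 'rV[R]_d) (mu : R).
Hypothesis G_sym : forall v w, ip G v w = ip G w v.
Hypothesis G_pos : forall v, v != 0 -> 0 < ip G v v.
Hypothesis A_sym : forall v w, ip G (v *m A) w = ip G v (w *m A).
Hypothesis AA : A *m A = mu *: A.
Hypothesis AX : forall a, X a *m A = mu *: X a.
Hypothesis FF : forall a v, v *m F a *m F a = - v + ip G v (X a) *: X a.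
Implicit Types v w : 'rV[R]_d.
Let gl := @ip_lin R d G.

Lemma structure_tensor_eq0 : mu = 0 -> A = 0.
Proof.
move=> mu0; apply: rows_inj => v; rewrite mulmx0.
apply: (g_eq0 G_pos); rewrite A_sym -mulmxA AA mu0 scale0r mulmx0.
exact: (g0r gl G_sym).
Qed.

Lemma structure_tensor_hor v : (forall a, ip G v (X a) = 0) ->
  forall a, ip G (v *m A) (X a) = 0.
Proof. by move=> vX a; rewrite A_sym AX (gZr gl G_sym) vX mulr0. Qed.

Lemma structure_tensor_ker v a : (forall b, ip G v (X b) = 0) ->
  (forall w, ip G (v *m A *m F a) w = 0) -> v *m A = 0.
Proof.
move=> vX vAF; have vAF0 : v *m A *m F a = 0 by apply: (g_eq0 G_pos).
have := FF a (v *m A); rewrite vAF0 mul0mx structure_tensor_hor // scale0r addr0.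
by move/eqP; rewrite eq_sym oppr_eq0 => /eqP.
Qed.

(** The component [w] of [v] in the kernel of [A] is horizontal, so [v] is orthogonal to it by
    hypothesis; it is also orthogonal to the image of [A], hence to itself. *)
Lemma structure_tensor_image v : mu != 0 -> (forall a, ip G v (X a) = 0) ->
  (forall w, (forall a, ip G w (X a) = 0) -> w *m A = 0 -> ip G v w = 0) ->
  v *m A = mu *: v.
Proof.
move=> mu0 vX v_orth; pose w := v - mu^-1 *: (v *m A).
have wA : w *m A = 0.
  by rewrite /w mulmxBl -scalemxAl -mulmxA AA -scalemxAr scalerA mulVf // scale1r subrr.
have wX a : ip G w (X a) = 0.
  by rewrite /w (gDl gl) (gNl gl) (gZl gl) vX structure_tensor_hor // mulr0 subr0.
have vw := v_orth w wX wA.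
have : w = 0.
  apply: (g_eq0 G_pos); rewrite {1}/w (gDl gl) (gNl gl) (gZl gl) vw A_sym wA.
  by rewrite (g0r gl G_sym) mulr0 subr0.
by move/eqP; rewrite subr_eq0 => /eqP E; rewrite [in RHS]E scalerA mulfV // scale1r.
Qed.

End StructureDistributions.

(** * Tensor calculus in a chart *)

Section CovariantDerivativeMatrix.
Variables (R : realType) (d : nat) (U : set 'rV[R]_d) (g : 'rV[R]_d -> 'M[R]_d).
Hypothesis oU : open U.
Hypothesis sg : smooth_mx U g.
Hypothesis g_sym : forall x, U x -> (g x)^T = g x.
Hypothesis g_unit : forall x, U x -> g x \in unitmx.

(** The matrix of u |-> nabla_u X. In a second covariant derivative the direction [u] varies with
    the point, and this form lets the product rule apply. *)
Definition nabM (X : 'rV[R]_d -> 'rV[R]_d) y : 'M[R]_d :=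
  \matrix_(i, j) nabV g (delta_mx 0 i) X y 0 j.

Lemma nabME X y u : smooth_mx U X -> U y -> u *m nabM X y = nabV g u X y.
Proof.
move=> sX Uy; rewrite [in RHS](row_sum_delta u).
have -> : nabV g (\sum_j u 0 j *: delta_mx 0 j) X y =
    \sum_j u 0 j *: nabV g (delta_mx 0 j) X y.
  elim: (index_enum _) => [|j r IH].
    have := nabV_lin oU sg g_sym Uy (-1) 0 0 sX.
    by rewrite scaler0 addr0 scaleN1r addNr !big_nil.
  by rewrite !big_cons (nabV_lin oU sg g_sym Uy _ _ _ sX) IH.
rewrite mulmx_sum_row; apply: eq_bigr => j _; congr (_ *: _).
by apply/rowP => b; rewrite !mxE.
Qed.

Lemma smooth_nabM X : smooth_mx U X -> smooth_mx U (nabM X).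
Proof. by move=> sX; apply: (smooth_mx_rows oU) => i; exact: (smooth_nabV oU sg g_unit). Qed.

End CovariantDerivativeMatrix.

Lemma ev_leibniz (R : realType) d (a a' X Y : 'rV[R]_d) (b b' e : 'cV[R]_d) (k : R) :
  k * ((a *m e + Y *m b) 0 0 - (a' *m e + X *m b') 0 0 - ev e (a - a')) =
  k * (ev b Y - ev b' X).
Proof. by rewrite /ev mulmxBl !(entryD, entryN); ring. Qed.

Lemma koszul_leibniz (R : realType) d (G Gx Gy Gz : 'M[R]_d) (a a' b b' X Y z : 'rV[R]_d) :
  (forall v w, ip G v w = ip G w v) ->
  ((a *m G + Y *m Gx) *m z^T) 0 0 + ((a' *m G + X *m Gy) *m z^T) 0 0
  - ((b *m G + X *m Gz) *m Y^T + X *m G *m b'^T) 0 0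
  + ip G (a - a') z - ip G (0 - b) Y - ip G (0 - b') X =
  2 * ip G a z + ip Gx Y z + ip Gy X z - ip Gz X Y.
Proof.
move=> gs; rewrite !sub0r !(gNl (@ip_lin R d G)) (gDl (@ip_lin R d G)) (gNl (@ip_lin R d G)) (gs b').
by rewrite /ip !mulmxDl !entryD; ring.
Qed.

Lemma ip_delta (R : realType) d (G : 'M[R]_d) v a : ip G v (delta_mx 0 a) = (v *m G) 0 a.
Proof. by rewrite /ip trmx_delta -colE mxE. Qed.

Section ChartCalculus.
Variables (R : realType) (d : nat) (M : manifold R d) (i : atlas M).

Lemma chart_image_open (U : set M) : open U -> U `<=` chart_dom i -> open (chart i @` U).
Proof.
move=> oU Ui; rewrite openE => _ [p Up <-].
have domx : (chart i @` chart_dom i) (chart i p) by exists p => //; exact: Ui.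
have n1 : nbhs (chart i p) (chart i @` chart_dom i).
  by apply: open_nbhs_nbhs; split => //; exact: chart_open.
have n2 : nbhs (chart i p) (unchart i @^-1` U).
  apply: (unchart_continuous domx).
  by rewrite chartK; [apply: open_nbhs_nbhs|exact: Ui].
apply: filterS (filterI n1 n2) => y [[q qi <-]] /=; rewrite chartK // => Uq.
by exists q.
Qed.

Section OnDomain.
Variable U : set M.
Hypothesis oU : open U.
Hypothesis Ui : U `<=` chart_dom i.
Local Notation W := (chart i @` U).
Implicit Types (X Y Z : M -> 'rV[R]_d) (p q : M).

Let oW : open W. Proof. exact: chart_image_open. Qed.
Let WU p : U p -> W (chart i p). Proof. by move=> Up; exists p. Qed.
Let uK p : U p -> unchart i (chart i p) = p. Proof. by move=> /Ui; exact: chartK. Qed.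
Let UW y : W y -> U (unchart i y) /\ chart i (unchart i y) = y.
Proof. by move=> [q Uq <-]; rewrite uK. Qed.

Lemma smooth_const_field v : smooth_at_chart i U (const_field v : M -> 'rV[R]_d).
Proof. exact: (smooth_mx_cst _ v). Qed.

Lemma bracketE X Y p : smooth_at_chart i U X -> smooth_at_chart i U Y -> U p ->
  bracket i X Y p =
  pd (X p) (Y \o unchart i) (chart i p) - pd (Y p) (X \o unchart i) (chart i p).
Proof. by move=> sX sY Up; rewrite /bracket (pdE _ sY (WU Up)) (pdE _ sX (WU Up)). Qed.

Lemma deriv_entry X (F : M -> 'M[R]_1) p :
  Defs.deriv i X (fun q => F q 0 0) p = pd (X p) (F \o unchart i) (chart i p) 0 0.
Proof. by rewrite pd_entry. Qed.

Lemma dextE (eta : M -> 'cV[R]_d) X Y p :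
  smooth_at_chart i U eta -> smooth_at_chart i U X -> smooth_at_chart i U Y -> U p ->
  dext i eta X Y p = 2^-1 * (ev (pd (X p) (eta \o unchart i) (chart i p)) (Y p)
    - ev (pd (Y p) (eta \o unchart i) (chart i p)) (X p)).
Proof.
move=> se sX sY Up; have Wp := WU Up.
rewrite /dext (deriv_entry X (fun q => Y q *m eta q)) (deriv_entry Y (fun q => X q *m eta q)).
rewrite (bracketE sX sY Up) (pdM Wp (X p) sY se) (pdM Wp (Y p) sX se) /= uK //.
exact: ev_leibniz.
Qed.

Section LeviCivita.
Variable g : M -> 'M[R]_d.
Hypothesis sg : smooth_at_chart i U g.
Hypothesis g_sym : forall p, U p -> forall v w, ip (g p) v w = ip (g p) w v.
Hypothesis g_pos : forall p, U p -> forall v, v != 0 -> 0 < ip (g p) v v.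
Local Notation gu := (g \o unchart i).

Lemma koszulE X Y z p : smooth_at_chart i U X -> smooth_at_chart i U Y -> U p ->
  koszul i g X Y (const_field z) p =
  2 * ip (g p) (pd (X p) (Y \o unchart i) (chart i p)) z
  + ip (pd (X p) gu (chart i p)) (Y p) z + ip (pd (Y p) gu (chart i p)) (X p) z
  - ip (pd z gu (chart i p)) (X p) (Y p).
Proof.
move=> sX sY Up; have Wp := WU Up; have sz := smooth_const_field z.
have sYT := smooth_mx_tr oW sY.
rewrite /koszul (deriv_entry X (fun q => Y q *m g q *m z^T)) (deriv_entry Y (fun q => X q *m g q *m z^T)).
rewrite (deriv_entry (const_field z) (fun q => X q *m g q *m (Y q)^T)).
rewrite (bracketE sX sY Up) (bracketE sX sz Up) (bracketE sY sz Up).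
rewrite (pdMl Wp _ _ (smooth_mxM oW sY sg)) (pdMl Wp _ _ (smooth_mxM oW sX sg)).
rewrite (pdM Wp _ (smooth_mxM oW sX sg) sYT) (pdM Wp _ sX sg) (pdM Wp _ sX sg) (pdM Wp _ sY sg).
rewrite !pd_cst pd_tr /= uK //; exact: koszul_leibniz (g_sym Up).
Qed.

Let gt y : W y -> (gu y)^T = gu y.
Proof. by move=> /UW[Uy _]; exact: metric_tr (g_sym Uy). Qed.
Let gun y : W y -> gu y \in unitmx.
Proof. by move=> /UW[Uy _]; exact: metric_unit (g_pos Uy). Qed.

(** Compare after multiplication by the metric: half of [koszulE] is then the definition [chrE],
    entry by entry. *)
Lemma levi_civitaE X Y p : smooth_at_chart i U X -> smooth_at_chart i U Y -> U p ->
  levi_civita i g X Y p = nabV gu (X p) (Y \o unchart i) (chart i p).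
Proof.
move=> sX sY Up; have Wp := WU Up; have gp : g p = gu (chart i p) by rewrite /= uK.
have gup := gun Wp.
apply: (can_inj (mulmxK gup)); rewrite /levi_civita gp mulmxKV // /nabV mulmxDl.
rewrite chrE -mulmxA -scalemxAl (mulmxKV gup) -scalemxAr !mulmxDr mulmxN.
rewrite (pdrowsE oW sg Wp) /= uK //; apply/rowP => a; rewrite mxE koszulE //.
have E : (Y p *m (pdrows gu (X p) (chart i p))^T) 0 a =
    ip (pd (delta_mx 0 a) gu (chart i p)) (X p) (Y p).
  rewrite mxE /ip [RHS]mxE; apply: eq_bigr => j _.
  by rewrite entryT [pdrows _ _ _ a j]mxE [(Y p)^T j 0]entryT mulrC.
rewrite entryD entryZ !entryD entryN E !ip_delta.
move: (ip _ _ _) ((_ *m g p) 0 a) ((Y p *m _) 0 a) ((X p *m _) 0 a) => k1 k2 k3 k4.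
by rewrite mulrBr !mulrDr mulrA mulVf ?mul1r ?pnatr_eq0 //; ring.
Qed.

Let lc_nabM X Y y : smooth_at_chart i U X -> smooth_at_chart i U Y -> W y ->
  levi_civita i g X Y (unchart i y) = X (unchart i y) *m nabM gu (Y \o unchart i) y.
Proof.
move=> sX sY Wy; have [Uy yK] := UW Wy.
by rewrite (levi_civitaE sX sY Uy) yK (nabME oW sg gt _ sY Wy).
Qed.

Lemma smooth_levi_civita X Y : smooth_at_chart i U X -> smooth_at_chart i U Y ->
  smooth_at_chart i U (levi_civita i g X Y).
Proof.
move=> sX sY; have sN := smooth_nabM oW sg gun sY.
apply: (smooth_mx_eq oW _ (smooth_mxM oW sX sN)) => y Wy.
by rewrite /= lc_nabM.
Qed.

(** Curvature is tensorial: the derivative of [X] in [E1] is cancelled by the bracket term [E3], and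
    the rest is the Ricci identity for constant directions. *)
Lemma curvatureE X Y z p : smooth_at_chart i U X -> smooth_at_chart i U Y -> U p ->
  curvature i g (const_field z) X Y p = Y p *m curv gu z (X p) (chart i p).
Proof.
move=> sX sY Up; have Wp := WU Up; have sz := smooth_const_field z.
have sN := smooth_nabM oW sg gun sY.
pose x := chart i p; pose Yu := Y \o unchart i; pose N := nabM gu Yu.
have sb : smooth_at_chart i U (bracket i (const_field z) X).
  apply: (smooth_mx_eq oW _ (smooth_mx_pd oW z sX)) => y Wy; have [Uy yK] := UW Wy.
  by rewrite /= (bracketE sz sX Uy) pd_cst subr0 yK.
have E1 : levi_civita i g (const_field z) (levi_civita i g X Y) p =
    pd z (X \o unchart i) x *m N x + nabV gu z (nabV gu (X p) Yu) x.
  rewrite (levi_civitaE sz (smooth_levi_civita sX sY) Up).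
  rewrite (nabV_eq gu oW Wp z (fun y => lc_nabM sX sY)).
  rewrite -(nabV_eq gu oW Wp z (fun y => nabME oW sg gt (X p) sY)).
  rewrite /nabV (pdM Wp z sX sN) (pdMr Wp z (X p) sN) /= uK //.
  by rewrite addrA.
have E2 : levi_civita i g X (levi_civita i g (const_field z) Y) p =
    nabV gu (X p) (nabV gu z Yu) x.
  rewrite (levi_civitaE sX (smooth_levi_civita sz sY) Up).
  rewrite (nabV_eq gu oW Wp (X p) (fun y => lc_nabM sz sY)).
  by rewrite (nabV_eq gu oW Wp (X p) (fun y => nabME oW sg gt z sY)).
have E3 : levi_civita i g (bracket i (const_field z) X) Y p =
    pd z (X \o unchart i) x *m N x.
  rewrite (levi_civitaE sb sY Up) (bracketE sz sX Up) pd_cst subr0.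
  by rewrite -(nabME oW sg gt _ sY Wp).
rewrite /curvature E1 E2 E3.
have := ricci_vec oW sg gun Wp z (X p) sY; rewrite /= uK // => <-.
move: (pd _ _ _ *m _) (nabV _ z _ _) (nabV _ (X p) _ _) => q q1 q2.
by rewrite addrAC (addrC q) addrK.
Qed.

End LeviCivita.

End OnDomain.
End ChartCalculus.

(** * Three-quasi-Sasakian structures in coordinates *)

(** The arithmetic of [nabT_Hmx_cyc]: [k1 + k2 + k3 = 0] is the Bianchi identity, and skewness turns
    the three differences into pairwise sums. *)
Lemma cyclic_skew_sum (R : realFieldType) (p p' q q' r r' k1 k2 k3 : R) :
  p - q' = - k1 -> q - r' = - k2 -> r - p' = - k3 ->
  p = - p' -> q = - q' -> r = - r' -> k1 + k2 + k3 = 0 -> p + q + r = 0.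
Proof. lra. Qed.

Lemma half_sumN (R : realFieldType) (p : R) : 2^-1 * (- p - p) = - p.
Proof. lra. Qed.

Section ThreeQuasiSasakian.
Variables (R : realType) (d : nat) (U : set 'rV[R]_d) (g : 'rV[R]_d -> 'M[R]_d).
Variables (phi : 'I_3 -> 'rV[R]_d -> 'M[R]_d) (xi : 'I_3 -> 'rV[R]_d -> 'rV[R]_d)
  (eta : 'I_3 -> 'rV[R]_d -> 'cV[R]_d) (mu : R).
Local Notation s := ordS.
Hypothesis oU : open U.
Hypothesis sg : smooth_mx U g.
Hypothesis sphi : forall a, smooth_mx U (phi a).
Hypothesis sxi : forall a, smooth_mx U (xi a).
Hypothesis g_sym : forall x, U x -> forall v w, ip (g x) v w = ip (g x) w v.
Hypothesis g_pos : forall x, U x -> forall v, v != 0 -> 0 < ip (g x) v v.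
Hypothesis phi_phi : forall a x, U x -> forall v,
  v *m phi a x *m phi a x = - v + ev (eta a x) v *: xi a x.
Hypothesis eta_xi : forall a x, U x -> ev (eta a x) (xi a x) = 1.
Hypothesis phi_g : forall a x, U x -> forall v w,
  ip (g x) (v *m phi a x) (w *m phi a x) = ip (g x) v w - ev (eta a x) v * ev (eta a x) w.
Hypothesis nij : forall a x, U x -> forall u v,
  v *m pd (u *m phi a x) (phi a) x - u *m pd (v *m phi a x) (phi a) x
  + u *m pd v (phi a) x *m phi a x - v *m pd u (phi a) x *m phi a x
  + (ev (pd u (eta a) x) v - ev (pd v (eta a) x) u) *: xi a x = 0.
Hypothesis closed : forall a x, U x -> forall u v w,
  let dPhi u := pd u (fun y => g y *m (phi a y)^T) x in
  ip (dPhi u) v w + ip (dPhi v) w u + ip (dPhi w) u v = 0.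
Hypothesis quat1 : forall a x, U x -> forall v,
  v *m phi (s (s a)) x = v *m phi (s a) x *m phi a x - ev (eta (s a) x) v *: xi a x.
Hypothesis quat2 : forall a x, U x -> forall v,
  v *m phi (s (s a)) x = - (v *m phi a x *m phi (s a) x) + ev (eta a x) v *: xi (s a) x.
Hypothesis xi_s : forall a x, U x -> xi (s a) x *m phi a x = xi (s (s a)) x.
Hypothesis xi_ss : forall a x, U x -> xi a x *m phi (s a) x = - xi (s (s a)) x.
Hypothesis xi_bracket : forall a x, U x ->
  pd (xi a x) (xi (s a)) x - pd (xi (s a) x) (xi a) x = (2 * mu) *: xi (s (s a)) x.
Implicit Types (x u v w : 'rV[R]_d) (a : 'I_3).

Let gt x (Ux : U x) : (g x)^T = g x. Proof. exact: metric_tr (g_sym Ux). Qed.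
Let gu x (Ux : U x) : g x \in unitmx. Proof. exact: metric_unit (g_pos Ux). Qed.
Let etaE a x (Ux : U x) : eta a x = g x *m (xi a x)^T.
Proof. exact: (qs_eta g_sym (phi_phi a) (eta_xi a) (phi_g a) Ux). Qed.
Let seta a : smooth_mx U (eta a).
Proof. exact: (smooth_eta oU sg (sxi a) g_sym (phi_phi a) (eta_xi a) (phi_g a)). Qed.

Definition Hmx a : 'rV[R]_d -> 'M[R]_d := nabM g (xi a).

(** [qsA] for the index [ord0], in matrix form; by [AmxE] every index gives the same field. *)
Definition Amx y : 'M[R]_d := Hmx ord0 y *m phi ord0 y + mu *: (eta ord0 y *m xi ord0 y).

Lemma HmxE a y u : U y -> u *m Hmx a y = nabV g u (xi a) y.
Proof. exact: (nabME oU sg gt u (sxi a)). Qed.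

Lemma smooth_Hmx a : smooth_mx U (Hmx a).
Proof. exact: (smooth_nabM oU sg gu (sxi a)). Qed.

Lemma smooth_Amx : smooth_mx U Amx.
Proof.
apply: (smooth_mxD oU); first by apply: (smooth_mxM oU) => //; exact: smooth_Hmx.
by apply: (smooth_mxZ oU); exact: (smooth_mxM oU).
Qed.

Section Basics.
Variable x : 'rV[R]_d.
Hypothesis Ux : U x.
Local Notation ipx := (ip (g x)).

Lemma tq_phi_lin a c u v : (c *: u + v) *m phi a x = c *: (u *m phi a x) + v *m phi a x.
Proof. by rewrite mulmxDl scalemxAl. Qed.

Lemma tq_eta a v : ev (eta a x) v = ipx v (xi a x).
Proof. by rewrite etaE // ev_flat. Qed.

Lemma tq_phi_phi a v : v *m phi a x *m phi a x = - v + ipx v (xi a x) *: xi a x.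
Proof. by rewrite -tq_eta; exact: phi_phi. Qed.

Lemma tq_phi_skew a u v : ipx (u *m phi a x) v = - ipx u (v *m phi a x).
Proof. exact: (qs_phi_skew g_sym (phi_phi a) (eta_xi a) (phi_g a)). Qed.

Lemma tq_phi_xi a : xi a x *m phi a x = 0.
Proof. exact: (qs_phi_xi (phi_phi a) (eta_xi a)). Qed.

Lemma tq_xi_xi a : ipx (xi a x) (xi a x) = 1.
Proof. by rewrite -tq_eta; exact: eta_xi. Qed.

Lemma tq_quat1 a v : v *m phi (s (s a)) x =
  v *m phi (s a) x *m phi a x - ipx v (xi (s a) x) *: xi a x.
Proof. by rewrite -tq_eta; exact: quat1. Qed.

Lemma tq_quat2 a v : v *m phi (s (s a)) x =
  - (v *m phi a x *m phi (s a) x) + ipx v (xi a x) *: xi (s a) x.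
Proof. by rewrite -tq_eta; exact: quat2. Qed.

Lemma tq_nabC_eta a u : nabC g u (eta a) x = g x *m (nabV g u (xi a) x)^T.
Proof.
exact: (qs_nabC_eta oU sg (sxi a) g_sym g_pos (phi_phi a) (eta_xi a) (phi_g a)).
Qed.

End Basics.

Section AtPoint.
Variable x : 'rV[R]_d.
Hypothesis Ux : U x.
Local Notation ipx := (ip (g x)).
Let gl := @ip_lin R d (g x).
Let gs := g_sym Ux.
Let gp := g_pos Ux.
Let ph a v := v *m phi a x.
Let X a := xi a x.
Let h a u := nabV g u (xi a) x.
Let T a u v := v *m nabT g u (phi a) x.
Let ph_lin : forall a c u v, ph a (c *: u + v) = c *: ph a u + ph a v := @tq_phi_lin x.
Let ph_ph : forall a v, ph a (ph a v) = - v + ipx v (X a) *: X a := tq_phi_phi Ux.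
Let ph_skew : forall a u v, ipx (ph a u) v = - ipx u (ph a v) := tq_phi_skew Ux.
Let ph_X : forall a, ph a (X a) = 0 := tq_phi_xi Ux.
Let X_X : forall a, ipx (X a) (X a) = 1 := tq_xi_xi Ux.
Let X_s : forall a, ph a (X (s a)) = X (s (s a)) := fun a => xi_s a Ux.
Let X_ss : forall a, ph (s a) (X a) = - X (s (s a)) := fun a => xi_ss a Ux.

Let h_skew a u v : ipx (h a u) v = - ipx (h a v) u.
Proof. exact: (qs_killing oU sg (sphi a) (sxi a) g_sym g_pos (phi_phi a) (eta_xi a) (phi_g a) (nij a) (closed a)). Qed.
Let h_phi a u v : ipx (h a (ph a u)) (ph a v) = ipx (h a u) v.
Proof. exact: (qs_h_phi oU sg (sphi a) (sxi a) g_sym g_pos (phi_phi a) (eta_xi a) (phi_g a) (nij a) (closed a)). Qed.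
Let h_eta a u : ipx (h a u) (X a) = 0.
Proof. exact: (qs_h_eta oU sg (sxi a) g_sym g_pos (phi_phi a) (eta_xi a) (phi_g a)). Qed.
Let T_form a u v :
  T a u v = ipx (ph a (h a u)) v *: X a - ipx v (X a) *: ph a (h a u).
Proof. exact: (qs_T_form oU sg (sphi a) (sxi a) g_sym g_pos (phi_phi a) (eta_xi a) (phi_g a) (nij a) (closed a)). Qed.

Let T_quat a u v : T (s (s a)) u v =
  ph a (T (s a) u v) + T a u (ph (s a) v) - ipx (h (s a) u) v *: X a
  - ipx v (X (s a)) *: h a u.
Proof.
have sd := smooth_mxM oU (seta (s a)) (sxi a).
have E : nabT g u (phi (s (s a))) x =
    nabT g u (fun y => phi (s a) y *m phi a y + - (eta (s a) y *m xi a y)) x.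
  apply: (nabT_eq g oU Ux) => y Uy; apply: rows_inj => z.
  by rewrite quat1 // mulmxDr mulmxA mulmxN dyad_row.
rewrite /T E (nabT_gD g Ux u (smooth_mxM oU (sphi (s a)) (sphi a)) (smooth_mxN oU sd)).
rewrite (nabT_N g Ux u sd) (nabT_mulmx g Ux u (sphi (s a)) (sphi a)).
rewrite (nabT_dyad g Ux u (seta (s a)) (sxi a)) tq_nabC_eta // /h /ph.
move: (nabT _ _ _ _) (nabT _ _ _ _) (nabV _ _ (xi (s a)) _) (nabV _ _ (xi a) _).
move=> Tb Ta hb ha; rewrite mulmxDr mulmxN !mulmxDr !dyad_row tq_eta // ev_flat opprD addrA.
by rewrite !mulmxA (gs v hb).
Qed.

Let h_bracket a : h (s a) (X a) - h a (X (s a)) = (2 * mu) *: X (s (s a)).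
Proof.
rewrite -xi_bracket // /h /nabV (chr_sym oU sg gt Ux (X (s a)) (X a)).
by rewrite opprD addrACA subrr addr0.
Qed.

Lemma AmxE a u : u *m Amx x = qsA ipx ph X mu h a u.
Proof.
rewrite (qsA_indep gl gs gp ph_lin ph_ph ph_skew ph_X X_X X_s X_ss h_skew h_phi h_eta
  T_form T_quat h_bracket a ord0) qsAE.
rewrite /Amx mulmxDr mulmxA HmxE // -scalemxAr dyad_row tq_eta // scalerA.
by [].
Qed.

Lemma Amx_sym u v : ipx (u *m Amx x) v = ipx u (v *m Amx x).
Proof. by rewrite !(AmxE ord0); exact: (qsA_sym gl gs ph_ph ph_skew mu h_skew h_phi h_eta). Qed.

Lemma Amx_phi a u : u *m phi a x *m Amx x = u *m Amx x *m phi a x.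
Proof. by rewrite !(AmxE a); exact: (qsA_phi gl gs gp ph_lin ph_ph ph_skew ph_X mu h_phi h_eta). Qed.

Lemma Amx_xi a : xi a x *m Amx x = mu *: xi a x.
Proof.
rewrite (AmxE a); exact: (qsA_xi_all gl gs gp ph_lin ph_ph ph_skew ph_X X_X X_s X_ss h_skew h_phi h_eta
  T_form T_quat h_bracket).
Qed.

Lemma nabV_xi_Amx a u : nabV g u (xi a) x = - (u *m Amx x *m phi a x).
Proof. by rewrite (AmxE a) [X in - X](phi_qsA ph_lin ph_ph ph_X mu h_eta) opprK. Qed.

Lemma nabT_phi_Amx a u v : v *m nabT g u (phi a) x =
  ipx (u *m Amx x) v *: xi a x - ipx v (xi a x) *: (u *m Amx x).
Proof. by rewrite (AmxE a); exact: (T_qsA gl gs gp mu T_form). Qed.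

End AtPoint.
Lemma Amx_tr x : U x -> Amx x *m g x = g x *m (Amx x)^T.
Proof.
by move=> Ux; apply: ip_inj_mx => u v; rewrite -ip_mull -ip_mulr Amx_sym.
Qed.

Lemma Hmx_Amx a x : U x -> Hmx a x = - (Amx x *m phi a x).
Proof.
by move=> Ux; apply: rows_inj => u; rewrite HmxE // nabV_xi_Amx // mulmxN mulmxA.
Qed.

Lemma Amx_comm a x : U x -> phi a x *m Amx x = Amx x *m phi a x.
Proof. by move=> Ux; apply: rows_inj => u; rewrite !mulmxA Amx_phi. Qed.

(** The Ricci identity for [xi a], written through the endomorphism field nabla xi_a; the
    Christoffel terms that this rewriting creates cancel by [chr_sym]. *)
Lemma ricci_xi a x u v : U x ->
  v *m nabT g u (Hmx a) x - u *m nabT g v (Hmx a) x = xi a x *m curv g u v x.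
Proof.
move=> Ux; have sH := smooth_Hmx a.
rewrite -(ricci_vec oU sg gu Ux u v (sxi a)).
have E y y' : nabV g y (nabV g y' (xi a)) x =
    y' *m nabT g y (Hmx a) x + y' *m chr g y x *m Hmx a x.
  rewrite -(nabV_eq g oU Ux y (fun q Uq => HmxE a y' Uq)) /nabV.
  by rewrite (pdMr Ux y y' sH) /nabT; mxexpand; mxring.
rewrite !E (chr_sym oU sg gt Ux u v); move: (nabT _ _ _ _) (nabT _ _ _ _) => p q.
by rewrite opprD addrACA subrr addr0.
Qed.

(* The integrability condition d(d eta) = 0, obtained from the Ricci identity for
   the Killing field [xi]. *)
Lemma nabT_Hmx_cyc a x u v w : U x ->
  ip (g x) (v *m nabT g u (Hmx a) x) w + ip (g x) (w *m nabT g v (Hmx a) x) u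
  + ip (g x) (u *m nabT g w (Hmx a) x) v = 0.
Proof.
move=> Ux; pose n u := nabT g u (Hmx a) x.
have sH := smooth_Hmx a.
have ric z z' : z' *m n z - z *m n z' = xi a x *m curv g z z' x by exact: ricci_xi.
have skew z : n z *m g x = - (g x *m (n z)^T).
  have sN := smooth_mxN oU sH.
  rewrite (nabT_adjoint oU sg gt gu Ux z sH sN) => [|y Uy].
    by rewrite (nabT_N g Ux z sH) linearN mulmxN.
  have gphi : phi a y *m g y = - (g y *m (phi a y)^T).
    by apply: ip_inj_mx => p q; rewrite ipN_mx -ip_mull -ip_mulr tq_phi_skew.
  rewrite Hmx_Amx // opprK -[in RHS]Amx_comm // trmx_mul mulNmx -mulmxA gphi mulmxN opprK.
  by rewrite !mulmxA Amx_tr.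
have nsk z p q : ip (g x) (p *m n z) q = - ip (g x) (q *m n z) p.
  by rewrite ip_mull skew ipN_mx -ip_mulr g_sym.
have Ksk p q z : ip (g x) (xi a x *m curv g p q x) z = - ip (g x) (xi a x) (z *m curv g p q x).
  by rewrite ip_mull (curv_skew oU sg gt gu Ux) ipN_mx -ip_mulr.
have e p q z : ip (g x) (q *m n p) z - ip (g x) (p *m n q) z =
    - ip (g x) (xi a x) (z *m curv g p q x).
  rewrite -Ksk -ric (gDl (@ip_lin R d (g x))) (gNl (@ip_lin R d (g x))).
  by [].
have bia := congr1 (ip (g x) (xi a x)) (curv_bianchi oU sg gt gu Ux u v w).
have gs := g_sym Ux.
rewrite !(gDr (@ip_lin R d (g x)) gs) (g0r (@ip_lin R d (g x)) gs) in bia.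
exact: (cyclic_skew_sum (e u v w) (e v w u) (e w u v)
  (nsk u v w) (nsk v w u) (nsk w u v) bia).
Qed.

Section StructureField.
Variable x : 'rV[R]_d.
Hypothesis Ux : U x.
Local Notation ipx := (ip (g x)).
Let gl := @ip_lin R d (g x).
Let gs := g_sym Ux.
Let gp := g_pos Ux.
Let ph a v := v *m phi a x.
Let X a := xi a x.
Let ph_lin : forall a c u v, ph a (c *: u + v) = c *: ph a u + ph a v := @tq_phi_lin x.
Let ph_ph : forall a v, ph a (ph a v) = - v + ipx v (X a) *: X a := tq_phi_phi Ux.
Let ph_skew : forall a u v, ipx (ph a u) v = - ipx u (ph a v) := tq_phi_skew Ux.
Let ph_X : forall a, ph a (X a) = 0 := tq_phi_xi Ux.
Let X_X : forall a, ipx (X a) (X a) = 1 := tq_xi_xi Ux.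
Let X_s : forall a, ph a (X (s a)) = X (s (s a)) := fun a => xi_s a Ux.
Let X_ss : forall a, ph (s a) (X a) = - X (s (s a)) := fun a => xi_ss a Ux.
Let A v := v *m Amx x.
Let B u v := v *m nabT g u Amx x.
Let T a u v := ipx (A u) v *: X a - ipx v (X a) *: A u.

Let A_lin c u v : A (c *: u + v) = c *: A u + A v.
Proof. by rewrite /A mulmxDl scalemxAl. Qed.
Let A_sym u v : ipx (A u) v = ipx u (A v). Proof. exact: Amx_sym. Qed.
Let A_phi a u : A (ph a u) = ph a (A u). Proof. exact: Amx_phi. Qed.
Let A_xi a : A (X a) = mu *: X a. Proof. exact: Amx_xi. Qed.
Let B_lin1 c u u' v : B (c *: u + u') v = c *: B u v + B u' v.
Proof. by rewrite /B (nabT_lin oU sg gt Ux _ _ _ smooth_Amx) mulmxDr scalemxAr. Qed.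
Let B_lin2 c u v v' : B u (c *: v + v') = c *: B u v + B u v'.
Proof. by rewrite /B mulmxDl scalemxAl. Qed.
Let B_sym u v w : ipx (B u v) w = ipx v (B u w).
Proof.
rewrite /B ip_mull ip_mulr.
by rewrite (nabT_adjoint oU sg gt gu Ux u smooth_Amx smooth_Amx) // => y; exact: Amx_tr.
Qed.

Let TE a u v : v *m nabT g u (phi a) x = T a u v.
Proof. exact: nabT_phi_Amx. Qed.

Let B_xi a u : B u (X a) - A (ph a (A u)) = - (mu *: ph a (A u)).
Proof.
have sZ := smooth_mxZ oU mu (sxi a).
have E : nabV g u (fun y => xi a y *m Amx y) x = nabV g u (fun y => mu *: xi a y) x.
  by apply: (nabV_eq g oU Ux) => y Uy; exact: Amx_xi.
have E2 : nabV g u (fun y => mu *: xi a y) x = mu *: nabV g u (xi a) x.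
  by rewrite /nabV (pdZ Ux u mu (sxi a)) scalerDr scalemxAl.
rewrite (nabV_mulmx g Ux u (sxi a) smooth_Amx) E2 (nabV_xi_Amx Ux) in E.
by rewrite /B /A /ph /X addrC -mulNmx E scalerN.
Qed.

Let B_cyc a u v w :
  ipx (T a u (A v) + ph a (B u v)) w + ipx (T a v (A w) + ph a (B v w)) u
  + ipx (T a w (A u) + ph a (B w u)) v = 0.
Proof.
have E p q : q *m nabT g p (Hmx a) x = - (T a p (A q) + ph a (B p q)).
  rewrite (nabT_eq g oU Ux p (fun y => @Hmx_Amx a y)) (nabT_N g Ux p); last exact: (smooth_mxM oU smooth_Amx).
  rewrite (nabT_mulmx g Ux p smooth_Amx (sphi a)) -TE /B /ph /A.
  move: (nabT _ _ _ _) (nabT _ _ _ _) (Amx x) => N N' A'.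
  by rewrite mulmxN mulmxDr !mulmxA addrC.
have := nabT_Hmx_cyc a u v w Ux; rewrite !E.
move: (T _ _ _ + _) (T _ _ _ + _) (T _ _ _ + _) => p q r.
by rewrite !(gNl gl) -!opprD => /eqP; rewrite oppr_eq0 => /eqP.
Qed.

Lemma Amx_Amx : Amx x *m Amx x = mu *: Amx x.
Proof.
apply: rows_inj => u; rewrite mulmxA -scalemxAr.
exact: (A_A gl gs gp ph_lin ph_ph ph_skew ph_X X_X X_s X_ss (tq_quat1 Ux)
  A_lin A_sym A_phi A_xi B_sym B_xi B_cyc).
Qed.

(** The identity A^2 = mu A is assumed on all of [U] because it is differentiated: [B_A] is its
    derivative and [B_phiT] that of the commutation of [A] with [phi a]. *)
Lemma nabT_Amx_of_idem : (forall y, U y -> Amx y *m Amx y = mu *: Amx y) ->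
  mu != 0 -> forall u, nabT g u Amx x = 0.
Proof.
move=> AA mu0 u; apply: rows_inj => v; rewrite mulmx0.
have B_A p q : B p (A q) + A (B p q) = mu *: B p q.
  have := nabT_eq g oU Ux p AA.
  rewrite (nabT_mulmx g Ux p smooth_Amx smooth_Amx) (nabT_Z g Ux mu p smooth_Amx).
  rewrite /A /B; move: (nabT _ _ _ _) (Amx x) => N A' /(congr1 (mulmx q)).
  by rewrite mulmxDr -scalemxAr !mulmxA addrC.
have B_phiT a p q : T a p (A q) + ph a (B p q) = B p (ph a q) + A (T a p q).
  have := nabT_eq g oU Ux p (fun y => @Amx_comm a y).
  rewrite (nabT_mulmx g Ux p smooth_Amx (sphi a)) (nabT_mulmx g Ux p (sphi a) smooth_Amx).
  rewrite -!TE /A /B /ph; move: (nabT _ _ _ _) (nabT _ _ _ _) (Amx x) => N N' A'.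
  by move/(congr1 (mulmx q)); rewrite !mulmxDr !mulmxA => E; rewrite addrC -E addrC.
exact: (B_eq0 gl gs gp ph_lin ph_ph ph_skew ph_X X_X X_s X_ss (tq_quat1 Ux) (tq_quat2 Ux)
  A_lin A_sym A_phi A_xi B_lin1 B_lin2 B_sym B_xi B_cyc mu0 B_A B_phiT u v).
Qed.

End StructureField.

Section RicciCurvature.
Hypothesis mu_neq0 : mu != 0.
Variable x : 'rV[R]_d.
Hypothesis Ux : U x.
Local Notation ipx := (ip (g x)).
Let gl := @ip_lin R d (g x).
Let gs := g_sym Ux.
Local Notation A := (Amx x).
Local Notation K u v := (curv g u v x).

Lemma nabT_Amx y u : U y -> nabT g u Amx y = 0.
Proof. by move=> Uy; apply: nabT_Amx_of_idem => // z Uz; exact: Amx_Amx. Qed.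

Lemma nabT_phi_mx a y v : U y -> nabT g v (phi a) y =
  g y *m (v *m Amx y)^T *m xi a y - eta a y *m (v *m Amx y).
Proof.
move=> Uy; apply: rows_inj => w; rewrite nabT_phi_Amx // mulmxBr !dyad_row ev_flat tq_eta //.
by rewrite (g_sym Uy w (v *m _)).
Qed.

Lemma curv_xi a u v : xi a x *m K u v =
  mu *: (ipx v (xi a x) *: (u *m A) - ipx u (xi a x) *: (v *m A)).
Proof.
have N z w : w *m nabT g z (Hmx a) x =
    - (ipx (z *m A) (w *m A) *: xi a x - (mu * ipx w (xi a x)) *: (z *m A)).
  rewrite (nabT_eq g oU Ux z (fun y => @Hmx_Amx a y)) (nabT_N g Ux z); last exact: (smooth_mxM oU smooth_Amx).
  rewrite (nabT_mulmx g Ux z smooth_Amx (sphi a)) nabT_Amx // mul0mx add0r mulmxN mulmxA.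
  by rewrite nabT_phi_Amx // (Amx_sym Ux w) Amx_xi // (gZr gl gs).
rewrite -ricci_xi // !N (gs (v *m A)).
move: (ipx (u *m A) (v *m A)) (ipx v (xi a x)) (ipx u (xi a x)) => p q r.
move: (u *m A) (v *m A) (xi a x) => z z' y.
by apply/rowP => j; rewrite !(entryD, entryN, entryZ); ring.
Qed.

Definition curv0 u v : 'M[R]_d :=
  g x *m (v *m A)^T *m (u *m A) - g x *m (u *m A)^T *m (v *m A).

Lemma curv0E u v w : w *m curv0 u v =
  ipx w (v *m A) *: (u *m A) - ipx w (u *m A) *: (v *m A).
Proof. by rewrite /curv0 mulmxBr !dyad_row !ev_flat. Qed.

Lemma phi_g_mx a : phi a x *m g x = - (g x *m (phi a x)^T).
Proof.
by apply: ip_inj_mx => p q; rewrite ipN_mx -ip_mull -ip_mulr tq_phi_skew.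
Qed.

(** The Ricci identity for [phi a]. As [A] is parallel, the second derivatives of [phi a] are
    algebraic in [A], [phi a] and the metric, and their commutator is exactly that of [phi a] with
    the model [curv0]. *)
Lemma curv_phi a u v : phi a x *m (K u v - curv0 u v) = (K u v - curv0 u v) *m phi a x.
Proof.
have sA := smooth_Amx.
have svA (z : 'rV[R]_d) : smooth_mx U (fun y => z *m Amx y) by apply: (smooth_mxM oU) => //; exact: smooth_mx_cst.
have sgA (z : 'rV[R]_d) : smooth_mx U (fun y => g y *m (z *m Amx y)^T).
  by apply: (smooth_mxM oU) => //; apply: (smooth_mx_tr oU); exact: svA.
have V z w : nabV g z (fun y => w *m Amx y) x = w *m chr g z x *m A.
  have := nabT_Amx z Ux; rewrite /nabT => /eqP; rewrite subr_eq0 => /eqP E.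
  by rewrite /nabV (pdMr Ux z w sA) -mulmxA -mulmxDr E mulmxA.
have N z w : nabT g z (nabT g w (phi a)) x =
    g x *m (w *m chr g z x *m A)^T *m xi a x - g x *m (w *m A)^T *m (z *m A *m phi a x)
  - (- (g x *m (z *m A *m phi a x)^T *m (w *m A)) + eta a x *m (w *m chr g z x *m A)).
  rewrite (nabT_eq g oU Ux z (fun y => @nabT_phi_mx a y w)).
  rewrite (nabT_gD g Ux z (smooth_mxM oU (sgA w) (sxi a)) (smooth_mxN oU (smooth_mxM oU (seta a) (svA w)))).
  rewrite (nabT_N g Ux z (smooth_mxM oU (seta a) (svA w))).
  rewrite (nabT_dyad g Ux z (sgA w) (sxi a)) (nabT_dyad g Ux z (seta a) (svA w)).
  rewrite (nabC_flat oU sg gt gu Ux z (svA w)) tq_nabC_eta // V (nabV_xi_Amx Ux).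
  by rewrite mulmxN linearN mulmxN mulNmx.
have := ricci_end oU sg gu Ux u v (sphi a); rewrite !N (chr_sym oU sg gt Ux u v).
rewrite /curv0; move: (K u v) (chr g v x) (Amx x) => k G A'.
by mxexpand; rewrite phi_g_mx; mxexpand; mxlin.
Qed.

(** The difference from the model is Ricci-flat, and the model contributes tr A g(Au, w) - g(Aw,
    Au), where A^2 = mu A turns the last term into mu g(Au, w). *)
Lemma ricci_mx w u : \sum_i (w *m K (delta_mx 0 i) u) 0 i = (\tr A - mu) * ipx (u *m A) w.
Proof.
pose K' p q := K p q - curv0 p q.
have K'E y p q : y *m K' p q =
    y *m K p q - (ipx y (q *m A) *: (p *m A) - ipx y (p *m A) *: (q *m A)).
  by rewrite -curv0E; exact: (mulmxBr y (K p q) (curv0 p q)).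
have flat : \sum_i (w *m K' (delta_mx 0 i) u) 0 i = 0.
  apply: (@ricci_flat R d (g x) (fun a => phi a x) (fun a => xi a x) K').
  - exact: gu.
  - exact: tq_phi_phi.
  - exact: tq_quat1.
  - exact: tq_quat2.
  - move=> c p p' q; rewrite /K' (curvDl oU sg gt gu Ux) (curvZl oU sg gt gu Ux) /curv0.
    by move: (K _ _) (K _ _) => k k'; mxexpand; mxring.
  - move=> p q; rewrite /K' curvC /curv0; move: (K _ _) => k; mxring.
  - move=> p q z; rewrite !K'E.
    have S y y' : ipx y (y' *m A) = ipx y' (y *m A) by rewrite -Amx_sym // gs.
    have := curv_bianchi oU sg gt gu Ux p q z.
    rewrite (S z q) (S z p) (S q p).
    move: (ipx q (z *m A)) (ipx p (z *m A)) (ipx p (q *m A)) => c1 c2 c3.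
    move: (z *m K _ _) (p *m K _ _) (q *m K _ _) => y1 y2 y3.
    move: (p *m A) (q *m A) (z *m A) => z1 z2 z3 E.
    rewrite -[RHS]E; apply/rowP => j; rewrite !(entryD, entryN, entryZ); ring.
  - move=> p q; rewrite /K' mulmxBl (curv_skew oU sg gt gu Ux) /curv0.
    move: (K _ _) => k; mxexpand; rewrite gt //; mxring.
  - exact: curv_phi.
  - move=> a p q; rewrite K'E curv_xi.
    have S y : ipx (xi a x) (y *m A) = mu * ipx y (xi a x).
      by rewrite -Amx_sym // Amx_xi // (gZl gl) gs.
    rewrite !S; move: (ipx p (xi a x)) (ipx q (xi a x)) (p *m A) (q *m A) => c1 c2 z1 z2.
    by apply/rowP => j; rewrite !(entryD, entryN, entryZ, entry0); ring.
have E i : (w *m K (delta_mx 0 i) u) 0 i = (w *m K' (delta_mx 0 i) u) 0 i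
    + (ipx (u *m A) w * A i i - (u *m A) 0 i * ipx (w *m A) (delta_mx 0 i)).
  have -> : A i i = ((delta_mx 0 i : 'rV[R]_d) *m A) 0 i by rewrite -rowE [RHS]mxE.
  have S : ipx w (delta_mx 0 i *m A) = ipx (w *m A) (delta_mx 0 i) by rewrite Amx_sym.
  rewrite K'E S (gs w); move: (ipx (w *m A) _) (ipx (u *m A) w) => p q.
  move: (w *m K _ _) (delta_mx 0 i *m A) (u *m A) => k z z'.
  by rewrite entryD entryN entryD entryN !entryZ [_ * z' 0 i]mulrC subrK.
rewrite (eq_bigr _ (fun i _ => E i)) big_split /= flat add0r sumrB -mulr_sumr.
have -> : \sum_i (u *m A) 0 i * ipx (w *m A) (delta_mx 0 i) = ipx (w *m A) (u *m A).
  rewrite [in RHS](row_sum_delta (u *m A)).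
  elim: (index_enum _) => [|i r IH]; first by rewrite !big_nil (g0r gl gs).
  by rewrite !big_cons (gDr gl gs) (gZr gl gs) IH.
rewrite (Amx_sym Ux w (u *m A)) -mulmxA Amx_Amx // -scalemxAr (gZr gl gs) (gs w) /mxtrace.
by move: (ipx w (u *m A)) (\sum_i _) => p q; ring.
Qed.

End RicciCurvature.

(** * Trace, kernel and image of [A] in terms of the forms d eta_a *)

Section StructureRank.
Variable x : 'rV[R]_d.
Hypothesis Ux : U x.
Local Notation ipx := (ip (g x)).
Local Notation A := (Amx x).
Let gl := @ip_lin R d (g x).
Let gs := g_sym Ux.
Let gp := g_pos Ux.
Local Notation dt a u v := (2^-1 * (ev (pd u (eta a) x) v - ev (pd v (eta a) x) u)).

(** By the Killing property both terms of d eta are equal, which absorbs the factor 1/2 of the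
    convention; so d eta_a has matrix [- (A *m phi a x *m g x)]. *)
Lemma dext_Amx a u v : dt a u v = - ipx (u *m A *m phi a x) v.
Proof.
rewrite (qs_deta oU sg (sxi a) g_sym g_pos (phi_phi a) (eta_xi a) (phi_g a) Ux).
rewrite !(nabV_xi_Amx Ux) !(gNl gl).
have -> : ipx (v *m A *m phi a x) u = - ipx (u *m A *m phi a x) v.
  by rewrite tq_phi_skew // (Amx_sym Ux v) Amx_phi // gs.
by rewrite opprK; exact: half_sumN.
Qed.

Section Rank.
Variables (a : 'I_3) (k : nat).
Let W r := wedge_pow (fun v : 'I_2 -> 'rV[R]_d => dt a (v ord0) (v ord_max)) r.
Hypothesis W0 : forall z, @W k.+1 z = 0.
Hypothesis W_neq0 : exists z, @W k z <> 0.

Lemma Amx_rank : \rank (A *m phi a x *m g x) = (2 * k)%N.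
Proof.
pose Th := - (A *m phi a x *m g x).
have O u v : (u *m Th *m v^T) 0 0 = dt a u v.
  by rewrite dext_Amx /ip /Th mulmxN mulNmx entryN !mulmxA.
have Th_skew u v : (u *m Th *m v^T) 0 0 = - (v *m Th *m u^T) 0 0.
  by rewrite !O -mulrN opprB.
have WE r : @W r = wedge_pow (fun v : 'I_2 -> 'rV[R]_d => (v ord0 *m Th *m (v ord_max)^T) 0 0) r.
  by congr (wedge_pow _ r); apply/funext => v; rewrite O.
rewrite -mxrank_opp -/Th; apply: (rank_of_wedge_pow Th_skew); by rewrite -WE.
Qed.

Lemma mu_neq0_of_rank : (0 < k)%N -> mu != 0.
Proof.
move=> k0; apply/negP => /eqP mu0; have := Amx_rank.
rewrite (structure_tensor_eq0 gs gp (Amx_sym Ux) (Amx_Amx Ux) mu0) !mul0mx mxrank0.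
by case: (k) k0.
Qed.

Lemma mxtrace_Amx : mu != 0 -> \tr A = mu * (2 * k + 1)%:R.
Proof.
move=> mu0; apply: (mxtrace_structure_tensor (gu Ux) (Amx_tr Ux) (Amx_Amx Ux)
  (Amx_xi Ux a) (tq_phi_xi Ux a) _ _ mu0 Amx_rank).
- apply: rows_inj => v; rewrite mulmxA tq_phi_phi // mulmxDr mulmxN mulmx1 dyad_row.
  by rewrite ev_flat.
- by apply/rowP => j; rewrite !ord1 mulmxA [RHS]mxE; exact: tq_xi_xi.
Qed.

End Rank.

Lemma Amx_ker a v : (forall b, ev (eta b x) v = 0) -> (forall w, dt a v w = 0) -> v *m A = 0.
Proof.
move=> vX vd; apply: (structure_tensor_ker gs gp (Amx_sym Ux) (Amx_xi Ux) (tq_phi_phi Ux) (a := a)).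
  by move=> b; rewrite -tq_eta.
move=> w; apply/eqP; rewrite -oppr_eq0; apply/eqP; exact: etrans (esym (dext_Amx a v w)) (vd w).
Qed.

Lemma Amx_image v : mu != 0 -> (forall b, ev (eta b x) v = 0) ->
  (forall w, (forall b, ev (eta b x) w = 0) -> (exists b, forall z, dt b w z = 0) ->
     ipx v w = 0) ->
  v *m A = mu *: v.
Proof.
move=> mu0 vX v_orth; apply: (structure_tensor_image gs gp (Amx_sym Ux) (Amx_Amx Ux) (Amx_xi Ux)).
- by [].
- by move=> b; rewrite -tq_eta.
move=> w wX wA; apply: v_orth => [b|]; first by rewrite tq_eta.
exists ord0 => z; rewrite dext_Amx wA mul0mx (g0l gl); exact: oppr0.
Qed.

End StructureRank.

End ThreeQuasiSasakian.

(** * Three-quasi-Sasakian manifolds *)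

Lemma scale_sum6 (R : pzRingType) (k p q r p' q' r' a b c : R) :
  p = p' -> q = q' -> r = r' -> a = 0 -> b = 0 -> c = 0 ->
  k * (p + q + r - a - b - c) = k * (p' + q' + r').
Proof. by move=> -> -> -> -> -> ->; rewrite !subr0. Qed.

Section ConstantFields.
Variables (R : realType) (d : nat) (M : manifold R d) (i : atlas M).
Local Notation D := (chart_dom i).
Local Notation W := (chart i @` D).
Local Notation "F ^" := (F \o unchart i) (at level 2, format "F ^").
Variables (phi g : M -> 'M[R]_d) (eta : M -> 'cV[R]_d).
Hypothesis sphi : smooth_at_chart i D phi.
Hypothesis sg : smooth_at_chart i D g.
Hypothesis seta : smooth_at_chart i D eta.
Variable p : M.
Hypothesis Dp : D p.
Local Notation x := (chart i p).
Implicit Types u v w : 'rV[R]_d.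

Let oW : open W. Proof. exact: chart_open. Qed.
Let Wx : W x. Proof. by exists p. Qed.
Let sc v : smooth_at_chart i D (const_field v : M -> 'rV[R]_d).
Proof. exact: smooth_const_field. Qed.

Lemma bracket_const u v : bracket i (const_field u) (const_field v) p = 0.
Proof. by rewrite (bracketE (sc u) (sc v) Dp) !pd_cst subr0. Qed.

Lemma dext_const u v : dext i eta (const_field u) (const_field v) p =
  2^-1 * (ev (pd u eta^ x) v - ev (pd v eta^ x) u).
Proof. exact: (dextE _ seta (sc u) (sc v) Dp). Qed.

Lemma nijenhuis_const u v : nijenhuis i phi (const_field u) (const_field v) p =
  v *m pd (u *m phi p) phi^ x - u *m pd (v *m phi p) phi^ x
  + u *m pd v phi^ x *m phi p - v *m pd u phi^ x *m phi p.
Proof.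
have sf w : smooth_at_chart i D (fun q => ap (phi q) (const_field w q)).
  exact: (smooth_mxM oW (smooth_mx_cst W w) sphi).
have E w z : pd w ((fun q => ap (phi q) (const_field z q)) \o unchart i) x = z *m pd w phi^ x.
  exact: (pdMr Wx w z sphi).
rewrite /nijenhuis bracket_const (bracketE (sf u) (sf v) Dp).
rewrite (bracketE (sf u) (sc v) Dp) (bracketE (sc u) (sf v) Dp) !pd_cst !E.
rewrite /ap /const_field /= !mul0mx sub0r subr0 mulNmx opprK add0r.
by [].
Qed.

Lemma dfund_form_const u v w :
  dfund_form i phi g (const_field u) (const_field v) (const_field w) p =
  let dPhi u := pd u (fun y => g^ y *m (phi^ y)^T) x in
  3^-1 * (ip (dPhi u) v w + ip (dPhi v) w u + ip (dPhi w) u v).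
Proof.
have sF : smooth_mx W (fun y => g^ y *m (phi^ y)^T).
  by apply: (smooth_mxM oW sg); exact: (smooth_mx_tr oW).
have E z y y' : Defs.deriv i (const_field z)
    (fund_form phi g (const_field y) (const_field y')) p =
    ip (pd z (fun y => g^ y *m (phi^ y)^T) x) y y'.
  rewrite (deriv_entry i (const_field z) (fun q => y *m g q *m (y' *m phi q)^T)).
  have sl := smooth_mxM oW (smooth_mx_cst W y) sF.
  have H q : W q -> ((fun q => y *m g q *m (y' *m phi q)^T) \o unchart i) q =
      y *m (g^ q *m (phi^ q)^T) *m y'^T.
    by move=> _ /=; rewrite trmx_mul !mulmxA.
  by rewrite (pd_eq oW z H Wx) (pdMl Wx z y'^T sl) (pdMr Wx z y sF).
have B z z' y : fund_form phi g (bracket i (const_field z) (const_field z')) (const_field y) p = 0.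
  by rewrite /fund_form bracket_const /ip !mul0mx mxE.
exact: (scale_sum6 _ (E u v w) (E v w u) (E w u v) (B u v w) (B v w u) (B w u v)).
Qed.

End ConstantFields.

Section EvenPermutation.

Let rot_inj (a : 'I_3) : injective (fun b : 'I_3 => a + b). Proof. exact: addrI. Qed.

Lemma even_perm3 (a : 'I_3) : exists s : 'S_3,
  [/\ ~~ odd_perm s, s 0 = a, s 1 = ordS a & s 2 = ordS (ordS a)].
Proof.
exists (perm (@rot_inj a)); rewrite !permE addr0; split => //.
(* A rotation has order dividing three, so its sign is equal to its own cube, which is 1. *)
- suff E : (perm (@rot_inj a) * perm (@rot_inj a) * perm (@rot_inj a) = 1)%g.
    have := odd_perm1 'I_3; rewrite -E !odd_permM.
    by case: (odd_perm _).
  apply/permP => b; rewrite !permM !permE; apply/val_inj.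
  by case: a => -[|[|[|//]]] ?; case: b => -[|[|[|//]]] ?.
- by apply/val_inj; case: a => -[|[|[|//]]] ?.
- by apply/val_inj; case: a => -[|[|[|//]]] ?.
Qed.

End EvenPermutation.

Section ThreeQuasiSasakianChart.
Variables (R : realType) (d l : nat) (M : manifold R d).
Variables (phi : 'I_3 -> mx_comps M) (xi : 'I_3 -> vec_comps M).
Variables (eta : 'I_3 -> covec_comps M) (g : mx_comps M) (c : R).
Hypothesis hM : three_quasi_sasakian phi xi eta g.
Hypothesis hrank : rank_is eta (4 * l + 3).
Hypothesis hc : reeb_brackets xi c.
Variable i : atlas M.
Local Notation D := (chart_dom i).
Local Notation W := (chart i @` D).
Local Notation "F ^" := (F \o unchart i) (at level 2, format "F ^").
Let mu := c / 2.
Let A := Amx (g i)^ (fun a => (phi a i)^) (fun a => (xi a i)^) (fun a => (eta a i)^) mu.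
Implicit Types (a : 'I_3) (p : M) (y u v w : 'rV[R]_d).

Let oW : open W. Proof. exact: chart_open. Qed.
Let WD y : W y -> D (unchart i y) /\ chart i (unchart i y) = y.
Proof. by move=> [q Dq <-]; rewrite chartK. Qed.
Let DW p : D p -> W (chart i p). Proof. by move=> Dp; exists p. Qed.
Let sg : smooth_at_chart i D (g i).
Proof. by have [[[_ _ _ [+ _ _ _]] _ _ _] _ _] := hM.1 ord0. Qed.
Let g_sym p : D p -> forall v w, ip (g i p) v w = ip (g i p) w v.
Proof. by have [[[_ _ _ [_ _ + _]] _ _ _] _ _] := hM.1 ord0; apply. Qed.
Let g_pos p : D p -> forall v, v != 0 -> 0 < ip (g i p) v v.
Proof. by have [[[_ _ _ [_ _ _ +]] _ _ _] _ _] := hM.1 ord0; apply. Qed.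
Let sphi a : smooth_at_chart i D (phi a i).
Proof. by have [[[[+ _] _ _ _] _ _ _] _ _] := hM.1 a. Qed.
Let sxi a : smooth_at_chart i D (xi a i).
Proof. by have [[[_ [+ _] _ _] _ _ _] _ _] := hM.1 a. Qed.
Let seta a : smooth_at_chart i D (eta a i).
Proof. by have [[[_ _ [+ _] _] _ _ _] _ _] := hM.1 a. Qed.

Let gW_sym y : W y -> forall v w, ip ((g i)^ y) v w = ip ((g i)^ y) w v.
Proof. by move=> /WD[/g_sym]. Qed.
Let gW_pos y : W y -> forall v, v != 0 -> 0 < ip ((g i)^ y) v v.
Proof. by move=> /WD[/g_pos]. Qed.
Let phi_phi a y : W y -> forall v,
  v *m (phi a i)^ y *m (phi a i)^ y = - v + ev ((eta a i)^ y) v *: (xi a i)^ y.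
Proof. by move=> /WD[Dy _]; have [[_ + _ _] _ _] := hM.1 a; apply. Qed.
Let eta_xi a y : W y -> ev ((eta a i)^ y) ((xi a i)^ y) = 1.
Proof. by move=> /WD[Dy _]; have [[_ _ + _] _ _] := hM.1 a; apply. Qed.
Let phi_g a y : W y -> forall v w,
  ip ((g i)^ y) (v *m (phi a i)^ y) (w *m (phi a i)^ y) =
  ip ((g i)^ y) v w - ev ((eta a i)^ y) v * ev ((eta a i)^ y) w.
Proof. by move=> /WD[Dy _]; have [[_ _ _ +] _ _] := hM.1 a; apply. Qed.
Let nij a y : W y -> forall u v,
  v *m pd (u *m (phi a i)^ y) (phi a i)^ y - u *m pd (v *m (phi a i)^ y) (phi a i)^ y
  + u *m pd v (phi a i)^ y *m (phi a i)^ y - v *m pd u (phi a i)^ y *m (phi a i)^ y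
  + (ev (pd u (eta a i)^ y) v - ev (pd v (eta a i)^ y) u) *: (xi a i)^ y = 0.
Proof.
move=> /WD[Dy yK] u v; have [_ nrm _] := hM.1 a.
have := nrm i _ _ (smooth_const_field i D u) (smooth_const_field i D v) _ Dy.
rewrite (nijenhuis_const (sphi a) Dy) (dext_const (seta a) Dy) yK mulrA mulfV ?mul1r //.
Qed.
Let closed a y : W y -> forall u v w,
  let dPhi u := pd u (fun y => (g i)^ y *m ((phi a i)^ y)^T) y in
  ip (dPhi u) v w + ip (dPhi v) w u + ip (dPhi w) u v = 0.
Proof.
move=> /WD[Dy yK] u v w; have [_ _ cl] := hM.1 a.
have := cl i _ _ _ (smooth_const_field i D u) (smooth_const_field i D v)
  (smooth_const_field i D w) _ Dy.
rewrite (dfund_form_const (sphi a) sg Dy) yK => /eqP.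
by rewrite mulf_eq0 invr_eq0 pnatr_eq0 /= => /eqP.
Qed.
Let quat a y : W y -> let b := ordS a in let e := ordS b in
  [/\ forall v, v *m (phi e i)^ y =
        v *m (phi b i)^ y *m (phi a i)^ y - ev ((eta b i)^ y) v *: (xi a i)^ y,
      forall v, v *m (phi e i)^ y =
        - (v *m (phi a i)^ y *m (phi b i)^ y) + ev ((eta a i)^ y) v *: (xi b i)^ y,
      (xi b i)^ y *m (phi a i)^ y = (xi e i)^ y
    & (xi a i)^ y *m (phi b i)^ y = - (xi e i)^ y].
Proof.
move=> /WD[Dy _]; have [s [es s0 s1 s2]] := even_perm3 a.
have := hM.2 s es i _ Dy; rewrite /= s0 s1 s2 => -[q1 q2 [x1 x2] _ _]; split => //.
by rewrite x2 opprK.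
Qed.
Let xi_bracket a y : W y ->
  pd ((xi a i)^ y) (xi (ordS a) i)^ y - pd ((xi (ordS a) i)^ y) (xi a i)^ y =
  (2 * mu) *: (xi (ordS (ordS a)) i)^ y.
Proof.
move=> /WD[Dy yK]; have [s [es s0 s1 s2]] := even_perm3 a.
have := hc es Dy; rewrite s0 s1 s2 (bracketE (sxi a) (sxi (ordS a)) Dy) yK => ->.
by rewrite /mu mulrCA mulfV ?mulr1 // pnatr_eq0.
Qed.

Let quat1 a y Wy := let: And4 q _ _ _ := @quat a y Wy in q.
Let quat2 a y Wy := let: And4 _ q _ _ := @quat a y Wy in q.
Let xi_s a y Wy := let: And4 _ _ q _ := @quat a y Wy in q.
Let xi_ss a y Wy := let: And4 _ _ _ q := @quat a y Wy in q.

Local Notation tq lem := (lem R d W (g i)^ (fun a => (phi a i)^) (fun a => (xi a i)^)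
  (fun a => (eta a i)^) mu oW sg sphi sxi gW_sym gW_pos phi_phi eta_xi phi_g nij closed
  quat1) (only parsing).

Section AtPoint.
Variable p : M.
Hypothesis Dp : D p.
Local Notation x := (chart i p).
Let Wx : W x. Proof. exact: DW. Qed.
Let gp : (g i)^ x = g i p. Proof. by rewrite /= chartK. Qed.

Let dext_atE a v w : dext_at i (eta a i) p v w =
  2^-1 * (ev (pd v (eta a i)^ x) w - ev (pd w (eta a i)^ x) v).
Proof. exact: (dext_const (seta a) Dp v w). Qed.

(** Rank 4l + 3 means 2q + 1 with q = 2l + 1, which is positive even for l = 0. Each term of the
    wedge of eta with (d eta)^q contains a value of (d eta)^q, so the latter cannot vanish
    identically. *)
Let rank_form : let a : 'I_3 := ord0 in let q := (2 * l + 1)%N in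
  let dt (v : 'I_2 -> 'rV[R]_d) := 2^-1 * (ev (pd (v ord0) (eta a i)^ x) (v ord_max)
    - ev (pd (v ord_max) (eta a i)^ x) (v ord0)) in
  (forall z, wedge_pow dt q.+1 z = 0) /\ (exists z, wedge_pow dt q z <> 0).
Proof.
move=> a q dt; have [q' qE /(_ i p Dp)] := hrank a.
have -> : q' = q by rewrite /q; lia.
have -> : (fun v : 'I_2 -> 'rV[R]_d => dext_at i (eta a i) p (v ord0) (v ord_max)) = dt.
  by apply/funext => v; rewrite dext_atE.
move=> [[v wv] w0]; split => //; apply: contrapT => no; apply: wv.
rewrite /wedge big1 ?mulr0 // => s _.
suff -> : wedge_pow dt q (fun b => v (s (rshift 1 b))) = 0 by rewrite mulr0.
by apply: contrapT => ?; apply: no; eexists; eassumption.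
Qed.

Lemma structure_constant_neq0 : mu != 0.
Proof.
have [r0 r1] := rank_form.
by apply: (tq (@mu_neq0_of_rank) xi_s xi_ss xi_bracket Wx r0 r1); rewrite addn1.
Qed.

Lemma mxtrace_A : \tr (A x) = mu * (4 * l + 3)%:R.
Proof.
have [r0 r1] := rank_form.
have := tq (@mxtrace_Amx) xi_s xi_ss xi_bracket Wx r0 r1 structure_constant_neq0.
by rewrite (_ : (2 * (2 * l + 1) + 1 = 4 * l + 3)%N) //; lia.
Qed.

Lemma distEm_A v : distEm eta i p v -> v *m A x = 0.
Proof.
move=> [vH [a va]]; apply: (tq (@Amx_ker) xi_s xi_ss xi_bracket Wx (a := a)) => [b|w].
  by rewrite /= chartK //; exact: vH.
by rewrite -dext_atE.
Qed.

Lemma ip_distEm_A v w : distEm eta i p v \/ distEm eta i p w ->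
  ip (g i p) (v *m A x) w = 0.
Proof.
move=> [/distEm_A ->|/distEm_A wA]; first exact: (g0l (ip_lin (g i p))).
rewrite -gp (tq (@Amx_sym) xi_s xi_ss xi_bracket Wx) wA.
exact: (g0r (ip_lin _) (gW_sym Wx)).
Qed.

Lemma distEl_A v : distEl eta g i p v -> v *m A x = mu *: v.
Proof.
move=> [vH v_orth]; apply: (tq (@Amx_image) xi_s xi_ss xi_bracket Wx).
- exact: structure_constant_neq0.
- by move=> b; rewrite /= chartK //; exact: vH.
move=> w wH [b wb]; rewrite gp; apply: v_orth; split => [b'|].
  by have := wH b'; rewrite /= chartK.
by exists b => z; rewrite dext_atE.
Qed.

Lemma distEl3_A v : distEl3 xi eta g i p v -> v *m A x = mu *: v.
Proof.
move=> [h hE [k ->]]; rewrite mulmxDl scalerDr distEl_A //; congr (_ + _).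
rewrite mulmx_suml scaler_sumr; apply: eq_bigr => a _.
have xiE : xi a i p = (xi a i)^ x by rewrite /= chartK.
rewrite xiE -scalemxAl (tq (@Amx_xi) xi_s xi_ss xi_bracket Wx a).
by rewrite scalerA mulrC -scalerA.
Qed.

Lemma ricci_A (U : set M) (X Y : M -> 'rV[R]_d) : open U -> U `<=` D ->
  smooth_at_chart i U X -> smooth_at_chart i U Y -> U p ->
  ricci i (g i) X Y p = (\tr (A x) - mu) * ip (g i p) (X p *m A x) (Y p).
Proof.
move=> oU UD sX sY Up.
have sgU : smooth_at_chart i U (g i).
  by move=> a b; apply: smooth_subset (sg a b) => _ [q Uq <-]; apply: DW; exact: UD.
have gsU q : U q -> forall v w, ip (g i q) v w = ip (g i q) w v by move=> /UD /g_sym.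
have gpU q : U q -> forall v, v != 0 -> 0 < ip (g i q) v v by move=> /UD /g_pos.
rewrite -gp -(tq (@ricci_mx) quat2 xi_s xi_ss xi_bracket structure_constant_neq0 Wx).
rewrite /ricci; apply: eq_bigr => a _; congr (fun_of_matrix _ 0 a).
exact: (curvatureE oU UD sgU gsU gpU _ sX sY Up).
Qed.

(** Contracting g(A u, v) with the inverse metric gives the trace of [A]. *)
Lemma scalar_curvature_A :
  scalar_curvature i (g i) p = (\tr (A x) - mu) * \tr (A x).
Proof.
have gt : (g i p)^T = g i p by exact: metric_tr (g_sym Dp).
have gu : g i p \in unitmx by exact: metric_unit (g_pos Dp).
have trE : \tr (A x) = \tr (invmx (g i p) *m (A x *m g i p)).
  by rewrite mxtrace_mulC -mulmxA mulmxV // mulmx1.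
have AgT j k : (A x *m g i p) k j = (A x *m g i p) j k.
  rewrite -[RHS]entryT trmx_mul gt -gp.
  by rewrite (tq (@Amx_tr) xi_s xi_ss xi_bracket Wx).
rewrite [X in _ * X]trE mulrC {1}/mxtrace mulr_suml /scalar_curvature; apply: eq_bigr => a _.
rewrite mxE mulr_suml; apply: eq_bigr => b _.
rewrite (ricci_A (@chart_dom_open _ _ M i) (fun q => id) (smooth_const_field i D _)
  (smooth_const_field i D _) Dp).
rewrite ip_delta -mulmxA -rowE [row _ _ 0 b]mxE AgT.
by rewrite -mulrA [in RHS](mulrC _ (_ - _)).
Qed.

End AtPoint.

End ThreeQuasiSasakianChart.

Theorem theorem5p11 (R : realType) (n l : nat) (hl : (l <= n)%N)
    (M : manifold R (4 * n + 3))
    (phi : 'I_3 -> mx_comps M) (xi : 'I_3 -> vec_comps M)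
    (eta : 'I_3 -> covec_comps M) (g : mx_comps M) (c : R)
    (hM : three_quasi_sasakian phi xi eta g)
    (hrank : rank_is eta (4 * l + 3))
    (hc : reeb_brackets xi c) :
  [/\ forall (i : atlas M) (U : set M), open U -> U `<=` chart_dom i ->
        forall X Y : M -> 'rV[R]_(4 * n + 3),
          section_on i U (distEl3 xi eta g i) X ->
          section_on i U (distEl3 xi eta g i) Y ->
        forall p, U p ->
          ricci i (g i) X Y p =
          c ^+ 2 / 2 * (2 * l + 1)%:R * ip (g i p) (X p) (Y p),
      forall (i : atlas M) (U : set M), open U -> U `<=` chart_dom i ->
        forall X Y : M -> 'rV[R]_(4 * n + 3),
          smooth_at_chart i U X -> smooth_at_chart i U Y ->
          section_on i U (distEm eta i) X \/ section_on i U (distEm eta i) Y ->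
        forall p, U p -> ricci i (g i) X Y p = 0
    & forall (i : atlas M) (p : M), chart_dom i p ->
        scalar_curvature i (g i) p =
          c ^+ 2 / 2 * (2 * l + 1)%:R * (4 * l + 3)%:R /\
        0 < scalar_curvature i (g i) p].
Proof.
(* With tr A = mu (4l + 3) this gives tr A - mu = 2 mu (2l + 1); the eigenvalue [mu] of [A] on
   E^{4l+3} and mu = c / 2 then yield c^2 / 2 times 2l + 1. *)
have E : (4 * l + 3)%:R = 2 * (2 * l + 1)%:R + 1 :> R.
  by rewrite -natrM -[1]/(1%:R) -natrD; congr _%:R; lia.
have k0 : 0 < (2 * l + 1)%:R :> R by rewrite ltr0n addn1.
split=> [i U oU Ui X Y [sX DX] [sY DY] p Up|i U oU Ui X Y sX sY XY p Up|i p Dp].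
- rewrite (ricci_A hM hrank hc (Ui _ Up) oU Ui sX sY Up) (mxtrace_A hM hrank hc (Ui _ Up)) E.
  rewrite (distEl3_A hM hrank hc (Ui _ Up) (DX p Up)) (gZl (ip_lin (g i p))).
  by move: (ip _ _ _) ((2 * l + 1)%:R : R) => q k; field.
- rewrite (ricci_A hM hrank hc (Ui _ Up) oU Ui sX sY Up).
  rewrite (ip_distEm_A hM hc (Ui _ Up)) ?mulr0 //.
  by case: XY => -[_ D]; [left|right]; exact: D.
have c0 := structure_constant_neq0 hM hrank hc Dp.
have -> : scalar_curvature i (g i) p = c ^+ 2 / 2 * (2 * l + 1)%:R * (4 * l + 3)%:R.
  rewrite (scalar_curvature_A hM hrank hc Dp) (mxtrace_A hM hrank hc Dp) E.
  by move: ((2 * l + 1)%:R : R) => k; field.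
split => //; apply: mulr_gt0; last by rewrite E; lra.
apply: mulr_gt0 => //; apply: divr_gt0 => //.
by rewrite exprn_even_gt0 //; apply: contra c0 => /eqP ->; rewrite mul0r.
Qed.
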